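(* There exists a positive constant $C$ such that for every $p = p(n)$ with $\frac{C\log n}{n} \le p \le 1$ and every graph $G$ on $n$ vertices of minimum degree at least $\frac{n}{2}$, the random subgraph $G_p$ is asymptotically almost surely Hamiltonian.
   Context: All graphs are finite and simple; $\log$ is the natural logarithm. For a graph $G$ and $p\in[0,1]$, $G_p$ denotes the random spanning subgraph of $G$ obtained by keeping each edge of $G$ independently with probability $p$. A graph is Hamiltonian if it contains a cycle passing through every vertex exactly once. ''Asymptotically almost surely'' (a.a.s.) means with probability tending to $1$ as $n\to\infty$, for any choice of a graph $G=G(n)$ and a probability $p=p(n)$ satisfying the hypotheses. *)

(* Defs.v *)
From HB Require Import structures.
From mathcomp Require Import all_boot all_order all_algebra.
From mathcomp Require Import all_classical all_reals all_analysis.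

Set Implicit Arguments.
Unset Strict Implicit.
Unset Printing Implicit Defensive.

Import Order.TTheory GRing.Theory Num.Theory.
Import numFieldNormedType.Exports.

Local Open Scope ring_scope.

Record sgraph (V : finType) := SGraph {
  edges : {set {set V}};
  edgesP : [forall e in edges, #|e| == 2%N] }.

HB.instance Definition _ (V : finType) := [isSub for @edges V].
HB.instance Definition _ (V : finType) := [Finite of sgraph V by <:].

Section Graphs.
Variable V : finType.
Implicit Types (G H : sgraph V) (x y : V).

(* Irreflexive, since [set x; x] has cardinal 1. *)
Definition adj G : rel V := fun x y => [set x; y] \in edges G.

Definition degree G x : nat := #|[set y | adj G x y]|.

(* Every degree is smaller than #|V|, so the neutral value #|V| only matters
   for the graph without vertices. *)
Definition min_degree G : nat := \big[minn/#|V|]_(x : V) degree G x.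

(* The bound on the size excludes the degenerate closed walks of length at
   most 2, which [cycle] accepts. *)
Definition hamiltonian G : Prop :=
  exists c : seq V,
    [/\ (2 < size c)%N, cycle (adj G) c, uniq c & forall x, x \in c].

End Graphs.

Section RandomSubgraph.
Variables (R : realType) (V : finType).
Implicit Types (G H : sgraph V) (p : R).

(* Probability that G_p = H: the edges of G are independent Bernoulli(p)
   trials, and G_p is always a spanning subgraph of G. *)
Definition Gp_mass G p H : R :=
  if edges H \subset edges G
  then \prod_(e in edges G) (if e \in edges H then p else 1 - p)
  else 0.

Definition Gp_prob G p (A : sgraph V -> Prop) : R :=
  \sum_(H : sgraph V | `[< A H >]) Gp_mass G p H.

End RandomSubgraph.

(* Main.v *)
(** The Hamiltonian cycles of G that contain a suitable small set F of edges form
    an O(1/n)-spread family: every set S of edges outside F is contained in at most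
    a fraction (K/n)^|S| of them.  This is shown by switching, i.e. by trading a
    prescribed edge for others through one, two or three Posa rotations in at
    least c n^k of the n^k possible ways (k the number of rotations).  The
    minimum-fragment argument of Frankston, Kahn, Narayanan and Park, in the form
    given by Park and Pham, halves the part of a random member not covered by a
    random set of density O(1/n); log n rounds cover a whole member.

    If no two sets of about n/2 vertices span few edges, F is empty.  Otherwise G
    is close to two disjoint cliques of size about n/2, or to a nearly balanced
    complete bipartite graph.  Then F is found in a first exposure of the random
    graph: two disjoint edges between the cliques, respectively a matching inside
    the larger class that makes up for the imbalance. *)

From mathcomp Require Import all_boot all_order all_algebra.
From mathcomp Require Import zify ring lra.

Set Implicit Arguments.
Unset Strict Implicit.
Unset Printing Implicit Defensive.

Import Order.TTheory GRing.Theory Num.Theory.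

(** * Product Bernoulli measures *)

Local Open Scope ring_scope.

(** Switchings protect only a small linear number of edges, so they bound the share of the cycles
    through S only while |S| is at most a small multiple of n. For larger S one counts: at most 4^n
    n^(n+1-|S|-|F|) vertex orderings contain S and F, and a loss exponential in n is only a constant
    per edge of S. This needs a family of at least n^(n-|F|) / C^n orderings, a bound that again
    comes from switching: Hamiltonian cycles are counted in a template (the complete graph, two
    cliques joined by F, a complete bipartite graph with F added), and the edges missing from G are
    then switched away one by one. This is why switchings are studied for cycles of the template and
    not only of G. Near an extremal structure the switchings bring in template edges only, so the
    few edges that overcome its obstruction (disconnection or imbalance) are never traded: they are
    frozen as F and must be found beforehand. *)

Section ProductMeasure.
Variables (R : realFieldType) (X : finType).
Implicit Types (p q x : R) (A B C D E W : {set X}).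

Definition bmass p W : R := \prod_(e : X) (if e \in W then p else 1 - p).

Lemma sum_set_prod (F : X -> bool -> R) :
  \sum_(W : {set X}) \prod_e F e (e \in W) = \prod_e (F e true + F e false).
Proof.
rewrite bigA_distr; apply: eq_bigr => W _; apply: eq_bigr => e _.
by case: (e \in W).
Qed.

Lemma bmass_ge0 p W : 0 <= p <= 1 -> 0 <= bmass p W.
Proof.
by move=> /andP[p0 p1]; apply: prodr_ge0 => e _; case: ifP => _; rewrite ?subr_ge0.
Qed.

Lemma sum_bmass p : \sum_W bmass p W = 1.
Proof.
rewrite (sum_set_prod (fun _ b => if b then p else 1 - p)) big1 // => e _.
by rewrite addrC subrK.
Qed.

Lemma prod_indicator (b : X -> bool) : \prod_e (b e)%:R = [forall e, b e]%:R :> R.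
Proof.
case: forallP => [Hb|/forallP /forallPn [e /negPf He]]; first by rewrite big1 // => e _; rewrite Hb.
by rewrite (bigD1 e) //= He mul0r.
Qed.

Lemma sum_bmass_restrict p E A : A \subset E ->
  \sum_(W | W :&: E == A) bmass p W = \prod_(e in E) (if e \in A then p else 1 - p).
Proof.
move=> AE; rewrite big_mkcond.
rewrite (eq_bigr (fun W => \prod_e ((if e \in W then p else 1 - p) *
   (if e \in E then ((e \in W) == (e \in A))%:R else 1)))); last first.
  move=> W _; rewrite big_split /= -/(bmass p W).
  rewrite (eq_bigr (fun e => ((e \in E) ==> ((e \in W) == (e \in A)))%:R)); last first.
    by move=> e _; case: (e \in E).
  rewrite prod_indicator; case: ifPn => [/eqP HW|HW].
    suff -> : [forall e, (e \in E) ==> ((e \in W) == (e \in A))] by rewrite mulr1.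
    by apply/forallP => e; apply/implyP => He; rewrite -HW inE He andbT.
  case: forallP => [H|]; last by rewrite mulr0.
  case/eqP: HW; apply/setP => e; rewrite inE.
  case: (boolP (e \in E)) => He; last by rewrite andbF; apply/esym/negP => /(subsetP AE); apply/negP.
  by have := H e; rewrite He andbT => /eqP.
rewrite (sum_set_prod (fun e b => (if b then p else 1 - p) *
   (if e \in E then (b == (e \in A))%:R else 1))).
rewrite [RHS]big_mkcond /=; apply: eq_bigr => e _.
by case: (e \in E); case: (e \in A) => /=; rewrite ?mulr1 ?mulr0 ?addr0 ?add0r // addrC subrK.
Qed.

(** Passes from a random subset of all of [X] to a random subset of [E]; this is how the random
    subgraph of a graph is later read as the trace of a random set on its edges. *)
Lemma sum_bmass_inter p E (f : {set X} -> R) :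
  \sum_W bmass p W * f (W :&: E) =
  \sum_(A : {set X} | A \subset E) (\prod_(e in E) (if e \in A then p else 1 - p)) * f A.
Proof.
rewrite (partition_big (fun W => W :&: E) (fun A => A \subset E)) /=; last first.
  by move=> W _; apply: subsetIr.
apply: eq_bigr => A AE; rewrite -sum_bmass_restrict // mulr_suml.
by apply: eq_bigr => W /eqP ->.
Qed.

Lemma sum_bmass_avoid p D : \sum_(W | W :&: D == set0) bmass p W = (1 - p) ^+ #|D|.
Proof.
rewrite sum_bmass_restrict ?sub0set //.
under eq_bigr do rewrite inE; by rewrite prodr_const.
Qed.

(** Two independent exposures: an element escapes the union with probability (1-p)(1-q). The masses
    and the condition [A :|: B == C] all factor over the elements, so the double sum is a product of
    four-term sums. *)
Lemma bmass_setU p q (f : {set X} -> R) :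
  \sum_A \sum_B bmass p A * bmass q B * f (A :|: B)
    = \sum_C bmass (p + q - p * q) C * f C.
Proof.
under eq_bigr => A _ do rewrite (partition_big (fun B => A :|: B) predT) //=.
rewrite exchange_big /=; apply: eq_bigr => C _.
pose g (e : X) (a b : bool) : R := (if a then p else 1 - p) * (if b then q else 1 - q) *
   ((a || b) == (e \in C))%:R.
transitivity (\sum_(A : {set X}) \sum_(B : {set X}) (\prod_e g e (e \in A) (e \in B)) * f C).
  apply: eq_bigr => A _; rewrite big_mkcond; apply: eq_bigr => B _.
  rewrite /g !big_split /= -/(bmass p A) -/(bmass q B) prod_indicator.
  have -> : [forall e, (e \in A) || (e \in B) == (e \in C)] = (A :|: B == C).
    apply/forallP/eqP => [H|<- e]; last by rewrite inE.
    by apply/setP => e; rewrite inE; apply/eqP.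
  by case: eqP => [->|_]; rewrite ?mulr1 // mulr0 mul0r.
under eq_bigr => A _ do rewrite -mulr_suml (sum_set_prod (fun e => g e (e \in A))).
rewrite -mulr_suml (sum_set_prod (fun e a => g e a true + g e a false)).
congr (_ * _); apply: eq_bigr => e _; rewrite /g.
by case: (e \in C) => /=; ring.
Qed.

Definition Ebern p (f : {set X} -> R) : R := \sum_W bmass p W * f W.

Lemma Ebern_le p f g : 0 <= p <= 1 -> (forall W, f W <= g W) -> Ebern p f <= Ebern p g.
Proof. by move=> hp fg; apply: ler_sum => W _; rewrite ler_wpM2l // bmass_ge0. Qed.

Lemma EbernC p c : Ebern p (fun _ => c) = c.
Proof. by rewrite /Ebern -mulr_suml sum_bmass mul1r. Qed.

Lemma EbernD p f g : Ebern p (fun W => f W + g W) = Ebern p f + Ebern p g.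
Proof. by rewrite /Ebern -big_split; apply: eq_bigr => W _; rewrite mulrDr. Qed.

Lemma EbernN p f : Ebern p (fun W => - f W) = - Ebern p f.
Proof. by rewrite /Ebern -sumrN; apply: eq_bigr => W _; rewrite mulrN. Qed.

Lemma EbernZ p c f : Ebern p (fun W => c * f W) = c * Ebern p f.
Proof. by rewrite /Ebern mulr_sumr; apply: eq_bigr => W _; rewrite mulrCA. Qed.

Lemma Ebern_sum p (I : finType) (P : pred I) (f : I -> {set X} -> R) :
  Ebern p (fun W => \sum_(i | P i) f i W) = \sum_(i | P i) Ebern p (f i).
Proof. by rewrite /Ebern exchange_big; apply: eq_bigr => W _; rewrite mulr_sumr. Qed.

Lemma EbernU p q f :
  Ebern p (fun A => Ebern q (fun B => f (A :|: B))) = Ebern (p + q - p * q) f.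
Proof.
rewrite /Ebern -bmass_setU; apply: eq_bigr => A _; rewrite mulr_sumr.
by apply: eq_bigr => B _; rewrite mulrA.
Qed.

(** Sprinkling: density q is reached from density p by adding an independent set of density
    (q-p)/(1-p). *)
Lemma Ebern_mono p q f : 0 <= p -> p <= q -> q <= 1 ->
  (forall A B, A \subset B -> f A <= f B) -> Ebern p f <= Ebern q f.
Proof.
move=> p0 pq q1 fmono.
have [->//|npq] := eqVneq p q.
have p1 : 0 < 1 - p by rewrite subr_gt0; apply: lt_le_trans q1; rewrite lt_neqAle npq.
pose r := (q - p) / (1 - p).
have hr : 0 <= r <= 1.
  apply/andP; split; first by apply: divr_ge0; lra.
  by rewrite ler_pdivrMr // mul1r; lra.
have -> : q = p + r - p * r by rewrite /r; field; lra.
rewrite -EbernU; apply: Ebern_le; first by rewrite p0 (le_trans pq).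
move=> A; rewrite -[leLHS](EbernC r); apply: Ebern_le => // B.
by apply: fmono; apply: subsetUl.
Qed.

Lemma sum_expr_subset x A : \sum_(T : {set X} | T \subset A) x ^+ #|T| = (1 + x) ^+ #|A|.
Proof.
rewrite -prodr_const [RHS]big_mkcond /=.
transitivity (\prod_e ((if e \in A then x else 0) + 1)); last first.
  by apply: eq_bigr => e _; case: ifP => _; rewrite ?add0r // addrC.
rewrite -(sum_set_prod (fun e (b : bool) => if b then (if e \in A then x else 0) else 1)).
rewrite big_mkcond; apply: eq_bigr => T _; case: ifPn => [TA|/subsetPn[e eT eA]].
  rewrite -prodr_const big_mkcond; apply: eq_bigr => e _.
  by case: ifP => // eT; rewrite (subsetP TA).
by rewrite (bigD1 e) //= eT (negPf eA) mul0r.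
Qed.

End ProductMeasure.

(** * Spread families and fragmentation *)

Lemma expr1D_le (R : realFieldType) (x : R) (k : nat) :
  0 <= x -> 2 * k%:R * x <= 1 -> (1 + x) ^+ k <= 1 + 2 * k%:R * x.
Proof.
move=> x0; elim: k => [|k IH] hk; first by rewrite expr0 mulr0 mul0r addr0.
have hk' : 2 * k%:R * x <= 1.
  by apply: le_trans hk; rewrite -natr1; nra.
rewrite exprS; have := IH hk'; set y := _ ^+ k => hy.
have k0 : 0 <= k%:R :> R by [].
rewrite -natr1 in hk *.
have : (1 + x) * y <= (1 + x) * (1 + 2 * k%:R * x) by rewrite ler_wpM2l //; lra.
nra.
Qed.

Section Fragments.
Variables (R : realFieldType) (X I : finType).
Implicit Types (p q N : R) (S T W Z : {set X}) (Om : {set I}) (h : I -> {set X}).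

(** Members are counted by index, so all orderings of one cycle count separately. *)
Definition spread Om h q N :=
  forall S, #|[set w in Om | S \subset h w]|%:R <= q ^+ #|S| * N.

Definition uncovered Om h W := ~~ [exists w in Om, h w \subset W].

(* The minimum fragment of Park and Pham; meaningful only for [w \in Om], where
   [w] itself is a candidate. *)
Definition frag Om h W (w : I) : {set X} :=
  h [arg min_(w' < w | (w' \in Om) && (h w' \subset W :|: h w)) #|h w' :\: W|] :\: W.

Lemma fragP Om h W w : w \in Om ->
  exists w', [/\ w' \in Om, frag Om h W w = h w' :\: W, h w' \subset W :|: h w &
    forall w'', w'' \in Om -> h w'' \subset W :|: h w -> (#|frag Om h W w| <= #|h w'' :\: W|)%N].
Proof.
move=> wOm; rewrite /frag; case: arg_minnP => [|w' /andP[w'Om sub] hmin].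
  by rewrite wOm subsetUr.
by exists w'; split=> // w'' ? ?; apply: hmin; apply/andP.
Qed.

Lemma frag_sub Om h W w : w \in Om -> frag Om h W w \subset h w.
Proof.
move=> /(fragP h W) [w' [_ -> sub _]].
by rewrite subDset.
Qed.

(** One fixed member inside [Z], chosen from [Z] alone; [set0] is a default for the case that there
    is none. *)
Definition star Om h Z : {set X} :=
  if [pick w | (w \in Om) && (h w \subset Z)] is Some w then h w else set0.

(* If [T] is the fragment of [h w] with respect to [W], then every member of
   the family inside [W :|: T] contains [T]: this is what makes [T]
   recoverable, up to [2 ^ l] choices, from [W :|: T] alone. *)
Lemma frag_star Om h W w : w \in Om ->
  [exists w' in Om, h w' \subset W :|: frag Om h W w] &&
  (frag Om h W w \subset star Om h (W :|: frag Om h W w)).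
Proof.
move=> wOm; have [w' [w'Om Efr sub hmin]] := fragP h W wOm.
have sub' : h w' \subset W :|: frag Om h W w by rewrite Efr -subDset.
apply/andP; split; first by apply/existsP; exists w'; rewrite w'Om.
rewrite /star; case: pickP => [w0 /andP[w0Om sub0]|/(_ w')]; last by rewrite w'Om sub'.
have sub1 : h w0 :\: W \subset frag Om h W w by rewrite subDset.
have : h w0 :\: W == frag Om h W w.
  rewrite eqEcard sub1 hmin //; apply: subset_trans sub0 _.
  by rewrite setUS // frag_sub.
by move=> /eqP <-; apply: subsetDl.
Qed.

(** On each element of [T] the factor 1-p becomes p, and (1-p)p is at most p. *)
Lemma bmass_add p W T : 0 <= p <= 1 -> [disjoint W & T] ->
  bmass p W * p ^+ #|T| <= bmass p (W :|: T).
Proof.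
move=> /andP[p0 p1] dWT; rewrite -prodr_const [X in _ * X]big_mkcond -big_split /=.
apply: ler_prod => e _; rewrite inE.
case: (boolP (e \in T)) => [eT|_]; last by rewrite orbF mulr1 lexx andbT; case: ifP; lra.
rewrite orbT (disjointFl dWT eT).
by apply/andP; split; nra.
Qed.

(** The counting argument behind fragmentation. A pair (W, w) with fragment T is encoded by Z = W
    :|: T, by T and by w. Going from W to Z costs a factor p^-|T|; T is a subset of the member
    [star Om h Z]; and w is one of at most q^|T| N indices whose member contains T. What remains for
    each Z is the sum over T bounded by [B]. *)
Lemma frag_moment Om h q N p (phi : nat -> R) (B : R) :
  0 < q -> 0 <= N -> 0 < p <= 1 -> (forall t, 0 <= phi t) -> 0 <= B -> spread Om h q N ->
  (forall w, w \in Om -> \sum_(T : {set X} | T \subset h w) (q / p) ^+ #|T| * phi #|T| <= B) ->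
  Ebern p (fun W => \sum_(w in Om) phi #|frag Om h W w|) <= N * B.
Proof.
move=> q0 N0 /andP[p0 p1] phi0 B0 hs hB.
have hp : 0 <= p <= 1 by rewrite ltW.
pose Q Z := [exists w in Om, h w \subset Z].
(* For fixed [w] and [T] the set [W] is recovered from [W :|: T], because a fragment is disjoint
   from its [W]. *)
have step1 w T : w \in Om ->
  \sum_(W | frag Om h W w == T) bmass p W <=
  (T \subset h w)%:R * \sum_(Z | Q Z && (T \subset star Om h Z)) bmass p Z * p ^- #|T|.
  move=> wOm; case: (boolP (T \subset h w)) => [_|nT]; last first.
    rewrite mul0r big1 // => W /eqP E; by case/negP: nT; rewrite -E frag_sub.
  rewrite mul1r.
  pose D := [set W | frag Om h W w == T].
  have dis W : W \in D -> [disjoint W & T].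
    rewrite inE => /eqP <-; have [w' [_ -> _ _]] := fragP h W wOm.
    by rewrite disjoint_sym disjoints_subset setDE subsetIr.
  have inj : {in D &, injective (fun W => W :|: T)}.
    move=> W1 W2 /dis d1 /dis d2 E.
    have: (W1 :|: T) :\: T = (W2 :|: T) :\: T by rewrite E.
    rewrite !setDUl setDv !setU0.
    by rewrite !(setDidPl _).
  apply: (@le_trans _ _ (\sum_(W in D) bmass p (W :|: T) * p ^- #|T|)).
    rewrite [leLHS](eq_bigl (mem D)); last by move=> W; rewrite !inE.
    apply: ler_sum => W WD; rewrite ler_pdivlMr ?exprn_gt0 //.
    by apply: bmass_add => //; apply: dis.
  rewrite -(big_imset (fun Z => bmass p Z * p ^- #|T|) inj) /=.
  rewrite big_mkcond [leRHS]big_mkcond /=; apply: ler_sum => Z _.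
  have pos : 0 <= bmass p Z * p ^- #|T| by rewrite mulr_ge0 ?bmass_ge0 // invr_ge0 exprn_ge0 // ltW.
  case: imsetP => [[W]|]; last by case: ifP.
  rewrite inE => /eqP <- ->.
  by have := frag_star h W wOm; rewrite /Q => ->.
apply: (@le_trans _ _ (\sum_(w in Om) \sum_(T : {set X} | T \subset h w)
   \sum_(Z | Q Z && (T \subset star Om h Z)) bmass p Z * p ^- #|T| * phi #|T|)).
  rewrite Ebern_sum; apply: ler_sum => w wOm; rewrite /Ebern.
  rewrite (partition_big (fun W => frag Om h W w) predT) //= [leRHS]big_mkcond /=.
  apply: ler_sum => T _.
  rewrite (eq_bigr (fun W => bmass p W * phi #|T|)); last by move=> W /eqP ->.
  rewrite -mulr_suml; have := step1 w T wOm.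
  case: (T \subset h w); rewrite ?mul0r ?mul1r => h1.
    by rewrite -mulr_suml; apply: ler_wpM2r.
  by apply: mulr_le0_ge0.
rewrite (eq_bigr (fun w => \sum_(Z | Q Z) \sum_(T : {set X} | T \subset star Om h Z)
   bmass p Z * p ^- #|T| * phi #|T| * (T \subset h w)%:R)); last first.
  move=> w wOm; rewrite [RHS](exchange_big_dep predT) //= [LHS]big_mkcond /=.
  apply: eq_bigr => T _; rewrite -[RHS]mulr_suml.
  case: (T \subset h w); rewrite ?mulr0 ?mulr1 //.
rewrite exchange_big /=.
apply: (@le_trans _ _ (\sum_Z bmass p Z * (N * B))); last by rewrite -mulr_suml sum_bmass mul1r.
rewrite [leLHS]big_mkcond; apply: ler_sum => Z _.
case: ifPn => [QZ|_]; last by rewrite mulr_ge0 ?bmass_ge0 // mulr_ge0.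
rewrite exchange_big /=.
(* Since [Q Z] holds, [star] is a genuine member and the bound [B] applies to it. *)
have [w0 w0Om Est] : exists2 w0, w0 \in Om & star Om h Z = h w0.
  rewrite /star; case: pickP => [w /andP[? _]|H]; first by exists w.
  by have /existsP [w] := QZ; rewrite H.
rewrite Est.
apply: (@le_trans _ _ (bmass p Z * (N * \sum_(T : {set X} | T \subset h w0) (q / p) ^+ #|T| * phi #|T|))); last first.
  by rewrite ler_wpM2l ?bmass_ge0 // ler_wpM2l // hB.
rewrite !mulr_sumr; apply: ler_sum => T _.
rewrite -[leLHS]mulr_sumr -natr_sum.
have -> : (\sum_(i in Om) (T \subset h i) = #|[set w in Om | T \subset h w]|)%N.
  by rewrite -sum1dep_card big_mkcondr; apply: eq_bigr => w _; case: (T \subset h w).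
rewrite expr_div_n -!mulrA ler_wpM2l ?bmass_ge0 //.
have := hs T; set c := #|_|%:R => hc.
have -> : N * (q ^+ #|T| * (p ^- #|T| * phi #|T|)) = p ^- #|T| * (phi #|T| * (q ^+ #|T| * N)) by ring.
by rewrite ler_wpM2l ?invr_ge0 ?exprn_ge0 ?(ltW p0) // ler_wpM2l.
Qed.

Lemma spread_card Om h q N : spread Om h q N -> #|Om|%:R <= N.
Proof.
move/(_ set0); rewrite cards0 expr0 mul1r => hN; apply: le_trans hN.
by rewrite ler_nat; apply: subset_leq_card; apply/subsetP => w wO; rewrite inE wO sub0set.
Qed.

(** If [W] contains no member, then every fragment is nonempty and the number of nonempty fragments
    is #|Om|. Its expectation is bounded by [frag_moment] with the indicator of t != 0. *)
Lemma final_round Om h q N p (l : nat) :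
  0 < q -> 0 <= N -> 0 < p <= 1 -> spread Om h q N -> (forall w, w \in Om -> (#|h w| <= l)%N) ->
  N * Ebern p (fun W => (uncovered Om h W)%:R) <= N - #|Om|%:R + N * ((1 + q / p) ^+ l - 1).
Proof.
move=> q0 N0 hp hs hl.
have hp' : 0 <= p <= 1 by case/andP: hp => /ltW ->.
have qp0 : 0 <= q / p by case/andP: hp => *; apply: divr_ge0; apply: ltW.
have hmom := @frag_moment Om h q N p (fun t => (t != 0)%N%:R) ((1 + q / p) ^+ l - 1) q0 N0 hp.
have /hmom {}hmom : forall t, 0 <= (t != 0)%N%:R :> R by [].
have B0 : 0 <= (1 + q / p) ^+ l - 1 by rewrite subr_ge0 exprn_ege1 // lerDl.
have {}hmom := hmom B0 hs.
rewrite -EbernZ.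
apply: (@le_trans _ _ (Ebern p (fun W => N - #|Om|%:R + \sum_(w in Om) (#|frag Om h W w| != 0)%N%:R))); last first.
  rewrite EbernD EbernC lerD2l; apply: hmom => w wOm.
  have -> : \sum_(T : {set X} | T \subset h w) (q / p) ^+ #|T| * (#|T| != 0)%N%:R = (1 + q / p) ^+ #|h w| - 1.
    rewrite -sum_expr_subset [in RHS](bigD1 set0) ?sub0set //= cards0 expr0 addrAC subrr add0r.
    rewrite [LHS]big_mkcond [RHS]big_mkcond /=; apply: eq_bigr => T _.
    by rewrite cards_eq0; case: (T \subset h w) => //=; case: eqP; rewrite ?mulr0 ?mulr1.
  by rewrite lerD2r ler_weXn2l ?hl // lerDl.
apply: Ebern_le => // W; have hO := spread_card hs.
case: (boolP (uncovered Om h W)) => [unc|_]; last first.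
  by rewrite mulr0 addr_ge0 ?subr_ge0 // sumr_ge0.
rewrite mulr1 (eq_bigr (fun=> 1)); first by rewrite sumr_const -mulr_natr mul1r subrK.
move=> w wOm; rewrite (_ : (_ != _)%N = true) // cards_eq0.
have [w' [w'Om -> _ _]] := fragP h W wOm.
rewrite setD_eq0; apply/negP => sub; case/negP: unc.
by apply/existsP; exists w'; rewrite w'Om.
Qed.

(* The family may be smaller than [N], the constant in its spread bound:
   passing to the members with a small fragment keeps [N], and the members
   lost are charged to [N - #|Om|]. *)
Definition covers (q N P d : R) (l : nat) :=
  forall p Om h, P <= p -> p <= 1 -> spread Om h q N -> (forall w, w \in Om -> (#|h w| <= l)%N) ->
  N * Ebern p (fun W => (uncovered Om h W)%:R) <= N - #|Om|%:R + N * d.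

Lemma uncovered_anti Om h (A B : {set X}) : A \subset B -> (uncovered Om h B <= uncovered Om h A)%N.
Proof.
move=> AB; rewrite /uncovered; case: (boolP [exists w in Om, h w \subset A]) => [|_].
  by case/existsP => w /andP[wO wA]; rewrite (_ : [exists w in Om, h w \subset B]) //;
    apply/existsP; exists w; rewrite wO (subset_trans wA).
by case: (~~ _).
Qed.

Lemma Ebern_uncovered_anti Om h p p' : 0 <= p -> p <= p' -> p' <= 1 ->
  Ebern p' (fun W => (uncovered Om h W)%:R) <= Ebern p (fun W => (uncovered Om h W)%:R).
Proof.
move=> p0 pp p1; rewrite -lerN2 -!EbernN; apply: Ebern_mono => // A B AB.
by rewrite lerN2 ler_nat uncovered_anti.
Qed.

(** One round of density 64q. A fragment with more than l elements has weight at most 64^-l =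
    8^-(2l), against 2^(2l) subsets of a member, so the expected number of indices with such a
    fragment is at most 16^-l N. The remaining fragments are a spread family with the same q and N
    and with sets of size at most l; a second random set that covers one of them completes a member,
    as a fragment is some member minus [W]. *)
Lemma covers_double q N P d l : 0 < q -> 0 <= N -> 0 <= P -> covers q N P d l ->
  covers q N (64 * q + P) (d + 16^-1 ^+ l) l.*2.
Proof.
move=> q0 N0 P0 hc p Om h Pp p1 hs hl.
have hq : 0 < 64 * q <= 1 by lra.
have hq' : 0 <= 64 * q <= 1 by lra.
apply: (@le_trans _ _ (N * Ebern (64 * q + P - 64 * q * P) (fun W => (uncovered Om h W)%:R))).
  rewrite ler_wpM2l //; apply: Ebern_uncovered_anti => //; nra.
rewrite -EbernU -EbernZ.
apply: (@le_trans _ _ (Ebern (64 * q) (fun W =>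
    N - #|Om|%:R + N * d + \sum_(w in Om) (l < #|frag Om h W w|)%N%:R))); last first.
  rewrite EbernD EbernC -addrA lerD2l mulrDr lerD2l.
  apply: (@frag_moment Om h q N (64 * q) (fun t => (l < t)%N%:R)) => // [|w wOm].
    by rewrite exprn_ge0 // invr_ge0.
  apply: (@le_trans _ _ (\sum_(T : {set X} | T \subset h w) 8^-1 ^+ l.*2)).
    apply: ler_sum => T _; case: ltnP => lT; last by rewrite mulr0 exprn_ge0 // invr_ge0.
    have -> : q / (64 * q) = 8^-1 ^+ 2 by field; lra.
    rewrite mulr1 -exprM; apply: ler_wiXn2l; rewrite ?invr_ge0 ?invf_le1 ?ler1n //; lia.
  rewrite sumr_const -[leLHS]mulr_natr.
  have -> : #|[pred T : {set X} | T \subset h w]| = (2 ^ #|h w|)%N.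
    by rewrite -card_powerset; apply: eq_card => T; rewrite !inE.
  apply: (@le_trans _ _ (8^-1 ^+ l.*2 * (2 ^ l.*2)%:R)).
    by rewrite ler_wpM2l ?exprn_ge0 ?invr_ge0 // ler_nat leq_exp2l // hl.
  rewrite natrX -exprMn -muln2 mulnC exprM.
  have -> : (8^-1 * 2) ^+ 2 = 16^-1 :> R by field.
  by [].
apply: Ebern_le => // W.
pose Om' := [set w in Om | (#|frag Om h W w| <= l)%N].
have hs' : spread Om' (frag Om h W) q N.
  move=> S; apply: le_trans (hs S); rewrite ler_nat; apply: subset_leq_card.
  apply/subsetP => w; rewrite !inE => /andP[/andP[wO _] wS].
  by rewrite wO (subset_trans wS) // frag_sub.
have P1 : P <= 1 by lra.
have := hc P Om' (frag Om h W) (lexx _) P1 hs'.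
have hl' : forall w, w \in Om' -> (#|frag Om h W w| <= l)%N by move=> w; rewrite inE => /andP[].
move=> /(_ hl') hle.
apply: (@le_trans _ _ (N * Ebern P (fun B => (uncovered Om' (frag Om h W) B)%:R))).
  rewrite ler_wpM2l //; apply: Ebern_le; first by rewrite P0.
  move=> B; rewrite ler_nat /uncovered; case: (boolP [exists w in Om', frag Om h W w \subset B]); last first.
    by move=> _; apply: leq_b1.
  case/existsP => w; rewrite inE => /andP[/andP[wO _] wB].
  have [w' [w'O E _ _]] := fragP h W wO.
  rewrite (_ : [exists w in Om, h w \subset W :|: B]) //.
  by apply/existsP; exists w'; rewrite w'O -subDset -E.
apply: (le_trans hle).
have -> : #|Om|%:R = #|Om'|%:R + \sum_(w in Om) (l < #|frag Om h W w|)%N%:R :> R.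
  rewrite -natr_sum -natrD; congr (_%:R).
  rewrite -[in LHS]sum1_card -sum1_card [in X in (_ = X + _)%N](eq_bigl (fun w => (w \in Om) && (#|frag Om h W w| <= l)%N)); last first.
    by move=> w; rewrite inE.
  rewrite big_mkcondr -big_split /=; apply: eq_bigr => w _; by case: ltnP.
lra.
Qed.

(** Each doubling adds 64q to the density, while the losses 16^-(2^i m) are at most 2^-(i+1)/m and
    sum to less than 1/m. *)
Lemma covers_pow q N P d m r : 0 < q -> 0 <= N -> 0 <= P -> (0 < m)%N -> covers q N P d m ->
  covers q N (64 * r%:R * q + P) (d + (1 - 2^-1 ^+ r) / m%:R) (2 ^ r * m)%N.
Proof.
move=> q0 N0 P0 m0 hc; elim: r => [|r IH].
  by rewrite mulr0 mul0r add0r expr0 subrr mul0r addr0 mul1n.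
have P0' : 0 <= 64 * r%:R * q + P by rewrite addr_ge0 // !mulr_ge0 // ltW.
have := covers_double q0 N0 P0' IH.
have -> : 64 * q + (64 * r%:R * q + P) = 64 * r.+1%:R * q + P by rewrite -natr1; ring.
have -> : (2 ^ r * m).*2 = (2 ^ r.+1 * m)%N by rewrite expnS; lia.
move=> H p Om h Pp p1 hs hl; apply: (le_trans (H p Om h Pp p1 hs hl)).
rewrite lerD2l ler_wpM2l // -addrA lerD2l.
have m0R : 0 < m%:R :> R by rewrite ltr0n.
have : 16^-1 ^+ (2 ^ r * m) <= 2^-1 ^+ r.+1 / m%:R :> R.
  rewrite -ler_pdivrMr ?invr_gt0 // invrK.
  apply: (@le_trans _ _ (2^-1 ^+ (4 * (2 ^ r * m)) * 2 ^+ m)).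
    have -> : 16^-1 = 2^-1 ^+ 4 :> R by field.
     rewrite [X in _ <= X * _]exprM ler_wpM2l ?exprn_ge0 ?invr_ge0 //.
    by rewrite -natrX ler_nat ltnW // ltn_expl.
  have hr : (r.+1 <= 2 ^ r)%N by apply: ltn_expl.
  have -> : (4 * (2 ^ r * m) = m + (4 * (2 ^ r * m) - m))%N by nia.
  rewrite exprD mulrAC -exprMn (_ : 2^-1 * 2 = 1 :> R); last by field.
  rewrite expr1n mul1r.
  apply: ler_wiXn2l; rewrite ?invr_ge0 ?invf_le1 ?ler1n //; nia.
have -> : (1 - 2^-1 ^+ r.+1) / m%:R = (1 - 2^-1 ^+ r) / m%:R + 2^-1 ^+ r.+1 / m%:R :> R.
  by rewrite exprS; field; rewrite gt_eqF.
lra.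
Qed.

(** The halving stops at size m rather than 1, since its losses are small only for large sets. A
    last round of density m^2 q then fails with share at most (1+1/m^2)^m - 1 <= 2/m, and the
    halving rounds add 1/m. *)
Lemma spread_uncovered Om h q (n m : nat) p :
  0 < q -> (0 < #|Om|)%N -> (2 <= m)%N -> spread Om h q #|Om|%:R ->
  (forall w, w \in Om -> (#|h w| <= n)%N) ->
  (64 * (trunc_log 2 n).+1%:R + m%:R ^+ 2) * q <= p -> p <= 1 ->
  Ebern p (fun W => (uncovered Om h W)%:R) <= 3 / m%:R.
Proof.
move=> q0 O0 m2 hs hl hp p1; set tl := trunc_log 2 n in hp.
have m0R : 0 < m%:R :> R by rewrite ltr0n; lia.
have m2R : 2 <= m%:R :> R by rewrite ler_nat.
have N0 : 0 < #|Om|%:R :> R by rewrite ltr0n.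
pose P := m%:R ^+ 2 * q.
have P0 : 0 < P by rewrite mulr_gt0 ?exprn_gt0.
have base : covers q #|Om|%:R P (2 / m%:R) m.
  move=> p' Om' h' Pp' p1' hs' hl'.
  have hp' : 0 < p' <= 1 by rewrite (lt_le_trans P0).
  apply: (le_trans (final_round q0 (ltW N0) hp' hs' hl')).
  rewrite lerD2l ler_wpM2l ?(ltW N0) //.
  have x0 : 0 <= q / p' by rewrite divr_ge0 // ltW //; case/andP: hp'.
  have xle : q / p' <= m%:R ^- 2.
    case/andP: hp' => p0' _.
    rewrite ler_pdivrMr // ler_pdivlMl ?exprn_gt0 //.
  have hx : 2 * m%:R * (q / p') <= 2 / m%:R.
    have -> : 2 / m%:R = 2 * m%:R * m%:R ^- 2 :> R by field; rewrite gt_eqF.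
    by rewrite ler_wpM2l // mulr_ge0 // ltW.
  have h2 : 2 / m%:R <= 1 :> R by rewrite ler_pdivrMr // mul1r.
  have := expr1D_le x0 (le_trans hx h2); lra.
have m0 : (0 < m)%N by lia.
have hpow := covers_pow (r := tl.+1) q0 (ltW N0) (ltW P0) m0 base.
have hp' : 64 * tl.+1%:R * q + P <= p by apply: le_trans hp; rewrite /P [leRHS]mulrDl lexx.
have := hpow p Om h hp' p1 hs.
have hl' : forall w, w \in Om -> (#|h w| <= 2 ^ tl.+1 * m)%N.
  move=> w wO; apply: (leq_trans (hl w wO)).
  have : (n < 2 ^ tl.+1)%N by apply: trunc_log_ltn.
  nia.
move=> /(_ hl'); rewrite subrr add0r ler_pM2l // => H; apply: (le_trans H).
have : (1 - 2^-1 ^+ tl.+1) / m%:R <= 1 / m%:R :> R.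
  by rewrite ler_pM2r ?invr_gt0 // gerBl exprn_ge0 // invr_ge0.
have -> : 3 / m%:R = 2 / m%:R + 1 / m%:R :> R by field; rewrite gt_eqF.
lra.
Qed.

End Fragments.

Local Close Scope ring_scope.

(** * Edge sets of vertex sequences and Posa rotations *)

Lemma set2_eq (T : finType) (a b c d : T) : [set a; b] = [set c; d] ->
  (a = c /\ b = d) \/ (a = d /\ b = c).
Proof.
move=> E.
have: a \in [set c; d] by rewrite -E set21.
have: b \in [set c; d] by rewrite -E set22.
have: c \in [set a; b] by rewrite E set21.
have: d \in [set a; b] by rewrite E set22.
rewrite !inE => /orP[] /eqP -> /orP[] /eqP -> /orP[] /eqP ? /orP[] /eqP ?; subst; auto.
Qed.

(** Double counting for switchings: [good s] lists the switchings of [s], and the result of a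
    switching must determine both its source and the choice made. *)
Lemma card_pairs_le (S J U : finType) (D : {set S}) (good : S -> {set J}) (f : S -> J -> U) (B : {set U}) :
  (forall s j, s \in D -> j \in good s -> f s j \in B) ->
  (forall s s' j j', s \in D -> s' \in D -> j \in good s -> j' \in good s' ->
     f s j = f s' j' -> s = s' /\ j = j') ->
  \sum_(s in D) #|good s| <= #|B|.
Proof.
move=> hB inj.
pose P := [set sj : S * J | (sj.1 \in D) && (sj.2 \in good sj.1)].
have -> : \sum_(s in D) #|good s| = #|P|.
  rewrite -sum1_card (eq_bigl (fun sj : S * J => (sj.1 \in D) && (sj.2 \in good sj.1))); last first.
    by move=> sj; rewrite inE.
  rewrite -(pair_big_dep (mem D) (fun s j => j \in good s) (fun _ _ => 1)) /=.
  by apply: eq_bigr => s _; rewrite sum1_card.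
rewrite -(card_in_imset (f := fun sj : S * J => f sj.1 sj.2) (D := mem P)).
  apply: subset_leq_card; apply/subsetP => u /imsetP [[s j]]; rewrite inE /= => /andP[? ?] ->.
  exact: hB.
move=> [s j] [s' j']; rewrite !inE /= => /andP[h1 h2] /andP[h3 h4] E.
by have [-> ->] := inj s s' j j' h1 h3 h2 h4 E.
Qed.

Section Sequences.
Variable V : finType.
Implicit Types (x y : V) (s u v : seq V) (e : {set V}).

Fixpoint path_edges s : {set {set V}} :=
  if s is x :: (y :: _) as r then [set x; y] |: path_edges r else set0.

Definition cycle_edges s : {set {set V}} :=
  if s is x :: p then [set last x p; x] |: path_edges s else set0.

Lemma last_rev x s : last x (rev s) = head x s.
Proof. by case: s => // y s; rewrite rev_cons last_rcons. Qed.

Lemma head_rev x s : head x (rev s) = last x s.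
Proof. by case/lastP: s => // s y; rewrite rev_rcons last_rcons. Qed.

Lemma path_edgesP x0 s e :
  reflect (exists2 i, i.+1 < size s & e = [set nth x0 s i; nth x0 s i.+1]) (e \in path_edges s).
Proof.
elim: s => [|x [|y s] IH]; try by rewrite inE; constructor; case.
have -> : path_edges [:: x, y & s] = [set x; y] |: path_edges (y :: s) by [].
rewrite in_setU1; apply: (iffP orP) => [[/eqP ->|/IH [i hi ->]]|[[|i] hi E]].
- by exists 0.
- by exists i.+1.
- by left; rewrite E.
- by right; apply/IH; exists i.
Qed.

Lemma path_edges_cat x0 u v : 0 < size u -> 0 < size v ->
  path_edges (u ++ v) = [set last x0 u; head x0 v] |: (path_edges u :|: path_edges v).
Proof.
case: v => // b v; elim: u => // x [|y u] IH _ _; first by rewrite /= set0U.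
have -> : path_edges ([:: x, y & u] ++ b :: v) = [set x; y] |: path_edges ((y :: u) ++ b :: v) by [].
have -> : path_edges [:: x, y & u] = [set x; y] |: path_edges (y :: u) by [].
by rewrite (IH _ _) // !setUA [_ |: [set [set x; y]]]setUC.
Qed.

Lemma path_edges_rev s : path_edges (rev s) = path_edges s.
Proof.
elim: s => // x s IH; rewrite rev_cons -cats1.
case: s IH => [|y s] IH //.
rewrite (path_edges_cat x) ?size_rev // IH last_rev /= setU0.
by rewrite [[set y; x]]setUC.
Qed.

Lemma cycle_edgesE x0 s : 0 < size s ->
  cycle_edges s = [set last x0 s; head x0 s] |: path_edges s.
Proof. by case: s. Qed.

Lemma cycle_edges_rev s : cycle_edges (rev s) = cycle_edges s.
Proof.
case: s => // x0 s.
rewrite (@cycle_edgesE x0 (rev _)) ?size_rev // path_edges_rev last_rev head_rev.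
by rewrite (@cycle_edgesE x0 (_ :: _)) // [[set head _ _; _]]setUC.
Qed.

Lemma cycle_edges_rot i s : cycle_edges (rot i s) = cycle_edges s.
Proof.
have [hi|/rot_oversize -> //] := ltnP i (size s).
case: (posnP i) => [->|i0]; first by rewrite rot0.
have [x0 _] : exists x0 : V, True by case: s hi => // x0; exists x0.
rewrite -{2}(cat_take_drop i s) /rot.
set u := take i s; set v := drop i s.
have hu : 0 < size u by rewrite size_take hi.
have hv : 0 < size v by rewrite size_drop subn_gt0.
rewrite !(@cycle_edgesE x0) ?size_cat ?addn_gt0 ?hu ?hv //.
rewrite !(@path_edges_cat x0) //.
have hl a b : 0 < size b -> last x0 (a ++ b) = last x0 b by case: b => // z b; rewrite last_cat.
have hh a b : 0 < size a -> head x0 (a ++ b) = head x0 a by case: a.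
rewrite !hl ?hh // [path_edges v :|: _]setUC !setUA.
by rewrite [[set [set _ ; head x0 v]] :|: _]setUC.
Qed.

Lemma card_path_edges s : #|path_edges s| <= (size s).-1.
Proof.
elim: s => [|x [|y s] IH]; rewrite ?cards0 //.
have -> : path_edges [:: x, y & s] = [set x; y] |: path_edges (y :: s) by [].
rewrite cardsU1; exact: (leq_add (leq_b1 _) IH).
Qed.

Lemma card_cycle_edges s : #|cycle_edges s| <= size s.
Proof.
case: s => [|x s]; rewrite ?cards0 // cardsU1.
exact: (leq_add (leq_b1 _) (card_path_edges (x :: s))).
Qed.

Lemma edge_pos_inj x0 s i j : uniq s -> i.+1 < size s -> j.+1 < size s ->
  [set nth x0 s i; nth x0 s i.+1] = [set nth x0 s j; nth x0 s j.+1] -> i = j.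
Proof.
move=> us hi hj /set2_eq [[/eqP + _]|[/eqP + /eqP]].
  by rewrite nth_uniq ?(ltnW hi) ?(ltnW hj) // => /eqP.
by rewrite !nth_uniq ?(ltnW hi) ?(ltnW hj) // => /eqP -> /eqP; lia.
Qed.

Lemma closing_notin x0 s : uniq s -> 2 < size s ->
  [set last x0 s; head x0 s] \notin path_edges s.
Proof.
move=> us s2; apply/negP => /(path_edgesP x0) [i hi].
have [h1 h2 h3] : [/\ (size s).-1 < size s, i < size s & 0 < size s] by split; lia.
by rewrite -nth0 -nth_last => /set2_eq [[/eqP + /eqP]|[/eqP + /eqP]];
 rewrite !nth_uniq // => /eqP ? /eqP ?; lia.
Qed.

(* A Posa rotation at the first vertex, followed by the reversal of the whole
   path: the new path starts where the old one ended. *)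
Definition rotate i s := rev (drop i s) ++ take i s.

Lemma size_rotate i s : size (rotate i s) = size s.
Proof. by rewrite /rotate size_cat size_rev addnC -size_cat cat_take_drop. Qed.

Lemma perm_rotate i s : perm_eq (rotate i s) s.
Proof.
rewrite /rotate perm_catC -[X in perm_eq _ X](cat_take_drop i s) perm_cat2l.
by rewrite perm_rev.
Qed.

Lemma rotate_uniq i s : uniq (rotate i s) = uniq s.
Proof. exact: perm_uniq (perm_rotate i s). Qed.

Lemma rotate_inj i s s' : size s = size s' -> rotate i s = rotate i s' -> s = s'.
Proof.
move=> E /eqP; rewrite eqseq_cat ?size_rev ?size_drop ?E // => /andP[/eqP E1 /eqP E2].
by rewrite -(cat_take_drop i s) E2 (can_inj (@revK V) E1) cat_take_drop.
Qed.

Section RotateEdges.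
Variables (x0 : V) (i : nat) (s : seq V).
Hypotheses (i0 : 0 < i) (hi : i < size s).

Let hu : 0 < size (take i s). Proof. by rewrite size_take hi. Qed.
Let hv : 0 < size (drop i s). Proof. by rewrite size_drop subn_gt0. Qed.

Lemma head_rotate : head x0 (rotate i s) = last x0 s.
Proof.
have hh a b : 0 < size a -> head x0 (a ++ b) = head x0 a by case: a.
rewrite -[in RHS](cat_take_drop i s) last_cat /rotate hh ?size_rev // head_rev.
by case: (drop i s) hv.
Qed.

Lemma last_take : last x0 (take i s) = nth x0 s i.-1.
Proof. by rewrite -nth_last size_take hi nth_take // prednK. Qed.

Lemma head_drop : head x0 (drop i s) = nth x0 s i.
Proof. by rewrite -nth0 nth_drop addn0. Qed.

Lemma head_take : head x0 (take i s) = head x0 s.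
Proof. by rewrite -!nth0 nth_take. Qed.

Lemma last_rotate : last x0 (rotate i s) = nth x0 s i.-1.
Proof. by rewrite /rotate last_cat -last_take; case: (take i s) hu. Qed.

Lemma path_edges_rotate : path_edges (rotate i s) =
  [set nth x0 s i; head x0 s] |: (path_edges (take i s) :|: path_edges (drop i s)).
Proof.
rewrite /rotate (path_edges_cat x0) ?size_rev // path_edges_rev [_ :|: path_edges (take _ _)]setUC.
by rewrite head_take -head_drop last_rev.
Qed.

Lemma path_edges_split : path_edges s =
  [set nth x0 s i.-1; nth x0 s i] |: (path_edges (take i s) :|: path_edges (drop i s)).
Proof. by rewrite -{1}(cat_take_drop i s) (path_edges_cat x0) // last_take head_drop. Qed.

Lemma path_edges_rotate_sub :
  path_edges (rotate i s) \subset [set nth x0 s i; head x0 s] |: path_edges s.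
Proof. by rewrite path_edges_rotate path_edges_split setUS // subsetUr. Qed.

Lemma sub_path_edges_rotate :
  path_edges s \subset [set nth x0 s i.-1; nth x0 s i] |: path_edges (rotate i s).
Proof. by rewrite path_edges_rotate path_edges_split setUS // subsetUr. Qed.

(** The position of the old first vertex reveals the cut, so a rotation can be undone once that
    vertex is known. *)
Lemma index_rotate_head : uniq s -> index (head x0 s) (rotate i s) = size s - i.
Proof.
move=> us; rewrite /rotate index_cat mem_rev size_rev size_drop.
have hin : head x0 s \in take i s by rewrite -head_take; case: (take i s) hu => //= z t; rewrite mem_head.
rewrite (_ : head x0 s \in drop i s = false).
  by rewrite -head_take; case: (take i s) hu => //= z t; rewrite eqxx addn0.
apply/negP => hd; move: us; rewrite -(cat_take_drop i s) cat_uniq => /and3P[_ /hasP + _].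
by apply; exists (head x0 s).
Qed.

End RotateEdges.

End Sequences.

(** * Switching and spreadness *)

Section Switching.
Variables (R : realFieldType) (V : finType) (n : nat).
Local Notation T := (n.-tuple V).
Implicit Types (x y : V) (s : T) (A B : {set T}).

Lemma size_rotate_tuple i s : size (rotate i s) == n.
Proof. by rewrite size_rotate size_tuple. Qed.

Definition trotate i s : T := Tuple (size_rotate_tuple i s).

(** The digit counts the edges exchanged: k rotations followed by closing up replace k+1 edges of
    the cycle. *)
Definition switch2 B s := [set i : 'I_n | (0 < i) && (trotate i s \in B)].
Definition switch3 B s := [set ij : 'I_n * 'I_n |
  [&& 0 < ij.1, 0 < ij.2 & trotate ij.2 (trotate ij.1 s) \in B]].
Definition switch4 B s := [set ijk : 'I_n * 'I_n * 'I_n |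
  [&& 0 < ijk.1.1, 0 < ijk.1.2, 0 < ijk.2 &
      trotate ijk.2 (trotate ijk.1.2 (trotate ijk.1.1 s)) \in B]].

Lemma trotate_inj i : injective (trotate i).
Proof.
move=> s s' /(congr1 val) /= E; apply: val_inj; apply: rotate_inj E.
by rewrite !size_tuple.
Qed.

Lemma trotate_idx_inj x i j s s' : uniq s -> uniq s' -> 0 < i < n -> 0 < j < n ->
  head x s = x -> head x s' = x -> trotate i s = trotate j s' -> s = s' /\ i = j.
Proof.
move=> us us' /andP[i0 hi] /andP[j0 hj] hx hx' E.
have := index_rotate_head x i0 (s := s); rewrite size_tuple => /(_ hi us).
have := index_rotate_head x j0 (s := s'); rewrite size_tuple => /(_ hj us').
rewrite hx hx' -[rotate j s']/(val (trotate j s')) -E /= => -> ?.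
have ij : i = j by lia.
by split=> //; rewrite ij in E; apply: trotate_inj E.
Qed.

(** Rotations keep track of known vertices: the path starts at x and ends at y, after one rotation
    it starts at y. The three kinds of switchings have n, n^2 and n^3 choices; they are brought to
    the common scale n^2, and the factor 3 adds the three cases. *)
Lemma card_switch_le (c : R) A B x y :
  (0 < n) ->
  (forall s, s \in A -> [/\ uniq s, head x s = x & last x s = y]) ->
  (forall s i, s \in B -> [tuple of rot i s] \in B) ->
  (forall s, s \in A -> [\/ c * n%:R <= #|switch2 B s|%:R,
     c * n%:R ^+ 2 <= #|switch3 B s|%:R | c * n%:R ^+ 3 <= #|switch4 B s|%:R])%R ->
  (c * n%:R ^+ 2 * #|A|%:R <= 3 * #|B|%:R)%R.
Proof.
move=> n0 hA hB hc.
have n0R : (0 < n%:R :> R)%R by rewrite ltr0n.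
(* The missing factor n comes from a cyclic shift of the resulting cycle: the path before the shift
   starts at y, so the position of y reveals the shift. *)
have b2 : \sum_(s in A) #|switch2 B s| * n <= #|B|.
  under eq_bigr => s _ do rewrite -[X in _ * X](card_ord n) -cardsT -cardsX.
  apply: (card_pairs_le (good := fun s : T => setX (switch2 B s) [set: 'I_n]) (f := fun (s : T) (il : 'I_n * 'I_n) => [tuple of rot il.2 (trotate il.1 s)])).
    by move=> s [i l] sA; rewrite !inE andbT /= => /andP[_]; apply: hB.
  move=> s s' [i l] [i' l'] sA sA'; rewrite !inE !andbT /= => /andP[i0 _] /andP[i0' _] E.
  have [us hx hy] := hA s sA; have [us' hx' hy'] := hA s' sA'.
  have ur : uniq (trotate i s) by rewrite rotate_uniq.
  have ur' : uniq (trotate i' s') by rewrite rotate_uniq.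
  have hi : i < size s by rewrite size_tuple.
  have hi' : i' < size s' by rewrite size_tuple.
  have hh : head x (trotate i s) = y by rewrite head_rotate.
  have hh' : head x (trotate i' s') = y by rewrite head_rotate.
  have idx (t : T) (k : 'I_n) : uniq t -> head x t = y -> nth x (rot k t) ((n - k) %% n) = y.
    move=> ut ht; case: (posnP k) => [->|k0].
      by rewrite subn0 modnn rot0 nth0.
    rewrite modn_small; last by rewrite ltn_subrL k0.
    by rewrite nth_cat size_drop size_tuple ltnn subnn nth_take // nth0.
  have E' : rot l (trotate i s) = rot l' (trotate i' s') by case: E.
  have := idx _ l ur hh; rewrite E' -(idx _ l' ur' hh') => /eqP.
  rewrite nth_uniq ?rot_uniq ?size_rot ?size_tuple ?ltn_mod //.
  have [hl hl'] := (ltn_ord l, ltn_ord l').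
  move=> /eqP El; have {El} El : l = l'.
    apply: val_inj => /=; move: El.
    case: (posnP l) => [->|l0]; case: (posnP l') => [->|l0'] //;
      rewrite ?subn0 ?modnn ?modn_small ?ltn_subrL ?l0 ?l0' //; lia.
  subst l'; move/rot_inj/val_inj: E' => {}E.
  have [||-> Ei] := @trotate_idx_inj x i i' s s' us us' _ _ hx hx' E; rewrite ?i0 ?i0' ?ltn_ord //.
  by rewrite (val_inj Ei).
(* The position of y in the result gives the second cut, and then the position of x gives the
   first. *)
have b3 : \sum_(s in A) #|switch3 B s| <= #|B|.
  apply: (card_pairs_le (good := switch3 B) (f := fun (s : T) (ij : 'I_n * 'I_n) => trotate ij.2 (trotate ij.1 s))).
    by move=> s ij _; rewrite inE => /and3P[].
  move=> s s' [i j] [i' j'] sA sA'; rewrite !inE /= => /and3P[i0 j0 _] /and3P[i0' j0' _] E.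
  have [us hx hy] := hA s sA; have [us' hx' hy'] := hA s' sA'.
  have ly t : t \in A -> last y t = y.
    by case/hA => _ _ <-; case: (tval t).
  have [] := @trotate_idx_inj y j j' (trotate i s) (trotate i' s') _ _ _ _ _ _ E;
    rewrite ?rotate_uniq ?j0 ?j0' ?ltn_ord // ?head_rotate ?size_tuple ?ly //.
  move=> {}E Ej.
  have [||-> Ei] := @trotate_idx_inj x i i' s s' us us' _ _ hx hx' E; rewrite ?i0 ?i0' ?ltn_ord //.
  by rewrite (val_inj Ei) (val_inj Ej).
(* The first vertex before the third rotation is not known in advance, so the third cut is recorded
   next to the result, at the cost of a factor n. *)
have b4 : \sum_(s in A) #|switch4 B s| <= n * #|B|.
  have -> : n * #|B| = #|setX [set: 'I_n] B| by rewrite cardsX cardsT card_ord.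
  apply: (card_pairs_le (good := switch4 B) (f := fun (s : T) (ijk : 'I_n * 'I_n * 'I_n) => (ijk.2, trotate ijk.2 (trotate ijk.1.2 (trotate ijk.1.1 s))))).
    by move=> s ijk _; rewrite !inE => /and4P[].
  move=> s s' [[i j] k] [[i' j'] k'] sA sA'; rewrite !inE /= => /and4P[i0 j0 k0 _] /and4P[i0' j0' k0' _].
  case=> Ek /eqP E; subst k'.
  have {}E : trotate j (trotate i s) = trotate j' (trotate i' s').
    by apply: (@trotate_inj k); apply: val_inj; apply/eqP.
  have [us hx hy] := hA s sA; have [us' hx' hy'] := hA s' sA'.
  have ly t : t \in A -> last y t = y.
    by case/hA => _ _ <-; case: (tval t).
  have [] := @trotate_idx_inj y j j' (trotate i s) (trotate i' s') _ _ _ _ _ _ E;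
    rewrite ?rotate_uniq ?j0 ?j0' ?ltn_ord // ?head_rotate ?size_tuple ?ly //.
  move=> {}E Ej.
  have [||-> Ei] := @trotate_idx_inj x i i' s s' us us' _ _ hx hx' E; rewrite ?i0 ?i0' ?ltn_ord //.
  by rewrite (val_inj Ei) (val_inj Ej).
have : (\sum_(s in A) c * n%:R ^+ 2 <= \sum_(s in A) ((#|switch2 B s| * n)%:R +
    #|switch3 B s|%:R + #|switch4 B s|%:R / n%:R) :> R)%R.
  apply: ler_sum => s sA; have := hc s sA; rewrite natrM.
  have h2 : (0 <= #|switch2 B s|%:R * n%:R :> R)%R by rewrite mulr_ge0 // ltW.
  have h3 : (0 <= #|switch3 B s|%:R :> R)%R by [].
  have h4 : (0 <= #|switch4 B s|%:R / n%:R :> R)%R by rewrite divr_ge0 // ltW.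
  case=> h.
  - have : (c * n%:R * n%:R <= #|switch2 B s|%:R * n%:R)%R by rewrite ler_pM2r.
    by rewrite expr2 mulrA; lra.
  - lra.
  - have : (c * n%:R ^+ 3 / n%:R <= #|switch4 B s|%:R / n%:R)%R by rewrite ler_pM2r ?invr_gt0.
    rewrite (_ : (c * n%:R ^+ 3 / n%:R = c * n%:R ^+ 2)%R); last by field; rewrite gt_eqF.
    lra.
rewrite sumr_const -mulr_natr !big_split /= -mulr_suml -!natr_sum.
have : ((\sum_(s in A) #|switch2 B s| * n)%:R <= #|B|%:R :> R)%R by rewrite ler_nat.
have : ((\sum_(s in A) #|switch3 B s|)%:R <= #|B|%:R :> R)%R by rewrite ler_nat.
have : ((\sum_(s in A) #|switch4 B s|)%:R / n%:R <= #|B|%:R :> R)%R.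
  by rewrite ler_pdivrMr // -natrM mulnC ler_nat.
lra.
Qed.

(** A cycle through xy can be shifted, and reversed if necessary, so that xy becomes its closing
    edge with x first; there are 2n such maps and each is injective. *)
Lemma card_edge_le A x y : (0 < n) ->
  (forall s i, s \in A -> [tuple of rot i s] \in A) ->
  (forall s, s \in A -> [tuple of rev s] \in A) ->
  #|[set s in A | [set x; y] \in cycle_edges s]| <=
    2 * n * #|[set s in A | (head x s == x) && (last x s == y)]|.
Proof.
move=> n0 hrot hrev; set M := [set s in A | (head x s == x) && _].
pose f (lb : 'I_n * bool) (s : T) : T :=
  if lb.2 then [tuple of rev [tuple of rot lb.1 s]] else [tuple of rot lb.1 s].
have finj lb : injective (f lb).
  case: lb => l b s s'; rewrite /f /=; case: b => /(congr1 val) /= E; apply: val_inj.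
    exact: rot_inj (can_inj (@revK V) E).
  exact: rot_inj E.
have sub : [set s in A | [set x; y] \in cycle_edges s] \subset \bigcup_(lb : 'I_n * bool) (f lb @^-1: M).
  apply/subsetP => s; rewrite inE => /andP[sA he].
  have [l El] : exists l : 'I_n, [set last x (rot l s); head x (rot l s)] = [set x; y].
    have s0 : 0 < size s by rewrite size_tuple.
    move: he; rewrite (cycle_edgesE x) // in_setU1 => /orP[/eqP ->|].
      by exists (Ordinal n0); rewrite rot0.
    move/(path_edgesP x) => [i hi ->].
    have hi' : i.+1 < n by rewrite size_tuple in hi.
    exists (Ordinal hi') => /=; rewrite /rot last_cat -!nth0 nth_cat size_drop subn_gt0 hi.
    rewrite nth_drop addn0; congr [set _; _].
    rewrite -nth_last size_take hi nth_take //=; apply: set_nth_default; exact: ltnW.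
  have rA := hrot s l sA.
  case/set2_eq: El => [[E1 E2]|[E1 E2]]; apply/bigcupP.
    by exists (l, true) => //; rewrite !inE /f /= hrev //= head_rev last_rev E1 E2 !eqxx.
  by exists (l, false) => //; rewrite !inE /f /= rA E1 E2 !eqxx.
apply: (leq_trans (subset_leq_card sub)).
apply: (@leq_trans (\sum_(lb : 'I_n * bool) #|f lb @^-1: M|)).
  apply: (big_ind2 (fun (D : {set T}) k => #|D| <= k)); rewrite ?cards0 // => posD1 k1 posD2 k2 h1 h2.
  by apply: leq_trans (leq_add h1 h2); rewrite cardsU leq_subr.
rewrite (eq_bigr (fun=> #|M|)) => [|lb _]; last first.
  by rewrite on_card_preimset //; apply: onW_bij; apply: injF_bij.
by rewrite sum_nat_const card_prod card_ord card_bool (mulnC n) leqnn.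
Qed.

End Switching.

(** * Counting vertex orderings through a prescribed edge set *)

Section EdgeCounting.
Variable V : finType.
Implicit Types (x y : V) (s p : seq V) (D : {set {set V}}).

Lemma card_cycle_nbr x s : uniq s -> #|[set y | [set x; y] \in cycle_edges s]| <= 2.
Proof.
move=> us; case: (boolP (x \in s)) => xs; last first.
  rewrite (_ : [set _ | _] = set0) ?cards0 //; apply/setP => y; rewrite !inE.
  apply/negP; case: s xs us => [|z p]; first by rewrite inE.
  move=> xs us; rewrite (cycle_edgesE z) // in_setU1.
  have nx w : w \in z :: p -> x != w by move=> ws; apply: contra xs => /eqP ->.
  case/orP => [/eqP|/(path_edgesP z) [i hi]] /set2_eq [[/eqP]|[/eqP]].
  - by rewrite (negPf (nx _ _)) // -nth_last mem_nth.
  - by rewrite (negPf (nx _ _)) // mem_head.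
  - by rewrite (negPf (nx _ _)) // mem_nth // ltnW.
  - by rewrite (negPf (nx _ _)) // mem_nth.
case: (rot_to xs) => i p Ep.
rewrite -(cycle_edges_rot i) Ep; have up : uniq (x :: p) by rewrite -Ep rot_uniq.
apply: (@leq_trans #|[set last x p; head x p]|); last by rewrite cards2; case: eqP.
apply: subset_leq_card; apply/subsetP => y; rewrite !inE.
case/orP => [/eqP|/(path_edgesP x) [j hj]] /set2_eq [[Ex Ey]|[Ex Ey]].
- by rewrite Ey -Ex eqxx.
- by rewrite Ey eqxx.
- have : nth x (x :: p) j == nth x (x :: p) 0 by rewrite -Ex.
  rewrite nth_uniq // ?(ltnW hj) // => /eqP Ej; subst j.
  by rewrite Ey /= nth0 eqxx orbT.
- have : nth x (x :: p) j.+1 == nth x (x :: p) 0 by rewrite -Ex.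
  by rewrite nth_uniq.
Qed.

Fixpoint steps_in D x p : nat :=
  if p is y :: p' then ([set x; y] \in D) + steps_in D y p' else 0.

Lemma card_steps_in D x p : #|D :&: path_edges (x :: p)| <= steps_in D x p.
Proof.
elim: p x => [|y p IH] x; first by rewrite setI0 cards0.
have -> : path_edges [:: x, y & p] = [set x; y] |: path_edges (y :: p) by [].
rewrite setIUr; apply: leq_trans (leq_card_setU _ _) _; apply: leq_add (IH y).
case: (boolP ([set x; y] \in D)) => h; first by rewrite (leq_trans (subset_leq_card (subsetIr _ _))) ?cards1.
by rewrite (_ : _ :&: _ = set0) ?cards0 //; apply/eqP; rewrite setI_eq0 disjoint_sym disjoints1.
Qed.

Lemma card_tupleS m (P : pred (m.+1.-tuple V)) :
  #|[set t | P t]| = \sum_(y : V) #|[set t : m.-tuple V | P [tuple of y :: t]]|.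
Proof.
rewrite -sum1dep_card; under [RHS]eq_bigr do rewrite -sum1dep_card.
rewrite pair_big_dep /= (reindex (fun yt : V * m.-tuple V => [tuple of yt.1 :: yt.2])) //=.
exists (fun t => (thead t, [tuple of behead t])) => [[y t] _|t _] /=.
  by rewrite theadE; congr (_, _); apply: val_inj.
by rewrite -tuple_eta.
Qed.

(** A step along an edge of [D] has at most 2 choices instead of |V|, so each of the [t] required
    steps saves a factor |V|. In the recursion one step contributes at most 2|V| + |V| <= 4|V|. *)
Lemma card_walks D m x t : (forall y, #|[set z | [set y; z] \in D]| <= 2) ->
  #|V| ^ t * #|[set p : m.-tuple V | t <= steps_in D x p]| <= 4 ^ m * #|V| ^ m.
Proof.
move=> hD; elim: m x t => [|m IH] x t.
  rewrite mul1n expn0; case: t => [|t].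
    by rewrite mul1n (leq_trans (max_card _)) // card_tuple.
  by rewrite (_ : [set _ | _] = set0) ?cards0 ?muln0 //; apply/setP => p; rewrite !inE tuple0.
rewrite card_tupleS big_distrr /=.
have V0 : 0 < #|V| by apply/card_gt0P; exists x.
apply: (@leq_trans (\sum_(y : V) (([set x; y] \in D) * #|V| + 1) * (4 ^ m * #|V| ^ m))).
  apply: leq_sum => y _.
  case: (boolP ([set x; y] \in D)) => h; last first.
    by rewrite mul0n add0n mul1n; apply: leq_trans (IH y t).
  rewrite mul1n; case: t => [|t].
    have := IH y 0; set a := _ ^ m * _; rewrite !expn0 !mul1n => h0.
    by apply: (leq_trans h0); apply: leq_pmull; rewrite addn1.
  have := IH y t; set a := _ ^ m * _ => h0.
  rewrite expnS -mulnA mulnDl; apply: leq_trans (leq_addr _ _).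
  by rewrite leq_mul2l h0 orbT.
rewrite -big_distrl /= big_split /= sum1_card -big_distrl /=.
have : \sum_(y : V) ([set x; y] \in D) <= 2.
  by rewrite -big_mkcond sum1dep_card.
set k := \sum_(y : V) _ => hk; rewrite !expnS.
have -> : 4 * 4 ^ m * (#|V| * #|V| ^ m) = 4 * #|V| * (4 ^ m * #|V| ^ m) by rewrite mulnACA.
rewrite leq_mul2r; apply/orP; right.
rewrite (_ : #|xpredT| = #|V|); last by apply: eq_card.
by nia.
Qed.

(** [D] lies in a cycle, hence has degrees at most 2. One of its edges may be the closing edge,
    which the walk does not see: only #|D|-1 steps are guaranteed, and this costs the extra factor
    |V|. *)
Lemma card_cycles_through D k : 0 < k ->
  #|V| ^ #|D| * #|[set s : k.-tuple V | uniq s && (D \subset cycle_edges s)]| <= 4 ^ k * #|V| ^ k.+1.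
Proof.
case: k => // m _.
set A := [set s | _].
have [->|[s0]] := set_0Vmem A; first by rewrite cards0 muln0.
rewrite inE => /andP[us0 Ds0].
have hD y : #|[set z | [set y; z] \in D]| <= 2.
  apply: leq_trans (card_cycle_nbr y us0); apply: subset_leq_card; apply/subsetP => z.
  by rewrite !inE; apply: (subsetP Ds0).
have V0 : 0 < #|V| by apply/card_gt0P; exists (thead s0).
apply: (@leq_trans (#|V| * (#|V| ^ #|D|.-1 * #|A|))).
  by rewrite mulnA leq_mul2r -expnS leq_pexp2l ?orbT //; lia.
have hA : #|A| <= \sum_(y : V) #|[set t : m.-tuple V | #|D|.-1 <= steps_in D y t]|.
  rewrite /A card_tupleS; apply: leq_sum => y _; apply: subset_leq_card; apply/subsetP => t.
  rewrite !inE => /andP[_ sub].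
  apply: leq_trans (card_steps_in D y t).
  have : #|D| <= #|[set [set last y t; y]] :|: (D :&: path_edges (y :: t))|.
    apply: subset_leq_card; apply/subsetP => e eD.
    by have := subsetP sub e eD; rewrite !inE eD.
  move/leq_trans/(_ (leq_card_setU _ _)); by rewrite cards1 add1n; case: #|D|.
rewrite !expnS.
apply: (@leq_trans (#|V| * (#|V| * (4 ^ m * #|V| ^ m)))); last first.
  have <- : 4 ^ m * (#|V| * (#|V| * #|V| ^ m)) = #|V| * (#|V| * (4 ^ m * #|V| ^ m)).
    by rewrite mulnCA; congr (_ * _); rewrite mulnCA.
  by rewrite -[X in _ <= X]mulnA; apply: leq_pmull.
rewrite leq_mul2l; apply/orP; right.
apply: (@leq_trans (#|V| ^ #|D|.-1 * \sum_(y : V) #|[set t : m.-tuple V | #|D|.-1 <= steps_in D y t]|)).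
  by rewrite leq_mul2l hA orbT.
rewrite big_distrr /= -sum_nat_const; apply: leq_sum => y _; exact: card_walks.
Qed.

End EdgeCounting.

(** n^n is at most the falling factorial (2n)(2n-1)...(n+1), which is n! times a binomial
    coefficient below 4^n. *)
Lemma expnn_le_fact n : n ^ n <= 4 ^ n * n`!.
Proof.
have h k : n ^ k <= (n + k) ^_ k.
  elim: k => // k IH; rewrite addnS ffactSS expnS; apply: leq_mul => //.
  by apply: leq_trans (leq_addr _ _) _.
apply: (leq_trans (h n)); rewrite -bin_ffact leq_mul2r; apply/orP; right.
rewrite (_ : 4 ^ n = (1 + 1) ^ (n + n)); last by rewrite expnD -expnMn.
have hn : n < (n + n).+1 by rewrite ltnS leq_addr.
rewrite expnDn (bigD1 (Ordinal hn)) //= !exp1n !muln1; exact: leq_addr.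
Qed.

(** * From switchings to a spread family of Hamiltonian cycles *)

Section RobustHamiltonicity.
Variables (R : realFieldType) (V : finType).
Variables (E1 ET F : {set {set V}}).
Local Notation n := #|V|.
Local Notation T := (n.-tuple V).
Implicit Types S : {set {set V}}.

(* Vertex orderings of Hamiltonian cycles; the edges of [F] are frozen: they are
   used by every cycle and may lie outside [E]. *)
Definition hamset (E : {set {set V}}) : {set T} :=
  [set s : T | [&& uniq s, F \subset cycle_edges s & cycle_edges s \subset E :|: F]].

(** Stated with [path_edges s]: the closing edge of [s] is given up unless it lies in [E1]. *)
Definition rewirings (Q : {set {set V}}) (s : seq V) : {set T} :=
  [set s' : T | [&& uniq s', Q \subset cycle_edges s' & cycle_edges s' \subset path_edges s :|: E1]].

(* Opening a cycle at its closing edge [xy], many choices of one, two or three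
   successive rotations close it up again with new edges from [E1] only, without
   losing an edge of [Q]. *)
Definition switchable (c eps : R) := forall (s : T) x y (Q : {set {set V}}),
  s \in hamset ET -> head x s = x -> last x s = y -> [set x; y] \notin F ->
  F \subset Q -> Q \subset path_edges s -> (#|Q|%:R <= eps * n%:R)%R ->
  [\/ c * n%:R <= #|switch2 (rewirings Q s) s|%:R,
      c * n%:R ^+ 2 <= #|switch3 (rewirings Q s) s|%:R
    | c * n%:R ^+ 3 <= #|switch4 (rewirings Q s) s|%:R]%R.

Variables (c eps : R).
Hypotheses (c0 : (0 < c)%R) (n3 : 2 < n) (E1T : E1 \subset ET) (sw : switchable c eps).
Hypothesis (Feps : (#|F|%:R <= eps * n%:R)%R).

Let n0 : 0 < n. Proof. exact: leq_trans n3. Qed.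
Let n0R : (0 < n%:R :> R)%R. Proof. by rewrite ltr0n. Qed.

Lemma hamset_uniq E s : s \in hamset E -> uniq s. Proof. by rewrite inE => /and3P[]. Qed.

Lemma hamset_mono : hamset E1 \subset hamset ET.
Proof.
apply/subsetP => s; rewrite !inE => /and3P[-> -> /= h].
by apply: subset_trans h _; apply: setSU.
Qed.

Lemma hamset_rot E (s : T) i : ([tuple of rot i s] \in hamset E) = (s \in hamset E).
Proof. by rewrite !inE /= rot_uniq cycle_edges_rot. Qed.

Lemma hamset_rev E (s : T) : ([tuple of rev s] \in hamset E) = (s \in hamset E).
Proof. by rewrite !inE /= rev_uniq cycle_edges_rev. Qed.

(** Opens every cycle of [A] at xy and closes it up inside [B]. The 6 is 2 for the two directions of
    the cycle times 3 for the three kinds of switchings. *)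
Lemma switch_edge (A B : {set T}) x y (Q : {set {set V}}) :
  (forall s i, s \in A -> [tuple of rot i s] \in A) ->
  (forall s, s \in A -> [tuple of rev s] \in A) ->
  (forall s i, s \in B -> [tuple of rot i s] \in B) ->
  A \subset hamset ET -> [set x; y] \notin F -> F \subset Q -> [set x; y] \notin Q ->
  (#|Q|%:R <= eps * n%:R)%R ->
  (forall s, s \in A -> head x s = x -> last x s = y -> Q \subset cycle_edges s /\ rewirings Q s \subset B) ->
  (c * n%:R * #|[set s in A | [set x; y] \in cycle_edges s]|%:R <= 6 * #|B|%:R)%R.
Proof.
move=> rotA revA rotB AT xyF FQ xyQ hQ hB.
have h1 := card_edge_le x y n0 rotA revA.
set M := [set s in A | _ && _] in h1.
have hM : (c * n%:R ^+ 2 * #|M|%:R <= 3 * #|B|%:R)%R.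
  apply: (@card_switch_le R V n c M B x y) => //.
    move=> s; rewrite inE => /and3P[sA /eqP hx /eqP hy]; split=> //.
    exact: hamset_uniq (subsetP AT _ sA).
  move=> s; rewrite inE => /and3P[sA /eqP hx /eqP hy].
  have [Qs sB] := hB s sA hx hy.
  have s0 : 0 < size s by rewrite size_tuple.
  have Qp : Q \subset path_edges s.
    apply/subsetP => e eQ; have := subsetP Qs e eQ.
    rewrite (cycle_edgesE x) // in_setU1 hx hy setUC => /orP[/eqP Ee|//].
    by case/negP: xyQ; rewrite -Ee.
  have incl (U : finType) (P P' : {set U}) : P \subset P' -> (#|P|%:R <= #|P'|%:R :> R)%R.
    by move=> ?; rewrite ler_nat subset_leq_card.
  have [h|h|h] := sw (subsetP AT _ sA) hx hy xyF FQ Qp hQ.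
  - apply: Or31; apply: le_trans h (incl _ _ _ _); apply/subsetP => i; rewrite !inE => /andP[-> h].
    by apply: (subsetP sB); rewrite inE.
  - apply: Or32; apply: le_trans h (incl _ _ _ _); apply/subsetP => i; rewrite !inE => /and3P[-> -> h].
    by apply: (subsetP sB); rewrite inE.
  - apply: Or33; apply: le_trans h (incl _ _ _ _); apply/subsetP => i; rewrite !inE => /and4P[-> -> -> h].
    by apply: (subsetP sB); rewrite inE.
have : (#|[set s in A | [set x; y] \in cycle_edges s]|%:R <= 2 * n%:R * #|M|%:R :> R)%R.
  by rewrite -!natrM ler_nat.
set a := _%:R%R => ha.
have : (c * n%:R * a <= c * n%:R * (2 * n%:R * #|M|%:R))%R by rewrite ler_wpM2l // mulr_ge0 // ltW.
have -> : (c * n%:R * (2 * n%:R * #|M|%:R) = 2 * (c * n%:R ^+ 2 * #|M|%:R))%R by ring.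
lra.
Qed.

Definition through (S : {set {set V}}) := [set s in hamset E1 | S \subset cycle_edges s].

(** Switch at [e] with F and the other edges of [S] protected. *)
Lemma through_le e S : e \in S -> [disjoint S & F] -> (#|S|%:R + #|F|%:R <= eps * n%:R)%R ->
  (c * n%:R * #|through S|%:R <= 6 * #|through (S :\ e)|%:R)%R.
Proof.
move=> eS dSF hS.
have [->|[s0]] := set_0Vmem (through S); first by rewrite cards0 mulr0 mulr_ge0.
rewrite inE => /andP[_ Ss0].
have [x [y Ee]] : exists x, exists y, e = [set x; y].
  have := subsetP Ss0 _ eS; case: (tval s0) => [|z p]; first by rewrite inE.
  rewrite (cycle_edgesE z) // in_setU1 => /orP[/eqP ->|/(path_edgesP z) [i _ ->]]; by do 2 eexists.
have eF : e \notin F by rewrite (disjointFr dSF eS).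
have -> : through S = [set s in through S | [set x; y] \in cycle_edges s].
  apply/setP => s; rewrite !inE -Ee; case: (boolP (S \subset _)) => [h|]; rewrite ?andbF //=.
  by rewrite (subsetP h _ eS) !andbT.
apply: (@switch_edge _ _ x y (F :|: (S :\ e))).
- by move=> s i; rewrite !in_set cycle_edges_rot rot_uniq.
- by move=> s; rewrite !in_set cycle_edges_rev rev_uniq.
- by move=> s i; rewrite !in_set cycle_edges_rot rot_uniq.
- apply: subset_trans hamset_mono; apply/subsetP => s; by rewrite inE => /andP[].
- by rewrite -Ee.
- exact: subsetUl.
- by rewrite -Ee !inE eqxx (negPf eF).
- apply: le_trans hS; rewrite -natrD ler_nat addnC.
  apply: leq_trans (leq_card_setU _ _) _; rewrite leq_add2l.
  by apply: subset_leq_card; apply: subD1set.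
move=> s; rewrite inE => /andP[sH Ss] hx hy.
move: sH; rewrite inE => /and3P[us Fs sE].
have s0' : 0 < size s by rewrite size_tuple.
split.
  rewrite subUset Fs /=; apply: subset_trans Ss; exact: subD1set.
apply/subsetP => s'; rewrite !inE => /and3P[-> +].
rewrite subUset => /andP[-> ->] h; rewrite andbT /=.
apply: subset_trans h _; rewrite subUset subsetUl andbT.
by apply: subset_trans sE; rewrite (cycle_edgesE x) // subsetUr.
Qed.

Lemma through_small S : [disjoint S & F] -> (#|S|%:R + #|F|%:R <= eps * n%:R)%R ->
  (#|through S|%:R <= (6 / c / n%:R) ^+ #|S| * #|hamset E1|%:R :> R)%R.
Proof.
move: {2}#|S| (leqnn #|S|) => k; elim: k S => [|k IH] S.
  rewrite leqn0 cards_eq0 => /eqP -> _ _; rewrite cards0 expr0 mul1r ler_nat.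
  by apply: subset_leq_card; apply/subsetP => s; rewrite inE => /andP[].
move=> hk dSF hS; have [->|[e eS]] := set_0Vmem S.
  rewrite cards0 expr0 mul1r ler_nat.
  by apply: subset_leq_card; apply/subsetP => s; rewrite inE => /andP[].
have hS' : #|S :\ e| < #|S| by rewrite (cardsD1 e S) eS.
have := IH (S :\ e); rewrite -ltnS (leq_trans hS') // => /(_ isT).
have dS' : [disjoint S :\ e & F] by apply: disjointWl dSF; apply: subD1set.
have hS1 : (#|S :\ e|%:R + #|F|%:R <= eps * n%:R)%R.
  by apply: le_trans hS; rewrite lerD2r ler_nat ltnW.
move=> /(_ dS' hS1) h; have := through_le eS dSF hS.
rewrite (cardsD1 e S) eS exprS => h2.
have cn : (0 < c * n%:R)%R by rewrite mulr_gt0.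
have : (#|through S|%:R <= 6 / c / n%:R * #|through (S :\ e)|%:R)%R.
  have -> : (6 / c / n%:R * #|through (S :\ e)|%:R = 6 * #|through (S :\ e)|%:R / (c * n%:R))%R.
    by field; rewrite !gt_eqF.
  by rewrite ler_pdivlMr // mulrC.
move=> h3; apply: (le_trans h3); rewrite -[X in (_ <= X)%R]mulrA ler_wpM2l //.
by rewrite !divr_ge0 // ltW.
Qed.

(* Switching away the bad edges one at a time compares the number of
   Hamiltonian cycles in [E1] with that in the template [ET]. *)
Definition bad (s : T) := #|cycle_edges s :\: (E1 :|: F)|.
Definition nearham k := [set s in hamset ET | bad s <= k].

Lemma nearham_rot k (s : T) i : ([tuple of rot i s] \in nearham k) = (s \in nearham k).
Proof. by rewrite [in LHS]inE [in RHS]inE hamset_rot /bad /= cycle_edges_rot. Qed.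

(** A cycle with k+1 bad edges can be opened at each of them. The rewiring adds edges of [E1] only,
    so it creates no bad edge and loses the one at which it was opened. Summing over the n^2 ordered
    pairs xy gives the bound. *)
Lemma nearham_step k : (c * k.+1%:R * #|[set s in hamset ET | bad s == k.+1]|%:R <=
   6 * n%:R * #|nearham k|%:R)%R.
Proof.
set A := [set s in _ | _].
have hA : k.+1 * #|A| <= \sum_(xy : V * V | [set xy.1; xy.2] \notin E1 :|: F)
     #|[set s in A | [set xy.1; xy.2] \in cycle_edges s]|.
  rewrite mulnC -sum_nat_const.
  under [leqRHS]eq_bigr => xy _ do rewrite -sum1dep_card big_mkcondr.
  rewrite exchange_big /=; apply: leq_sum => s; rewrite inE => /andP[_ /eqP <-].
  rewrite /bad -big_mkcondr sum1dep_card.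
  set D := [set xy : V * V | _].
  apply: (@leq_trans #|(fun xy : V * V => [set xy.1; xy.2]) @: D|); last exact: leq_imset_card.
  apply: subset_leq_card; apply/subsetP => e; rewrite inE => /andP[eEF es].
  have [x [y Ee]] : exists x, exists y, e = [set x; y].
    move: es; case: (tval s) => [|z p]; first by rewrite inE.
    rewrite (cycle_edgesE z) // in_setU1 => /orP[/eqP ->|/(path_edgesP z) [i _ ->]]; by do 2 eexists.
  by apply/imsetP; exists (x, y); rewrite // inE -Ee eEF es.
have hxy (xy : V * V) : [set xy.1; xy.2] \notin E1 :|: F ->
  (c * n%:R * #|[set s in A | [set xy.1; xy.2] \in cycle_edges s]|%:R <= 6 * #|nearham k|%:R)%R.
  case: xy => x y /=; rewrite inE negb_or => /andP[xyE xyF].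
  apply: (@switch_edge _ _ x y F) => //.
  - by move=> s i; rewrite [in X in X -> _]inE [in X in _ -> X]inE hamset_rot /bad /= cycle_edges_rot.
  - by move=> s; rewrite [in X in X -> _]inE [in X in _ -> X]inE hamset_rev /bad /= cycle_edges_rev.
  - by move=> s i; rewrite nearham_rot.
  - by apply/subsetP => s; rewrite inE => /andP[].
  move=> s; rewrite inE => /andP[sH /eqP sk] hx hy.
  move: sH; rewrite inE => /and3P[us Fs sE]; split=> //.
  have s0 : 0 < size s by rewrite size_tuple.
  have ps : path_edges s \subset cycle_edges s by rewrite (cycle_edgesE x) // subsetUr.
  apply/subsetP => s'; rewrite !inE => /and3P[-> -> /= h]; apply/andP; split.
    apply: subset_trans h _; rewrite subUset (subset_trans ps sE) /=.
    by apply: subset_trans E1T _; apply: subsetUl.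
  rewrite -ltnS -sk /bad; apply: proper_card; apply/properP; split.
    apply/subsetP => e; rewrite !inE => /andP[eEF es']; rewrite eEF.
    have := subsetP h e es'; rewrite inE => /orP[/(subsetP ps) -> //|eE].
    by move: eEF; rewrite eE.
  (* Strictness: the bad edge closed the cycle, so it is neither on the path nor in [E1], and no
     rewiring contains it. *)
  exists [set x; y]; rewrite !inE negb_or xyE xyF /=.
    by rewrite (cycle_edgesE x) // hx hy setUC setU11.
  apply/negP => /(subsetP h); rewrite inE (negPf xyE) orbF; apply/negP.
  by have := closing_notin x us; rewrite hx hy setUC size_tuple; apply.
have h : (c * n%:R * (k.+1 * #|A|)%:R <= \sum_(xy : V * V) 6 * #|nearham k|%:R)%R.
  apply: (@le_trans _ _ (c * n%:R * (\sum_(xy : V * V | [set xy.1; xy.2] \notin E1 :|: F)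
     #|[set s in A | [set xy.1; xy.2] \in cycle_edges s]|)%:R)%R).
    by rewrite ler_wpM2l ?ler_nat // mulr_ge0 // ltW.
  rewrite natr_sum mulr_sumr big_mkcond /=; apply: ler_sum => xy _.
  by case: ifP => [/hxy //|_]; rewrite mulr_ge0.
have : (c * n%:R * (k.+1 * #|A|)%:R <= 6 * #|nearham k|%:R * (n%:R * n%:R))%R.
  apply: (le_trans h); rewrite sumr_const -[X in (X <= _)%R]mulr_natr card_prod natrM; exact: lexx.
rewrite natrM => h2.
rewrite -(ler_pM2l n0R).
have -> : (n%:R * (c * k.+1%:R * #|A|%:R) = c * n%:R * (k.+1%:R * #|A|%:R))%R by ring.
have -> : (n%:R * (6 * n%:R * #|nearham k|%:R) = 6 * #|nearham k|%:R * (n%:R * n%:R) :> R)%R by ring.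
exact: h2.
Qed.

(** Raising k by one multiplies the count by at most 1 + 6n/(c(k+1)), which is at most (1+6/c)
    n/(k+1) as k+1 <= n; the product of the denominators is k!. *)
Lemma nearham_le k : k <= n ->
  (#|nearham k|%:R * k`!%:R <= ((1 + 6 / c) * n%:R) ^+ k * #|hamset E1|%:R :> R)%R.
Proof.
elim: k => [|k IH] hk.
  rewrite fact0 mulr1 expr0 mul1r ler_nat; apply: subset_leq_card; apply/subsetP => s.
  rewrite !inE leqn0 cards_eq0 setD_eq0 => /andP[/and3P[-> -> _] h].
  by rewrite h.
have {}IH := IH (ltnW hk).
have Esum : (#|nearham k.+1|%:R = #|nearham k|%:R + #|[set s in hamset ET | bad s == k.+1]|%:R :> R)%R.
  rewrite -natrD; congr _%:R%R.
  rewrite -cardsUI (_ : nearham k :&: _ = set0) ?cards0 ?addn0.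
    apply: eq_card => s; rewrite !in_set; case: [&& uniq s, _ & _] => //=.
    by rewrite orbC -leq_eqVlt.
  apply/setP => s; rewrite !in_set; case: [&& uniq s, _ & _] => //=.
  by apply/negP => /andP[h /eqP E]; move: h; rewrite E ltnn.
have := nearham_step k; set a := #|[set s in _ | _]|%:R%R in Esum * => ha.
rewrite Esum factS natrM exprS.
have k1n : (k.+1%:R <= n%:R :> R)%R by rewrite ler_nat.
have ha' : (k.+1%:R * a <= 6 / c * n%:R * #|nearham k|%:R)%R.
  rewrite -(ler_pM2l c0).
  have -> : (c * (6 / c * n%:R * #|nearham k|%:R) = 6 * n%:R * #|nearham k|%:R)%R by field; rewrite gt_eqF.
  by rewrite mulrA.
have m0 : (0 <= #|nearham k|%:R :> R)%R by [].
have h1 : (k.+1%:R * #|nearham k|%:R <= n%:R * #|nearham k|%:R :> R)%R by rewrite ler_wpM2r.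
have f0 : (0 <= k`!%:R :> R)%R by [].
apply: (@le_trans _ _ ((1 + 6 / c) * n%:R * (#|nearham k|%:R * k`!%:R))%R).
  have -> : ((#|nearham k|%:R + a) * (k.+1%:R * k`!%:R) = (k.+1%:R * #|nearham k|%:R + k.+1%:R * a) * k`!%:R)%R by ring.
  rewrite [X in (_ <= X)%R]mulrA ler_wpM2r //; lra.
rewrite -[X in (_ <= X)%R]mulrA ler_wpM2l //.
by apply: mulr_ge0; [apply: addr_ge0; [|apply: divr_ge0; [|apply: ltW]]|apply: ltW].
Qed.

(** The case k = n of [nearham_le], where n^n/n! is at most 4^n: passing from the template to [E1]
    loses only an exponential factor. *)
Lemma template_le : (#|hamset ET|%:R <= (4 * (1 + 6 / c)) ^+ n * #|hamset E1|%:R :> R)%R.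
Proof.
have := nearham_le (leqnn n).
have -> : nearham n = hamset ET.
  apply/setP => s; rewrite [in LHS]inE; case: (boolP (s \in hamset ET)) => //= _.
  apply: leq_trans (subset_leq_card (subsetDl _ _)) _.
  by apply: leq_trans (card_cycle_edges _) _; rewrite size_tuple.
move=> h.
have hf : (n%:R ^+ n <= 4 ^+ n * n`!%:R :> R)%R by rewrite -!natrX -natrM ler_nat expnn_le_fact.
have nn : (0 < n%:R ^+ n :> R)%R by rewrite exprn_gt0.
rewrite -(ler_pM2l nn).
apply: (@le_trans _ _ (4 ^+ n * n`!%:R * #|hamset ET|%:R)%R); first by rewrite ler_wpM2r.
have p4 : (0 <= 4 ^+ n :> R)%R by rewrite exprn_ge0.
have := ler_wpM2l p4 h; rewrite !exprMn => h2.
have -> : (4 ^+ n * n`!%:R * #|hamset ET|%:R = 4 ^+ n * (#|hamset ET|%:R * n`!%:R) :> R)%R by ring.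
apply: (le_trans h2); rewrite le_eqVlt; apply/orP; left; apply/eqP; ring.
Qed.

(** Small [S] are handled by switching, large [S] by counting all orderings through [S] and F and
    comparing with the number of cycles in the template. Sets that meet F lie in no member, since
    members are taken without F. *)
Lemma hamset_spread (C2 : R) (r : nat) :
  (c <= 1)%R -> (1 <= C2)%R -> (2 <= r%:R * eps)%R -> (#|F|%:R <= eps / 2 * n%:R)%R ->
  (n%:R ^+ (n - #|F|) <= C2 ^+ n * #|hamset ET|%:R)%R ->
  0 < #|hamset E1| /\
  spread (hamset E1) (fun s : T => cycle_edges s :\: F)
    (6 / c * (8 * C2 * (4 * (1 + 6 / c))) ^+ r / n%:R)%R #|hamset E1|%:R%R.
Proof.
move=> c1 C21 hr hF hT.
set K1 := (4 * (1 + 6 / c))%R.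
have K6 : (1 <= 6 / c)%R by rewrite ler_pdivlMr // mul1r (le_trans c1) // ler1n.
have K11 : (1 <= K1)%R by apply: mulr_ege1; rewrite ?ler1n // -[X in (X <= _)%R]addr0 lerD2l (le_trans _ K6).
have N0 : 0 < #|hamset E1|.
  rewrite lt0n; apply/eqP => E0; have := template_le; rewrite E0 mulr0 => h.
  have : (0 < n%:R ^+ (n - #|F|) :> R)%R by rewrite exprn_gt0.
  move/lt_le_trans/(_ hT); suff -> : (#|hamset ET|%:R = 0 :> R)%R by rewrite mulr0 ltxx.
  by apply/eqP; rewrite eq_le h /=.
split=> // S.
set K := (6 / c * _)%R.
have B1 : (1 <= 8 * C2 * K1)%R by apply: mulr_ege1 => //; apply: mulr_ege1 => //; rewrite ler1n.
have B0 : (0 < 8 * C2 * K1)%R by exact: lt_le_trans B1.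
have K0 : (0 < K)%R by rewrite /K mulr_gt0 ?exprn_gt0 // (lt_le_trans _ K6).
case: (boolP [disjoint S & F]) => [dSF|ndSF]; last first.
  rewrite (_ : [set _ in _ | _] = set0) ?cards0.
    by rewrite mulr_ge0 // exprn_ge0 // divr_ge0 // ltW.
  apply/setP => s; rewrite !in_set; apply/negP => /andP[_ sub]; case/negP: ndSF.
  apply: disjointWl sub _; by rewrite disjoint_sym disjoints_subset setDE subsetC subsetIr.
apply: (@le_trans _ _ (#|through S|%:R)%R).
  rewrite ler_nat; apply: subset_leq_card; apply/subsetP => s.
  rewrite [in X in X -> _]inE [in X in _ -> X]inE => /andP[-> /= h].
  by apply: subset_trans h (subsetDl _ _).
have [hS|hS] := lerP (#|S|%:R)%R (eps / 2 * n%:R)%R.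
  have h : (#|S|%:R + #|F|%:R <= eps * n%:R)%R by rewrite (le_trans (lerD hS hF)) // -mulrDl -splitr.
  have a1 : (0 <= 6 / c / n%:R)%R by apply: divr_ge0; [apply: le_trans K6|apply: ltW].
  have a2 : (6 / c / n%:R <= K / n%:R)%R.
    by rewrite ler_pM2r ?invr_gt0 // /K ler_peMr ?exprn_ege1 // (le_trans _ K6).
  apply: (le_trans (through_small dSF h)); apply: ler_wpM2r => //.
  by apply: lerXn2r => //; rewrite nnegrE // (le_trans a1).
(* Here |S| exceeds eps n/2 and r eps >= 2, so a constant to the power n is at most its r-th power
   to the power |S|. *)
have hnr : n <= r * #|S|.
  rewrite -(@ler_nat R) natrM.
  have r0 : (0 <= r%:R :> R)%R by [].
  have h1 : (r%:R * (eps / 2 * n%:R) <= r%:R * #|S|%:R)%R by rewrite ler_wpM2l // ltW.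
  have h2 : (2 * n%:R <= r%:R * eps * n%:R)%R by rewrite ler_pM2r.
  rewrite -(@ler_pM2l _ 2) // (le_trans h2) // -mulrA (_ : eps * n%:R = 2 * (eps / 2 * n%:R))%R.
    by rewrite mulrCA ler_pM2l.
  by rewrite !mulrA [(2 * eps)%R]mulrC mulfK // pnatr_eq0.
have [E0|[s0 s0S]] := set_0Vmem (through S).
  by rewrite E0 cards0 mulr_ge0 // exprn_ge0 // divr_ge0 // ltW.
have SFn : #|S| + #|F| <= n.
  have : #|S :|: F| <= n.
    move: s0S; rewrite !inE => /andP[/and3P[_ Fs _] Ss].
    rewrite -(size_tuple s0); apply: leq_trans (card_cycle_edges s0).
    by apply: subset_leq_card; rewrite subUset Ss.
  by rewrite cardsU (_ : S :&: F = set0) ?cards0 ?subn0 //; apply/eqP; rewrite setI_eq0.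
have hcount := card_cycles_through (S :|: F) n0.
have hle : (n%:R ^+ (#|S| + #|F|) * #|through S|%:R <= 4 ^+ n * n%:R ^+ n.+1 :> R)%R.
  rewrite -!natrX -!natrM ler_nat; apply: leq_trans hcount.
  rewrite cardsU (_ : S :&: F = set0) ?cards0 ?subn0; last by apply/eqP; rewrite setI_eq0.
  rewrite leq_mul2l; apply/orP; right; apply: subset_leq_card; apply/subsetP => s.
  by rewrite !inE subUset => /andP[/and3P[-> -> _] ->].
have hnn : (n%:R ^+ n <= n%:R ^+ #|F| * (C2 ^+ n * (K1 ^+ n * #|hamset E1|%:R)) :> R)%R.
  have -> : (n%:R ^+ n = n%:R ^+ #|F| * n%:R ^+ (n - #|F|) :> R)%R.
    by rewrite -exprD subnKC // (leq_trans _ SFn) // leq_addl.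
  rewrite ler_wpM2l ?exprn_ge0 //; apply: (le_trans hT).
  by rewrite ler_wpM2l ?template_le // exprn_ge0 // (le_trans _ C21).
(* The surplus factor n of the count is absorbed into 2^n, which turns 4 into 8 in the final
   base. *)
have n2 : (n%:R <= 2 ^+ n :> R)%R by rewrite -natrX ler_nat ltnW // ltn_expl.
have nS : (0 < n%:R ^+ #|S| :> R)%R by rewrite exprn_gt0.
have nF : (0 < n%:R ^+ #|F| :> R)%R by rewrite exprn_gt0.
rewrite expr_div_n -mulrA [(_^-1 * _)%R]mulrC mulrA ler_pdivlMr // mulrC.
rewrite -(ler_pM2l nF) mulrA -exprD addnC.
apply: (le_trans hle).
have p4 : (0 <= 4 ^+ n * n%:R :> R)%R by rewrite mulr_ge0 // exprn_ge0.
rewrite exprSr [(4 ^+ n * _)%R]mulrCA mulrC.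
apply: (le_trans (ler_wpM2l p4 hnn)).
set N := #|hamset E1|%:R%R.
have reorder (u v w x y z : R) : (u * v * (w * (x * (y * z))) = w * (v * (u * x * y) * z))%R by ring.
rewrite reorder ler_pM2l // ler_wpM2r //.
have q0 : (0 <= 4 ^+ n * C2 ^+ n * K1 ^+ n)%R by rewrite !mulr_ge0 ?exprn_ge0 // ?(le_trans _ C21) ?(le_trans _ K11).
apply: (le_trans (ler_wpM2r q0 n2)).
have E8 : (2 * 4 = 8 :> R)%R by rewrite -natrM.
rewrite -!exprMn (_ : 2 * (4 * C2 * K1) = 8 * C2 * K1)%R; last by rewrite mulrA; congr (_ * _)%R; rewrite mulrA E8.
apply: (@le_trans _ _ ((8 * C2 * K1) ^+ (r * #|S|))%R); first exact: ler_weXn2l.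
rewrite exprM lerXn2r ?nnegrE ?exprn_ge0 ?(ltW K0) ?(ltW B0) //.
by rewrite /K ler_peMl // exprn_ge0 // ltW.
Qed.

End RobustHamiltonicity.

Lemma card_rel (S T : finType) (r : S -> T -> bool) :
  #|[set st : S * T | r st.1 st.2]| = \sum_(s : S) #|[set t | r s t]|.
Proof.
rewrite -sum1dep_card; under [RHS]eq_bigr do rewrite -sum1dep_card.
by rewrite pair_big_dep.
Qed.

Lemma card_le_in (S T : finType) (A : {set S}) (B : {set T}) (f : S -> T) :
  {in A &, injective f} -> (forall a, a \in A -> f a \in B) -> #|A| <= #|B|.
Proof.
move=> inj h; rewrite -(card_in_imset inj); apply: subset_leq_card.
by apply/subsetP => _ /imsetP [a aA ->]; apply: h.
Qed.

Local Open Scope ring_scope.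

(** The letters are the cardinals in [posP_sparse]. With gam = eta^2/400, the counts w, e, m are
    successively O(gam) times n, n^2, n^2. *)
Lemma sparse_arith (R : realFieldType) (eta n w p y py e r m d1 d2 o z c s d : R) :
  0 < eta -> eta <= 1 -> 400 <= eta ^+ 2 * n -> 0 <= n -> 0 <= p -> 0 <= o -> 0 <= z -> 0 <= w ->
  w + p + y = n + py -> e <= r + n + 2 * n * w -> p * d + m <= p * (p + 1) + e ->
  d1 <= e + m -> d2 <= e + m -> o * z <= d1 + d2 + o -> c <= 2 * z -> c + 2 * p <= n + 2 * o ->
  s <= e + n * c -> o <= n -> p <= n -> py <= eta ^+ 2 / 400 * n -> r <= eta ^+ 2 / 400 * n ^+ 2 ->
  n <= 2 * p -> n <= 2 * y -> n <= 2 * d ->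
  s < eta * n ^+ 2 /\ p <= (1 / 2 + eta) * n.
Proof.
move=> eta0 eta1 hn n0 p0 o0 z0 w0 hw he hm hd1 hd2 hoz hcz hco hs on pn hpy hr np ny nd.
set gam := eta ^+ 2 / 400 in hpy hr.
have eta2 : eta ^+ 2 = 400 * gam by rewrite /gam; field.
have g0 : 0 <= gam by rewrite /gam divr_ge0 // exprn_ge0 // ltW.
have gle : gam <= eta / 400 by rewrite /gam ler_pM2r ?invr_gt0 // expr2; nra.
rewrite eta2 in hn.
have n1 : n <= gam * n ^+ 2.
  have h : 1 <= gam * n by lra.
  have := ler_wpM2r n0 h; rewrite mul1r => /le_trans; apply; rewrite expr2 mulrA lexx //.
have npos : 0 < n by nra.
have wg : w <= gam * n by lra.
have pg : p <= n / 2 + gam * n by lra.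
have nw : n * w <= gam * n ^+ 2.
  by have := ler_wpM2l n0 wg; rewrite expr2 mulrCA.
have eg : e <= 4 * gam * n ^+ 2 by lra.
have h1 : p * (p + 1 - d) <= n * (gam * n + 1).
  have h : p + 1 - d <= gam * n + 1 by lra.
  apply: (le_trans (ler_wpM2l p0 h)); apply: ler_wpM2r => //.
  by rewrite addr_ge0 // mulr_ge0.
have mg : m <= 6 * gam * n ^+ 2.
  have E1 : p * (p + 1) + e - p * d = p * (p + 1 - d) + e by ring.
  have E2 : n * (gam * n + 1) = gam * n ^+ 2 + n by ring.
  rewrite E2 in h1.
  have : m <= p * (p + 1 - d) + e by rewrite -E1; lra.
  lra.
have ozg : o * z <= 21 * gam * n ^+ 2 by lra.
(* o z is at most 21 gam n^2, while (eta/4)^2 = 25 gam: hence o or z is at most eta n/4, and each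
   alternative bounds c. *)
have cg : c <= eta / 2 * n.
  have [hz|hz] := lerP z (eta / 4 * n); first lra.
  suff ho : o <= eta / 4 * n by lra.
  rewrite leNgt; apply/negP => ho.
  have dn0 : 0 <= eta / 4 * n by rewrite mulr_ge0 // divr_ge0 // ltW.
  have h2 : (eta / 4 * n) * (eta / 4 * n) < o * z by apply: ltr_pM.
  have E3 : (eta / 4 * n) * (eta / 4 * n) = 25 * gam * n ^+ 2 by rewrite /gam; field.
  have n20 : 0 < n ^+ 2 by rewrite exprn_gt0.
  have : 0 <= gam * n ^+ 2 by rewrite mulr_ge0 // ltW.
  rewrite E3 in h2; lra.
have n20 : 0 < n ^+ 2 by rewrite exprn_gt0.
have nc : n * c <= eta / 2 * n ^+ 2.
  by have := ler_wpM2l n0 cg; rewrite expr2 mulrCA.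
have gn : gam * n ^+ 2 <= eta / 400 * n ^+ 2 by rewrite ler_pM2r.
have en : 0 < eta * n ^+ 2 by rewrite mulr_gt0.
split; first lra.
have : gam * n <= eta / 400 * n by rewrite ler_pM2r.
have : 0 < eta * n by rewrite mulr_gt0.
lra.
Qed.

Local Close Scope ring_scope.

(** * Rotations in graphs without sparse half-size pairs *)

(* For a path v_0 .. v_(n-1): [g] is adjacency of positions, [p a] says that
   v_0 is adjacent to v_(a+1), so that the path can be rotated at the edge
   v_a v_(a+1), and [q b] says that v_(n-1) is adjacent to v_b.  Closing up
   after one rotation needs [p a && q a]; [raw3] collects the pairs for which
   two rotations suffice. *)
Section Positions.
Variables (n : nat) (g : rel nat) (p q : pred nat).
Hypotheses (gsym : symmetric g) (girr : irreflexive g) (plt : forall a, p a -> a.+1 < n).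
Implicit Types a b c : 'I_n.

Let pp (b : nat) := (0 < b) && p b.-1.

Definition posP := [set a : 'I_n | p a].
Definition posY := [set a : 'I_n | q a].
Definition posW := [set a : 'I_n | ~~ p a && ~~ q a].
(** [pp b] says that v_0 is adjacent to v_b. In terms of the maximal runs of consecutive positions
    satisfying [p], [posZ] holds the first positions of the runs and [posO] the other ones; [posC]
    is where [p] holds one step to the right but not one step to the left. *)
Definition posO := [set a : 'I_n | p a && pp a].
Definition posZ := [set a : 'I_n | p a && ~~ pp a].
Definition posC := [set a : 'I_n | p a.+1 && ~~ pp a].
Definition raw3 := [set ab : 'I_n * 'I_n | [&& p ab.1, g ab.1 ab.2 &
  (ab.1.+1 < ab.2) && q ab.2.-1 || (ab.2 < ab.1) && q ab.2.+1]].
(** If [q] were the exact complement of [p] and [raw3] were empty, a neighbour v_b of v_a with [p a]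
    would have [p b.-1] when it lies to the right and [p b.+1] when it lies to the left. [err]
    collects the exceptions; [miss] collects the pairs that this pattern allows but that are not
    adjacent. *)
Let err a b := [&& p a, g a b & (a < b) && ~~ p b.-1 || (b < a) && ~~ p b.+1].
Let miss a b := [&& p a, ~~ g a b & (a < b) && p b.-1 || (b < a) && p b.+1].
Let Err := [set ab : 'I_n * 'I_n | err ab.1 ab.2].
Let Miss := [set ab : 'I_n * 'I_n | miss ab.1 ab.2].
Definition sparsePair := [set ab : 'I_n * 'I_n | [&& p ab.1, g ab.1 ab.2 & ~~ pp ab.2]].

Lemma ord_pred_val b : 0 < b -> ord_pred b = b.-1 :> nat.
Proof.
by case: b => [[|b] hb] //= _; rewrite modnDr modn_small // ltnW.
Qed.

Lemma ordS_val b : b.+1 < n -> ordS b = b.+1 :> nat.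
Proof. by move=> h; rewrite /= modn_small. Qed.

Lemma card_posW : #|posW| + #|posP| + #|posY| = n + #|posP :&: posY|.
Proof.
rewrite -addnA -cardsUI addnA; congr (_ + _).
rewrite -[RHS](card_ord n) -(cardsC (posP :|: posY)) addnC; congr (_ + _).
by apply: eq_card => a; rewrite !inE negb_or.
Qed.

(** An exceptional pair has a neighbouring position b-1 or b+1 outside [p]. If that position
    satisfies [q], the pair is in [raw3], unless b = a+1, which accounts for the term n; if not, it
    is in [posW]. *)
Lemma card_Err : #|Err| <= #|raw3| + n + 2 * n * #|posW|.
Proof.
pose next := [set ab : 'I_n * 'I_n | ab.2 == ab.1.+1 :> nat].
pose W1 := [set ab : 'I_n * 'I_n | (0 < ab.2) && (~~ p ab.2.-1 && ~~ q ab.2.-1)].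
pose W2 := [set ab : 'I_n * 'I_n | (ab.2.+1 < n) && (~~ p ab.2.+1 && ~~ q ab.2.+1)].
have h1 : #|next| <= n.
  rewrite -[leqRHS](card_ord n) -cardsT; apply: (card_le_in (f := fst)) => //.
  move=> [a b] [a' b']; rewrite !inE /= => /eqP E /eqP E' Ea; subst a'; congr pair.
  by apply: val_inj; rewrite /= E E'.
have cX : #|setX [set: 'I_n] posW| = n * #|posW| by rewrite cardsX cardsT card_ord.
have h2 : #|W1| <= n * #|posW|.
  rewrite -cX; apply: (card_le_in (f := fun ab => (ab.1, ord_pred ab.2))).
    by move=> [a b] [a' b'] _ _ /eqP; rewrite xpair_eqE /= => /andP[/eqP -> /eqP /ord_pred_inj ->].
  by move=> [a b]; rewrite !inE /= => /andP[b0]; rewrite -ord_pred_val.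
have h3 : #|W2| <= n * #|posW|.
  rewrite -cX; apply: (card_le_in (f := fun ab => (ab.1, ordS ab.2))).
    by move=> [a b] [a' b'] _ _ /eqP; rewrite xpair_eqE /= => /andP[/eqP -> /eqP /ordS_inj ->].
  by move=> [a b]; rewrite !inE => /andP[/ordS_val <-].
have sub : Err \subset (raw3 :|: next) :|: (W1 :|: W2).
  apply/subsetP => [[a b]]; rewrite !inE /err /= => /and3P[pa gab].
  rewrite pa gab /=; have [hb ha] := (ltn_ord b, ltn_ord a).
  case/orP => /andP[lt np]; rewrite np /=.
    have b0 : 0 < b by apply: leq_trans lt.
    rewrite b0; case: (boolP (q b.-1)) => [qb|]; last by rewrite !orbT.
    by move: lt; rewrite leq_eqVlt eq_sym => /orP[->|->]; rewrite ?orbT.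
  rewrite lt /=; have -> : b.+1 < n by apply: leq_ltn_trans ha.
  by case: (q b.+1); rewrite ?orbT.
apply: leq_trans (subset_leq_card sub) _.
apply: leq_trans (leq_card_setU _ _) _.
apply: (@leq_trans ((#|raw3| + #|next|) + (#|W1| + #|W2|))).
  by apply: leq_add; apply: leq_card_setU.
rewrite -mulnA mul2n -addnn; apply: leq_add; first by rewrite leq_add2l.
exact: leq_add.
Qed.

(** The pattern allows v_a at most #|posP|+1 neighbours (shifting the two sides towards a makes them
    overlap in a only). As the degree is about as large, few allowed pairs are missing. *)
Lemma card_Miss (d : nat) : (forall a, d <= #|[set b : 'I_n | g a b]|) ->
  #|posP| * d + #|Miss| <= #|posP| * #|posP|.+1 + #|Err|.
Proof.
move=> hd; rewrite /Miss /Err !card_rel.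
have sumP (f : 'I_n -> nat) : (forall a, ~~ p a -> f a = 0) -> \sum_a f a = \sum_(a in posP) f a.
  move=> hf; rewrite [RHS]big_mkcond; apply: eq_bigr => a _; rewrite inE.
  by case: ifPn => // /hf.
rewrite sumP; last first.
  move=> a na; apply/eqP; rewrite cards_eq0; apply/eqP/setP => b; by rewrite !inE /miss (negPf na).
rewrite [X in _ <= _ + X]sumP; last first.
  move=> a na; apply/eqP; rewrite cards_eq0; apply/eqP/setP => b; by rewrite !inE /err (negPf na).
rewrite -!sum_nat_const -!big_split /=; apply: leq_sum => a; rewrite inE => pa.
pose Fa := [set b : 'I_n | (a < b) && p b.-1 || (b < a) && p b.+1].
have hF : #|Fa| <= #|posP|.+1.
  pose P1 := [set b : 'I_n | p b && (a <= b)]; pose P2 := [set b : 'I_n | p b && (b <= a)].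
  have f1 : #|[set b : 'I_n | (a < b) && p b.-1]| <= #|P1|.
    apply: (card_le_in (f := @ord_pred n)).
      by move=> b b' _ _; apply: ord_pred_inj.
    move=> b; rewrite !inE => /andP[lt pb]; have b0 : 0 < b by apply: leq_trans lt.
    by rewrite ord_pred_val // pb -ltnS prednK.
  have f2 : #|[set b : 'I_n | (b < a) && p b.+1]| <= #|P2|.
    apply: (card_le_in (f := @ordS n)).
      by move=> b b' _ _; apply: ordS_inj.
    move=> b; rewrite !inE => /andP[lt pb]; have [ha _] := (ltn_ord a, tt).
    by rewrite ordS_val ?pb //; apply: leq_ltn_trans ha.
  apply: (@leq_trans (#|P1| + #|P2|)).
    apply: leq_trans (leq_add f1 f2); apply: leq_trans (leq_card_setU _ _).
    by apply: subset_leq_card; apply/subsetP => b; rewrite !inE.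
  rewrite -cardsUI -addn1; apply: leq_add.
    by apply: subset_leq_card; apply/subsetP => b; rewrite !inE => /orP[] /andP[].
  rewrite -(cards1 a); apply: subset_leq_card; apply/subsetP => b; rewrite !inE.
  by move=> /andP[/andP[_ h1] /andP[_ h2]]; rewrite -val_eqE /= eqn_leq h1 h2.
apply: (@leq_trans (#|Fa| + #|[set t | err a t]|)); last by rewrite leq_add2r.
apply: (@leq_trans (#|[set b : 'I_n | g a b]| + #|[set t | miss a t]|)); first by rewrite leq_add2r.
rewrite -[X in _ <= X]cardsUI -[X in X <= _]cardsUI; apply: leq_add; apply: subset_leq_card.
  apply/subsetP => b; rewrite !inE /err /miss pa /= => /orP[gab|/andP[_ ->] //].
  have nab : a != b :> nat by apply/eqP => E; move: gab; rewrite E girr.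
  rewrite gab /=; move: nab; rewrite neq_ltn => /orP[] lt; rewrite lt (ltnNge _ _) (ltnW lt) /=.
    by case: (p b.-1).
  by case: (p b.+1).
apply/subsetP => b; rewrite !inE /miss => /andP[->]; by rewrite andbF.
Qed.

(** Pairs on which the pattern contradicts itself: seen from one end adjacency is forbidden, seen
    from the other it is expected. So such a pair is in [Err] if adjacent and in [Miss] if not,
    possibly after exchanging its coordinates. *)
Definition posD1 := [set ab : 'I_n * 'I_n | [&& p ab.1, pp ab.1, p ab.2, ~~ p ab.2.+1 & ab.2 < ab.1]].
Definition posD2 := [set ab : 'I_n * 'I_n | [&& p ab.1, ~~ pp ab.1, p ab.2, p ab.2.+1 & ab.2 < ab.1]].

Let gE := [set ab : 'I_n * 'I_n | g ab.1 ab.2].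
Let swap (ab : 'I_n * 'I_n) := (ab.2, ab.1).
Let swap_inj : injective swap. Proof. by move=> [a b] [a' b'] [-> ->]. Qed.

Lemma card_posD1 : #|posD1| <= #|Err| + #|Miss|.
Proof.
rewrite -(cardsID gE); apply: leq_add.
  apply: subset_leq_card; apply/subsetP => [[a b]].
  by rewrite !inE /err /= => /andP[/and5P[-> _ _ -> ->] ->]; rewrite orbT.
apply: (card_le_in (f := swap)); first by move=> ? ? _ _; apply: swap_inj.
move=> [a b]; rewrite !inE /miss /pp /= => /andP[ng /and5P[_ /andP[_ pa] -> _ ->]].
by rewrite gsym ng pa.
Qed.

Lemma card_posD2 : #|posD2| <= #|Err| + #|Miss|.
Proof.
rewrite -(cardsID gE); apply: leq_add; last first.
  apply: subset_leq_card; apply/subsetP => [[a b]].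
  by rewrite !inE /miss /= => /andP[-> /and5P[-> _ _ -> ->]]; rewrite orbT.
apply: (card_le_in (f := swap)); first by move=> ? ? _ _; apply: swap_inj.
move=> [a b]; rewrite !inE /err /pp /= => /andP[/and5P[_ + -> _ lt] gab].
have -> : 0 < a by apply: leq_trans lt.
by rewrite /= => ->; rewrite gsym gab lt.
Qed.

(** Pairs of a run start z and an inner position o. If z > o, then (z, o-1) is in [posD2]. If z < o,
    the starts below o are replaced by the ends of runs below o, at most one fewer, which form pairs
    in [posD1]; the possible difference is the term #|posO|. So there are either few runs or few
    inner positions. *)
Lemma card_ZO : #|posO| * #|posZ| <= #|posD1| + #|posD2| + #|posO|.
Proof.
pose Z' := [set b : 'I_n | p b && ~~ p b.+1].
pose O' := [set b : 'I_n | p b && p b.+1].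
pose below (A : {set 'I_n}) (o : 'I_n) := A :&: [set b : 'I_n | b < o].
pose posD2' := [set oz : 'I_n * 'I_n | [&& oz.1 \in posO, oz.2 \in posZ & oz.1 < oz.2]].
have h2 : #|posD2'| <= #|posD2|.
  apply: (card_le_in (f := fun oz => (oz.2, ord_pred oz.1))).
    by move=> [a b] [a' b'] _ _ /eqP; rewrite xpair_eqE /= => /andP[/eqP -> /eqP /ord_pred_inj ->].
  move=> [o z]; rewrite !inE /pp /= => /and3P[/and3P[po o0 po'] /andP[-> ->] lt].
  by have /= -> := ord_pred_val o0; rewrite po' prednK // po ltnW.
have hO' o : #|below O' o| <= #|below posO o| + 1.
  apply: (@leq_trans #|below posO o :|: [set o]|); last first.
    by apply: leq_trans (leq_card_setU _ _) _; rewrite cards1.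
  apply: (card_le_in (f := @ordS n)); first by move=> ? ? _ _; apply: ordS_inj.
  move=> b; rewrite !inE => /andP[/andP[pb pb1] lt].
  have hb : b.+1 < n by apply: leq_ltn_trans (ltn_ord o).
  rewrite ordS_val // pb1 /pp /= pb /= -val_eqE [val (ordS b)]ordS_val //=.
  by rewrite orbC -leq_eqVlt.
have split2 o (A B C : {set 'I_n}) : A :|: B = C -> A :&: B = set0 ->
    #|below A o| + #|below B o| = #|below C o|.
  by move=> E E0; rewrite /below -E setIUl -cardsUI setIACA E0 set0I cards0 addn0.
have hZ o : #|below posZ o| <= #|below Z' o| + 1.
  have e1 : #|below posZ o| + #|below posO o| = #|below posP o|.
    apply: split2; apply/setP => b; rewrite !inE; case: (p b); case: (pp b) => //.
  have e2 : #|below Z' o| + #|below O' o| = #|below posP o|.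
    apply: split2; apply/setP => b; rewrite !inE; case: (p b); case: (p b.+1) => //.
  by have := hO' o; lia.
have h1 : \sum_(o in posO) #|below Z' o| <= #|posD1|.
  rewrite [X in _ <= X](_ : _ = \sum_(o in posO) #|[set b : 'I_n | [&& p b, ~~ p b.+1 & b < o]]|).
    by apply: leq_sum => o _; apply: subset_leq_card; apply/subsetP => b; rewrite !inE andbA.
  rewrite /posD1 (card_rel (fun a b : 'I_n => [&& p a, pp a, p b, ~~ p b.+1 & b < a])).
  rewrite [RHS]big_mkcond; apply: eq_bigr => a _; rewrite inE.
  case: ifP => ha; first by case/andP: ha => -> ->.
  apply: eq_card0 => b; rewrite !inE; by move: ha; case: (p a) => //=; case: (pp a).
have h3 : \sum_(o in posO) #|[set z in posZ | o < z]| <= #|posD2'|.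
  rewrite /posD2' (card_rel (fun o z : 'I_n => [&& o \in posO, z \in posZ & o < z])).
  rewrite big_mkcond; apply: leq_sum => a _; case: (a \in posO) => //=.
rewrite mulnC -[_ * _]mulnC -sum_nat_const.
apply: (@leq_trans (\sum_(o in posO) (#|below Z' o| + 1 + #|[set z in posZ | o < z]|))).
  apply: leq_sum => o; rewrite inE => /andP[po ppo].
  apply: (@leq_trans (#|below posZ o| + #|[set z in posZ | o < z]|)); last by rewrite leq_add2r.
  apply: leq_trans (leq_card_setU _ _); apply: subset_leq_card; apply/subsetP => z zZ.
  rewrite !inE; have : z != o :> nat.
    by apply/eqP => E; move: zZ; rewrite inE E ppo andbF.
  by rewrite inE in zZ; rewrite zZ /= neq_ltn => /orP[] ->; rewrite ?orbT.
rewrite !big_split /= sum1_card.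
by rewrite addnAC leq_add2r; apply: leq_add h1 (leq_trans h3 h2).
Qed.

(** If there are few runs, a shift by two changes [p] rarely: a position of [posC] is a run start or
    is followed by one. *)
Lemma card_C_Z : #|posC| <= 2 * #|posZ|.
Proof.
apply: (@leq_trans (#|(@ordS n) @^-1: posZ :|: posZ|)).
  apply: subset_leq_card; apply/subsetP => c; rewrite !inE => /andP[pc npp].
  have hc : c.+1 < n by apply: ltnW; apply: plt.
  by rewrite ordS_val // pc npp /pp /= andbT; case: (p c).
apply: leq_trans (leq_card_setU _ _) _; rewrite mul2n -addnn leq_add2r.
rewrite on_card_preimset //; apply: onW_bij; apply: injF_bij; exact: ordS_inj.
Qed.

Let posPP := [set b : 'I_n | pp b].

Lemma card_PP : #|posPP| = #|posP|.
Proof.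
apply/eqP; rewrite eqn_leq; apply/andP; split.
  apply: (card_le_in (f := @ord_pred n)); first by move=> ? ? _ _; apply: ord_pred_inj.
  by move=> b; rewrite !inE /pp => /andP[b0]; rewrite ord_pred_val.
apply: (card_le_in (f := @ordS n)); first by move=> ? ? _ _; apply: ordS_inj.
by move=> b; rewrite !inE => pb; rewrite ordS_val ?plt //.
Qed.

(** If there are few inner positions, [p] nearly alternates: as #|posP| is at least about n/2,
    [posP] and its shift by one cover almost everything. *)
Lemma card_C_O : #|posC| + 2 * #|posP| <= n + 2 * #|posO|.
Proof.
have h1 : #|posC :&: posP| <= #|posO|.
  apply: (card_le_in (f := @ordS n)); first by move=> ? ? _ _; apply: ordS_inj.
  move=> b; rewrite !inE => /andP[/andP[pb1 _] pb].
  by rewrite ordS_val ?plt // pb1 /pp /= pb.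
have h2 : #|posC :\: posP| + #|posP :|: posPP| <= n.
  rewrite -[leqRHS](card_ord n) -(cardsC (posP :|: posPP)) addnC leq_add2l.
  apply: subset_leq_card; apply/subsetP => c; rewrite !inE => /andP[npc /andP[_ npp]].
  by rewrite negb_or npc.
have h3 : #|posP :|: posPP| + #|posO| = #|posP| + #|posP|.
  rewrite -{2}card_PP -[RHS]cardsUI; congr (_ + _); apply: eq_card => a; by rewrite !inE.
have := cardsID posP posC; lia.
Qed.

Lemma card_sparsePair : #|sparsePair| <= #|Err| + n * #|posC|.
Proof.
rewrite -[X in X * _](card_ord n) -cardsT -cardsX.
apply: leq_trans (leq_card_setU _ _); apply: subset_leq_card; apply/subsetP => [[a b]].
rewrite !inE /err /= => /and3P[-> gab npp]; rewrite gab npp /= andbT.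
have nab : a != b :> nat by apply/eqP => E; move: gab; rewrite E girr.
move: nab; rewrite neq_ltn => /orP[] lt; rewrite lt /=.
  move: npp; rewrite /pp (leq_trans _ lt) //= => ->; by [].
by case: (p b.+1); rewrite ?orbT.
Qed.

(** Both alternatives make [posC] small, so the two sides of the pattern agree: a neighbour v_b of
    v_a with [p a] is almost always adjacent to v_0. Hence few edges join the vertices at [posP] to
    the non-neighbours of v_0, two sets of about n/2 vertices. *)
Lemma posP_sparse (R : realFieldType) (eta : R) (d : nat) :
  (0 < eta <= 1)%R -> (400 <= eta ^+ 2 * n%:R)%R ->
  (forall a, d <= #|[set b : 'I_n | g a b]|) -> n <= 2 * d ->
  n <= 2 * #|posP| -> n <= 2 * #|posY| ->
  (#|posP :&: posY|%:R <= eta ^+ 2 / 400 * n%:R)%R ->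
  (#|raw3|%:R <= eta ^+ 2 / 400 * n%:R ^+ 2)%R ->
  (#|sparsePair|%:R < eta * n%:R ^+ 2)%R /\ (#|posP|%:R <= (1 / 2 + eta) * n%:R)%R.
Proof.
move=> /andP[eta0 eta1] hn hd nd nP nY h2 h3.
have hW := card_posW; have hE := card_Err; have hM := card_Miss hd.
have hD1 := card_posD1; have hD2 := card_posD2; have hZO := card_ZO.
have hCZ := card_C_Z; have hCO := card_C_O; have hS := card_sparsePair.
have hOP : #|posO| <= n by rewrite -[leqRHS](card_ord n); apply: max_card.
have hPn : #|posP| <= n by rewrite -[leqRHS](card_ord n); apply: max_card.
apply: (@sparse_arith R eta n%:R #|posW|%:R #|posP|%:R #|posY|%:R #|posP :&: posY|%:R #|Err|%:R
  #|raw3|%:R #|Miss|%:R #|posD1|%:R #|posD2|%:R #|posO|%:R #|posZ|%:R #|posC|%:R _ d%:R) => //;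
  by rewrite ?natr1 -?natrM -?natrD ?ler_nat ?hW.
Qed.

End Positions.

Lemma nth_rotate1 (V : finType) (x0 : V) i j (s : seq V) : i <= size s -> j < size s - i ->
  nth x0 (rotate i s) j = nth x0 s (size s - j.+1).
Proof.
move=> hi hj; rewrite /rotate nth_cat size_rev size_drop hj nth_rev ?size_drop // nth_drop.
by congr nth; lia.
Qed.

Lemma nth_rotate2 (V : finType) (x0 : V) i j (s : seq V) : i <= size s -> size s - i <= j < size s ->
  nth x0 (rotate i s) j = nth x0 s (j - (size s - i)).
Proof.
move=> hi /andP[hj1 hj2]; rewrite /rotate nth_cat size_rev size_drop ltnNge hj1 /= nth_take //.
by lia.
Qed.

(* Index of the second cut that makes the vertex originally at [b] the last one,
   after a first rotation with last vertex [a]. *)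
Definition second_cut (n a b : nat) := if a < b then n - b else n - (a - b).

Lemma second_cut_bounds n a b : a < n -> b < n -> a != b -> 0 < second_cut n a b < n.
Proof. by rewrite /second_cut; case: (ltnP a b); lia. Qed.

Lemma second_cut_inj n a b b' : a < n -> b < n -> b' < n -> a != b -> a != b' ->
  second_cut n a b = second_cut n a b' -> b = b'.
Proof. by rewrite /second_cut; case: (ltnP a b); case: (ltnP a b'); lia. Qed.

Lemma second_cut_above n a b : a.+1 < b < n -> [/\ second_cut n a b = n - b,
  (n - b).-1 < n - a.+1, n - b < n - a.+1, n - (n - b).-1.+1 = b & n - (n - b).+1 = b.-1].
Proof. by move=> h; rewrite /second_cut (_ : a < b); [split|]; lia. Qed.

Lemma second_cut_below n a b : b < a < n -> [/\ second_cut n a b = n - (a - b),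
  n - a.+1 <= (n - (a - b)).-1 < n, n - a.+1 <= n - (a - b) < n,
  (n - (a - b)).-1 - (n - a.+1) = b & n - (a - b) - (n - a.+1) = b.+1].
Proof. by move=> h; rewrite /second_cut (_ : a < b = false); [split|]; lia. Qed.

Lemma half_up_le N c : N <= 2 * c -> N.+1./2 <= c. Proof. by lia. Qed.

Lemma half_up_ge N : N <= 2 * N.+1./2. Proof. by lia. Qed.

Section Rewiring.
Variables (V : finType) (E1 Q : {set {set V}}) (s0 : seq V).
Implicit Types (s : seq V).

Definition adjE (x y : V) := [set x; y] \in E1.

Lemma adjEC : symmetric adjE. Proof. by move=> x y; rewrite /adjE setUC. Qed.

Definition rewired s := [&& uniq s, Q \subset path_edges s & path_edges s \subset path_edges s0 :|: E1].

Lemma rewired_rotate x i s : 0 < i < size s -> rewired s ->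
  adjE (head x s) (nth x s i) -> [set nth x s i.-1; nth x s i] \notin Q -> rewired (rotate i s).
Proof.
move=> /andP[i0 hi] /and3P[us Qs sA] g nQ; rewrite /rewired rotate_uniq us /=.
apply/andP; split.
  apply/subsetP => e eQ; have := subsetP (sub_path_edges_rotate x i0 hi) e (subsetP Qs e eQ).
  by rewrite in_setU1 => /orP[/eqP Ee|//]; case/negP: nQ; rewrite -Ee.
apply: subset_trans (path_edges_rotate_sub x i0 hi) _.
by rewrite subUset sA andbT sub1set inE -[_ \in E1]/(adjE _ _) adjEC g orbT.
Qed.

Lemma rewired_close x (s : #|V|.-tuple V) : rewired s -> adjE (last x s) (head x s) ->
  s \in rewirings E1 Q s0.
Proof.
move=> /and3P[us Qs sA] g; rewrite inE us /=.
case E : (tval s) => [|z p]; first by rewrite E /= in Qs *; rewrite Qs sub0set.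
rewrite -E (cycle_edgesE x) ?E //.
by rewrite -E subUset sA !(subset_trans Qs) ?subsetUr // sub1set inE -[_ \in E1]/(adjE _ _) g orbT.
Qed.

(** Cuts that would destroy an edge of [Q]. Distinct cuts break distinct edges, so there are at most
    #|Q| of them. *)
Definition blocked x n s := [set k : 'I_n | (0 < k) && ([set nth x s k.-1; nth x s k] \in Q)].

Lemma card_blocked x n s : uniq s -> n <= size s -> #|blocked x n s| <= #|Q|.
Proof.
move=> us hn; apply: (card_le_in (f := fun k : 'I_n => [set nth x s k.-1; nth x s k])); last first.
  by move=> k; rewrite inE => /andP[].
move=> k k'; rewrite !inE => /andP[k0 _] /andP[k0' _] E.
apply: val_inj => /=; rewrite -(prednK k0) -(prednK k0'); congr _.+1.
have E' : [set nth x s k.-1; nth x s k.-1.+1] = [set nth x s k'.-1; nth x s k'.-1.+1] by rewrite !prednK.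
by apply: (edge_pos_inj us _ _ E'); rewrite prednK //; apply: leq_trans hn.
Qed.

End Rewiring.

Lemma card_positions (V : finType) n (s : n.-tuple V) x (f : pred V) : uniq s -> n = #|V| ->
  #|[set k : 'I_n | f (nth x s k)]| = #|[set z | f z]|.
Proof.
move=> us nV.
have inj : injective (fun k : 'I_n => nth x s k).
  move=> k k' /eqP; rewrite nth_uniq ?size_tuple // => /eqP; exact: val_inj.
rewrite -[RHS](on_card_preimset (f := fun k : 'I_n => nth x s k)).
  by apply: eq_card => k; rewrite !inE.
by apply: onW_bij; apply: inj_card_bij => //; rewrite card_ord nV.
Qed.

Section NonExtremal.
Variables (R : realFieldType) (V : finType) (E1 : {set {set V}}) (eta : R).
Local Notation n := #|V|.
Local Notation g := (adjE E1).
Hypotheses (girr : irreflexive g) (gdeg : forall x, n <= 2 * #|[set y | g x y]|).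
Hypothesis nonext : forall S T : {set V},
  ((1 / 2 - eta) * n%:R <= #|S|%:R)%R -> ((1 / 2 - eta) * n%:R <= #|T|%:R)%R ->
  (eta * n%:R ^+ 2 <= #|[set st : V * V | [&& st.1 \in S, st.2 \in T & g st.1 st.2]]|%:R)%R.
Hypotheses (heta : (0 < eta <= 1)%R) (hn : (400 <= eta ^+ 2 * n%:R)%R) (n3 : 2 < n).

Section Fixed.
Variables (s : n.-tuple V) (x y : V) (Q : {set {set V}}).
Hypotheses (us : uniq s) (hx : head x s = x) (hy : last x s = y) (Qs : Q \subset path_edges s).

Let v k := nth x s k.
Let g' a b := g (v a) (v b).
Let p a := (a.+1 < n) && g x (v a.+1).
Let q b := g y (v b).
Let B := rewirings E1 Q s : {set n.-tuple V}.

Let rs : rewired E1 Q s s. Proof. by rewrite /rewired us Qs subsetUl. Qed.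
Let ss : size s = n. Proof. exact: size_tuple. Qed.
Let plt a : p a -> a.+1 < n. Proof. by case/andP. Qed.

(** Cutting at a+1 leaves a path from y to v_a, which [q a] closes up. *)
Lemma card_switch2_ge : #|posP n p :&: posY n q| <= #|switch2 B s| + #|Q|.
Proof.
have hb := card_blocked Q x us (eq_leq (esym ss)).
apply: leq_trans (leq_add (leqnn _) hb); apply: leq_trans (leq_card_setU _ _).
apply: (card_le_in (f := @ordS n)); first by move=> ? ? _ _; apply: ordS_inj.
move=> a /setIP[pa qa]; rewrite in_set in pa; rewrite in_set in qa.
have hi := plt pa; rewrite in_setU [X in X || _]in_set [X in _ || X]in_set !ordS_val //=.
case: (boolP (_ \in Q)) => nQ; rewrite ?orbT // orbF.
apply: (rewired_close (x := x)) => /=.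
  by apply: (@rewired_rotate _ _ _ _ x) => //; rewrite ?ss ?hx ?hi //; case/andP: pa.
by rewrite head_rotate ?ss // last_rotate ?ss // hy adjEC.
Qed.

(** After the cut at a+1 the path reads v_(n-1) .. v_(a+1) v_0 .. v_a. To make v_b last it is cut
    right after v_b, where the next vertex is v_(b-1) if b > a and v_(b+1) if b < a: [q] there
    allows the second rotation, and [g a b] closes the cycle. *)
Lemma card_switch3_ge : #|raw3 n g' p q| <= #|switch3 B s| + 3 * (n * #|Q|).
Proof.
(* The sets [U1], [U2], [U3] exclude the pairs for which the first cut, the edge v_(b-1) v_b or the
   edge v_b v_(b+1) is protected. *)
have hb := card_blocked Q x us (eq_leq (esym ss)).
set Bl := blocked Q x n s in hb.
pose U1 := [set ab : 'I_n * 'I_n | ordS ab.1 \in Bl].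
pose U2 := [set ab : 'I_n * 'I_n | ab.2 \in Bl].
pose U3 := [set ab : 'I_n * 'I_n | ordS ab.2 \in Bl].
have cS : #|@ordS n @^-1: Bl| = #|Bl|.
  by rewrite on_card_preimset //; apply: onW_bij; apply: injF_bij; exact: ordS_inj.
have h1 : #|U1| <= n * #|Q|.
  rewrite (_ : U1 = setX (@ordS n @^-1: Bl) setT); last by apply/setP => ab; rewrite !inE andbT.
  by rewrite cardsX cardsT card_ord cS mulnC leq_mul2l hb orbT.
have h2 : #|U2| <= n * #|Q|.
  rewrite (_ : U2 = setX setT Bl); last by apply/setP => ab; rewrite !inE.
  by rewrite cardsX cardsT card_ord leq_mul2l hb orbT.
have h3 : #|U3| <= n * #|Q|.
  rewrite (_ : U3 = setX setT (@ordS n @^-1: Bl)); last by apply/setP => ab; rewrite !inE.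
  by rewrite cardsX cardsT card_ord cS leq_mul2l hb orbT.
pose Gd := raw3 n g' p q :\: (U1 :|: U2 :|: U3).
have sub : raw3 n g' p q \subset Gd :|: (U1 :|: U2 :|: U3).
  by apply/subsetP => ab h; rewrite inE orbC -implyNb; apply/implyP => h'; rewrite inE h' h.
apply: leq_trans (subset_leq_card sub) _; apply: leq_trans (leq_card_setU _ _) _.
apply: leq_add; last first.
  apply: leq_trans (leq_card_setU _ _) _.
  apply: (@leq_trans (n * #|Q| + n * #|Q| + n * #|Q|)); last by rewrite mulSn mul2n -addnn addnC.
  by apply: leq_add => //; apply: leq_trans (leq_card_setU _ _) _; apply: leq_add.
pose j (a b : 'I_n) : 'I_n := insubd a (second_cut n a b).
have jval (a b : 'I_n) : a != b :> nat -> j a b = second_cut n a b :> nat.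
  move=> nab; have /andP[_ h] := second_cut_bounds (ltn_ord a) (ltn_ord b) nab.
  by rewrite val_insubd h.
have neq (a b : 'I_n) : (a, b) \in Gd -> a != b :> nat.
  rewrite in_setD [X in _ && X]in_set => /andP[_ /and3P[_ gab _]].
  by apply/eqP => Eab; move: gab; rewrite /g' /= Eab girr.
apply: (card_le_in (f := fun ab => (ordS ab.1, j ab.1 ab.2))).
  move=> [a b] [a' b'] hab hab' /= /eqP; rewrite xpair_eqE => /andP[/eqP /ordS_inj Ea /eqP Ej].
  subst a'; congr pair; apply: val_inj => /=.
  have n1 := neq a b hab; have n2 := neq a b' hab'.
  have := congr1 val Ej; rewrite /= !jval //; exact: second_cut_inj.
move=> [a b] hab; have nab := neq a b hab; have Ej := jval a b nab.
move: hab; rewrite in_setD => /andP[nU]; rewrite in_set /= => /and3P[pa gab lt].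
have hi := plt pa.
move: nU; rewrite !in_setU !negb_or => /andP[/andP[nU1 nU2] nU3].
have r1 : rewired E1 Q s (rotate a.+1 s).
  apply: (@rewired_rotate _ _ _ _ x) => //; rewrite ?ss ?hx ?hi //; first by case/andP: pa.
  by move: nU1; rewrite !in_set ordS_val.
have s1 : size (rotate a.+1 s) = n by rewrite size_rotate ss.
have [ha hb'] := (ltn_ord a, ltn_ord b).
have /andP[j0 jn] := second_cut_bounds ha hb' nab.
have hhead : head x (rotate a.+1 s) = y by rewrite head_rotate ?ss.
have [E1j E2j Eq] : [/\ nth x (rotate a.+1 s) (j a b).-1 = v b, g y (nth x (rotate a.+1 s) (j a b)) &
    [set nth x (rotate a.+1 s) (j a b).-1; nth x (rotate a.+1 s) (j a b)] \notin Q].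
  rewrite Ej; case/orP: lt => /andP[lt qb].
    have hab : a.+1 < b < n by rewrite lt.
    have [-> k1 k2 k3 k4] := second_cut_above hab.
    have b0 : 0 < b by apply: leq_trans lt.
    rewrite !nth_rotate1 ?ss ?(ltnW hi) // k3 k4; split=> //.
    by move: nU2; rewrite !in_set b0 /= setUC.
  have hab : b < a < n by rewrite lt.
  have [-> k1 k2 k3 k4] := second_cut_below hab.
  rewrite !nth_rotate2 ?ss ?(ltnW hi) // k3 k4; split=> //.
  by move: nU3; rewrite !in_set ordS_val //; apply: leq_ltn_trans ha.
rewrite -Ej in j0 jn.
rewrite in_set -[(_, _).1]/(ordS a) -[(_, _).2]/(j a b) (ordS_val hi) j0 /=.
apply: (rewired_close (x := x)) => /=.
  by apply: (@rewired_rotate _ _ _ _ x) => //; rewrite ?s1 ?hhead ?j0.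
rewrite head_rotate ?s1 // last_rotate ?s1 // E1j.
by rewrite last_rotate ?ss // adjEC.
Qed.

(** If both counts of switchings were small, the predecessors on the path of the neighbours of x and
    the non-neighbours of x would be a sparse pair of sets of about n/2 vertices, against [nonext].
    Half of each threshold is left for the protected edges. *)
Lemma switch_nonextremal : (#|Q|%:R <= eta ^+ 2 / 3200 * n%:R)%R ->
  (eta ^+ 2 / 800 * n%:R <= #|switch2 B s|%:R)%R \/ (eta ^+ 2 / 800 * n%:R ^+ 2 <= #|switch3 B s|%:R)%R.
Proof.
move=> hQ.
have h2 := card_switch2_ge; have h3 := card_switch3_ge.
have n0 : (0 <= n%:R :> R)%R by [].
have arith2 (P Sw q' N e : R) : (0 <= e -> 0 <= N -> P <= Sw + q' -> q' <= e / 3200 * N -> e / 400 * N < P -> e / 800 * N <= Sw)%R.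
  move=> e0 N0 k1 k2 k3; have : (0 <= e * N)%R by rewrite mulr_ge0.
  lra.
have arith3 (P Sw q' N e : R) : (0 <= e -> 0 <= N -> P <= Sw + 3 * (N * q') -> q' <= e / 3200 * N -> e / 400 * N ^+ 2 < P -> e / 800 * N ^+ 2 <= Sw)%R.
  move=> e0 N0 k1 k2 k3; have k4 : (0 <= e * N ^+ 2)%R by rewrite mulr_ge0 // exprn_ge0.
  have k5 := ler_wpM2l N0 k2.
  have E : (N * (e / 3200 * N) = e / 3200 * N ^+ 2)%R by ring.
  rewrite E in k5; lra.
have e20 : (0 <= eta ^+ 2)%R by apply: sqr_ge0.
have [h|h] := lerP #|posP n p :&: posY n q|%:R%R (eta ^+ 2 / 400 * n%:R)%R; last first.
  left; apply: arith2 hQ h => //; by rewrite -natrD ler_nat.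
have [h'|h'] := lerP #|raw3 n g' p q|%:R%R (eta ^+ 2 / 400 * n%:R ^+ 2)%R; last first.
  right; apply: arith3 hQ h' => //; by rewrite -natrM -natrM -natrD ler_nat.
exfalso.
have gsym : symmetric g' by move=> a b; apply: adjEC.
have girr' : irreflexive g' by move=> a; apply: girr.
have degg a : n <= 2 * #|[set b : 'I_n | g' a b]|.
  by rewrite /g' (card_positions x (fun z => g (v a) z) us).
have v0 : v 0 = x by rewrite /v nth0.
have hP : n <= 2 * #|posP n p|.
  apply: leq_trans (gdeg x) _; rewrite leq_mul2l /=.
  rewrite -(card_positions x (fun z => g x z) us) //.
  apply: (card_le_in (f := @ord_pred n)); first by move=> ? ? _ _; apply: ord_pred_inj.
  move=> k; rewrite !inE => gk.
  have k0 : 0 < k by rewrite lt0n; apply/eqP => E; move: gk; rewrite E -/(v 0) v0 girr.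
  by rewrite ord_pred_val // /p prednK // ltn_ord.
have hY : n <= 2 * #|posY n q|.
  by rewrite /posY /q (card_positions x (fun z => g y z) us).
have [d hd] : exists d, d = (n.+1)./2 by eexists.
have hd1 (a : 'I_n) : d <= #|[set b : 'I_n | g' a b]|.
  by rewrite hd; apply: half_up_le.
have hd2 : n <= 2 * d by rewrite hd; apply: half_up_ge.
have [hs hPle] := posP_sparse gsym girr' plt heta hn hd1 hd2 hP hY h h'.
pose vs (A : {set 'I_n}) := [set v k | k : 'I_n in A].
have vinj : injective (fun k : 'I_n => v k).
  move=> k k' /eqP; rewrite nth_uniq ?ss // => /eqP; exact: val_inj.
pose pPP := [set b : 'I_n | ~~ ((0 < b) && p b.-1)].
have hPP : #|pPP| + #|posP n p| = n.
  rewrite -(card_PP plt) -[RHS](card_ord n) -(cardsC pPP); congr (_ + _).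
  by apply: eq_card => b; rewrite !inE negbK.
have := nonext (S := vs (posP n p)) (T := vs pPP).
rewrite !(card_imset _ vinj).
have hPR : (n%:R <= 2 * #|posP n p|%:R :> R)%R by rewrite -natrM ler_nat.
have hPPR : (#|pPP|%:R + #|posP n p|%:R = n%:R :> R)%R by rewrite -natrD hPP.
have a1 (N P : R) : (0 <= N -> N <= 2 * P -> 0 < eta <= 1 -> (1 / 2 - eta) * N <= P)%R.
  move=> N0 k1 /andP[k2 _]; have : (0 <= eta * N)%R by rewrite mulr_ge0 // ltW.
  lra.
have a2 (N P C : R) : (C + P = N -> P <= (1 / 2 + eta) * N -> (1 / 2 - eta) * N <= C)%R by lra.
move=> /(_ (a1 _ _ n0 hPR heta) (a2 _ _ _ hPPR hPle)).
rewrite leNgt => /negP; apply; apply: le_lt_trans hs; rewrite ler_nat.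
pose vv (ab : 'I_n * 'I_n) := (v ab.1, v ab.2).
have vvinj : injective vv.
  by move=> [a b] [a' b'] /eqP; rewrite xpair_eqE /= => /andP[/eqP /vinj -> /eqP /vinj ->].
rewrite -(card_imset _ vvinj); apply: subset_leq_card; apply/subsetP => [[u w]].
rewrite inE /= => /and3P[/imsetP [a ha ->] /imsetP [b hb ->] guw].
apply/imsetP; exists (a, b) => //; rewrite inE /=.
by move: ha hb; rewrite !inE => -> ->; rewrite /g' guw.
Qed.

End Fixed.

Lemma nonextremal_switchable : switchable E1 setT set0 (eta ^+ 2 / 800) (eta ^+ 2 / 3200).
Proof.
move=> s x y Q sH hx hy _ _ Qs hQ.
have us := hamset_uniq sH.
have hy' : last x s = y by rewrite -hy; case: (tval s) (size_tuple s) n3 => // <-.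
by have [h|h] := switch_nonextremal us hx hy' Qs hQ; [apply: Or31|apply: Or32].
Qed.

End NonExtremal.

(** * Rotations near a two-class template *)

Lemma card_triples_ge (R : realFieldType) (I : finType) (A : {set I}) (B : I -> {set I})
    (C : I -> I -> {set I}) (S : {set I * I * I}) (m1 m2 m3 : R) :
  (0 <= m1 -> 0 <= m2 -> 0 <= m3 -> m1 <= #|A|%:R -> (forall i, i \in A -> m2 <= #|B i|%:R) ->
  (forall i j, i \in A -> j \in B i -> m3 <= #|C i j|%:R) ->
  (forall i j k, i \in A -> j \in B i -> k \in C i j -> (i, j, k) \in S) ->
  m1 * m2 * m3 <= #|S|%:R)%R.
Proof.
move=> m10 m20 m30 hA hB hC hS.
have le1 : \sum_(i in A) \sum_(j in B i) #|C i j| <= #|S|.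
  apply: (@leq_trans #|[set ijk : I * I * I | [&& ijk.1.1 \in A, ijk.1.2 \in B ijk.1.1 & ijk.2 \in C ijk.1.1 ijk.1.2]]|).
    rewrite (card_rel (fun ij k => [&& ij.1 \in A, ij.2 \in B ij.1 & k \in C ij.1 ij.2])).
    rewrite pair_big_dep /= big_mkcond; apply: leq_sum => [[i j]] _ /=.
    case: ifP => // /andP[iA jB]; apply: subset_leq_card; apply/subsetP => k kC.
    by rewrite inE iA jB.
  by apply: subset_leq_card; apply/subsetP => [[[i j] k]]; rewrite inE => /and3P[]; apply: hS.
have le2 : (\sum_(i in A) \sum_(j in B i) #|C i j|%:R <= #|S|%:R :> R)%R.
  apply: le_trans (_ : (\sum_(i in A) \sum_(j in B i) #|C i j|)%:R <= _)%R; last by rewrite ler_nat.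
  by rewrite natr_sum; apply: ler_sum => i _; rewrite natr_sum.
apply: le_trans le2.
apply: (@le_trans _ _ (\sum_(i in A) m2 * m3)%R); last first.
  apply: ler_sum => i iA; apply: (@le_trans _ _ (\sum_(j in B i) m3)%R).
    by rewrite sumr_const -[leRHS]mulr_natl ler_wpM2r // hB.
  by apply: ler_sum => j jB; apply: hC.
by rewrite sumr_const -[leRHS]mulr_natl -mulrA ler_wpM2r // mulr_ge0.
Qed.

Section Template.
Variables (V : finType) (col : V -> bool) (flag : bool).

(* [flag = true]: complete bipartite between the two colours; [flag = false]: two
   cliques (with loops). *)
Definition tmpl (x y : V) := (col x (+) col y) == flag.

Definition tmpl_edges : {set {set V}} :=
  [set e | [exists x, [exists y, (e == [set x; y]) && tmpl x y]]].

Lemma tmplC : symmetric tmpl. Proof. by move=> x y; rewrite /tmpl addbC. Qed.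

Lemma tmpl_edgesE x y : ([set x; y] \in tmpl_edges) = tmpl x y.
Proof.
rewrite inE; apply/existsP/idP => [[u /existsP [w /andP[/eqP E h]]]|h].
  by case: (set2_eq E) => [[-> ->]|[-> ->]]; rewrite // tmplC.
by exists x; apply/existsP; exists y; rewrite eqxx.
Qed.

(** Both templates are closed under walks of length three. This keeps the two ends of the path
    adjacent in the template through all rotations. *)
Lemma tmpl3 x y z w : tmpl x y -> tmpl y z -> tmpl z w -> tmpl x w.
Proof. by rewrite /tmpl; case: (col x); case: (col y); case: (col z); case: (col w); case: flag. Qed.

End Template.

Section Extremal.
Variables (R : realFieldType) (V : finType) (col : V -> bool) (flag : bool) (E1 F : {set {set V}}).
Variables (theta eps : R).
Local Notation n := #|V|.
Local Notation T := (tmpl col flag).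
Local Notation ET := (tmpl_edges col flag).
Local Notation g := (adjE E1).
Hypotheses (girr : irreflexive g) (E1T : E1 \subset ET).
Hypothesis (gdeg : forall x, (theta * n%:R <= #|[set y | g x y]|%:R)%R).
Definition atypical := [set x | (eps * n%:R < #|[set y | T x y && ~~ g x y]|%:R)%R].
Hypothesis (atyp : (#|atypical|%:R <= eps * n%:R)%R).
Hypothesis (Tdeg : forall x, (4^-1 * n%:R <= #|[set y | T x y]|%:R :> R)%R).
Hypotheses (n3 : 2 < n) (eps0 : (0 < eps)%R) (eps_theta : (8 * eps <= theta)%R) (theta1 : (theta <= 8^-1)%R)
  (epsn : (1 <= eps * n%:R)%R).

Section Step.
Variables (s0 : n.-tuple V) (Q : {set {set V}}).
Hypotheses (FQ : F \subset Q) (s0T : path_edges s0 \subset ET :|: F) (hQ : (#|Q|%:R <= eps * n%:R)%R).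
Variables (s : n.-tuple V) (h l : V).
Hypotheses (rs : rewired E1 Q s0 s) (hh : head h s = h) (hl : last h s = l) (thl : T h l).

Let us : uniq s. Proof. by case/and3P: rs. Qed.
Let ss : size s = n. Proof. exact: size_tuple. Qed.
Let v k := nth h s k.

(** The last condition makes the new last vertex typical, that is, adjacent to almost all its
    template neighbours. *)
Definition cuts := [set k : 'I_n | [&& 0 < k, g h (v k), [set v k.-1; v k] \notin Q & v k.-1 \notin atypical]].

Lemma gT x y : g x y -> T x y.
Proof. by move=> hg; rewrite -tmpl_edgesE (subsetP E1T). Qed.

Lemma path_T k : 0 < k < n -> [set v k.-1; v k] \notin Q -> T (v k.-1) (v k).
Proof.
move=> /andP[k0 kn] nQ; have inp : [set v k.-1; v k] \in path_edges s.
  by apply/(path_edgesP h); exists k.-1; rewrite prednK // ss.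
have /and3P[_ _ sub] := rs.
have := subsetP sub _ inp; rewrite inE => /orP[h0|]; last by move=> hE; apply: gT.
have := subsetP s0T _ h0; rewrite inE => /orP[|hF]; first by rewrite tmpl_edgesE.
by case/negP: nQ; apply: (subsetP FQ).
Qed.

(** The new ends are joined by the template walk v_(k-1), v_k, h, l: a path edge outside [Q], the
    edge used for the rotation, and the invariant [thl]. *)
Lemma cuts_rewired k : k \in cuts ->
  [/\ rewired E1 Q s0 (rotate k s), head h (rotate k s) = l, last h (rotate k s) = v k.-1,
      T l (v k.-1) & v k.-1 \notin atypical].
Proof.
rewrite inE => /and4P[k0 gk nQ nat].
have kn : 0 < k < n by rewrite k0 ltn_ord.
split=> //.
- by apply: (@rewired_rotate _ _ _ _ h) => //; rewrite ?ss ?hh.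
- by rewrite head_rotate ?ss.
- by rewrite last_rotate ?ss.
- have t1 := path_T kn nQ; have t2 := gT gk.
  by rewrite tmplC (tmpl3 t1 _ thl) // tmplC.
Qed.

Lemma card_shift (A : {set V}) : #|[set k : 'I_n | (0 < k) && (v k.-1 \in A)]| <= #|A|.
Proof.
rewrite (_ : #|A| = #|[set k : 'I_n | v k \in A]|); last first.
  by rewrite (card_positions h (mem A) us) //; apply: eq_card => z; rewrite inE.
apply: (card_le_in (f := @ord_pred n)); first by move=> ? ? _ _; apply: ord_pred_inj.
by move=> k; rewrite !inE => /andP[k0 kA]; rewrite ord_pred_val.
Qed.

Lemma card_cuts : ((theta - 2 * eps) * n%:R <= #|cuts|%:R)%R.
Proof.
have h1 : #|[set z | g h z]| <= #|cuts| + (#|Q| + #|atypical|).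
  rewrite -(card_positions h (fun z => g h z) us) //.
  apply: (@leq_trans (#|cuts| + (#|blocked Q h n s| + #|[set k : 'I_n | (0 < k) && (v k.-1 \in atypical)]|))).
    apply: (@leq_trans (#|cuts :|: (blocked Q h n s :|: [set k : 'I_n | (0 < k) && (v k.-1 \in atypical)])|)).
      apply: subset_leq_card; apply/subsetP => k; rewrite [in X in X -> _]in_set => gk.
      have k0 : 0 < k.
        by rewrite lt0n; apply/eqP => E; move: gk; rewrite E nth0 hh girr.
      rewrite 2!in_setU [k \in cuts]in_set [k \in blocked _ _ _ _]in_set [k \in [set _ | _]]in_set k0 gk /=.
      by case: (_ \in Q) => //=; case: (_ \in atypical).
    apply: leq_trans (leq_card_setU _ _) _; rewrite leq_add2l; exact: leq_card_setU.
  rewrite leq_add2l; apply: leq_add; last exact: card_shift.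
  by apply: card_blocked; rewrite // ss.
have h2 := gdeg h.
have h3 : (#|[set z | g h z]|%:R <= #|cuts|%:R + (#|Q|%:R + #|atypical|%:R) :> R)%R.
  by rewrite -!natrD ler_nat.
have arith (a b q d N : R) : (theta * N <= a -> a <= b + (q + d) -> q <= eps * N -> d <= eps * N -> (theta - 2 * eps) * N <= b)%R by lra.
exact: arith h2 h3 hQ atyp.
Qed.

Definition closings := [set k : 'I_n | [&& 0 < k, g h (v k), [set v k.-1; v k] \notin Q & g l (v k.-1)]].

Lemma closings_rewirings k : k \in closings -> trotate k s \in rewirings E1 Q s0.
Proof.
rewrite inE => /and4P[k0 gk nQ gl]; have kn := ltn_ord k.
apply: (rewired_close (x := h)) => /=.
  by apply: (@rewired_rotate _ _ _ _ h) => //; rewrite ?ss ?hh ?k0.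
by rewrite head_rotate ?ss // last_rotate ?ss // hl adjEC.
Qed.

(** For a template neighbour v_k of h, the vertex v_(k-1) is automatically a template neighbour of
    l. Since both ends are typical, only a few k are lost to missing edges and to [Q]. *)
Lemma card_closings : h \notin atypical -> l \notin atypical -> (8^-1 * n%:R <= #|closings|%:R :> R)%R.
Proof.
rewrite !inE -!leNgt => hat lat.
pose Nh := [set y | T h y && ~~ g h y]; pose Nl := [set y | T l y && ~~ g l y].
have h1 : #|[set z | T h z]| <= #|closings| + (#|Q| + (#|Nh| + (#|Nl| + 1))).
  rewrite -(card_positions h (fun z => T h z) us) //.
  pose X1 := [set k : 'I_n | v k \in Nh]; pose X2 := [set k : 'I_n | (0 < k) && (v k.-1 \in Nl)].
  (* Position 0 is h itself, which counts as its own template neighbour when the template is two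
     cliques. *)
  pose X3 := [set k : 'I_n | k == 0 :> nat].
  have c1 : #|X1| = #|Nh| by rewrite (card_positions h (mem Nh) us) //; apply: eq_card => z; rewrite inE.
  have c3 : #|X3| <= 1.
    by apply/card_le1_eqP => k k'; rewrite !inE => /eqP E /eqP E'; apply: val_inj; rewrite /= E E'.
  apply: (@leq_trans (#|closings| + (#|blocked Q h n s| + (#|X1| + (#|X2| + #|X3|))))).
    apply: (@leq_trans #|closings :|: (blocked Q h n s :|: (X1 :|: (X2 :|: X3)))|).
      apply: subset_leq_card; apply/subsetP => k; rewrite [in X in X -> _]in_set => tk.
      rewrite 4!in_setU; case: (posnP k) => k0.
        by rewrite (_ : k \in X3) ?orbT // in_set k0.
      have kn : 0 < k < n by rewrite k0 ltn_ord.
      case: (boolP (k \in blocked Q h n s)) => [|nb]; first by rewrite !orbT.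
      have nQ : [set v k.-1; v k] \notin Q by move: nb; rewrite in_set k0.
      case: (boolP (k \in X1)) => [|nX1]; first by rewrite !orbT.
      case: (boolP (k \in X2)) => [|nX2]; first by rewrite !orbT.
      have gk : g h (v k) by move: nX1; rewrite in_set in_set tk /= negbK.
      have tl : T l (v k.-1).
        have t1 := path_T kn nQ; by rewrite tmplC (tmpl3 t1 _ thl) // tmplC.
      have gl : g l (v k.-1) by move: nX2; rewrite in_set in_set k0 tl /= negbK.
      by rewrite in_set k0 gk nQ gl.
    do 3 (apply: leq_trans (leq_card_setU _ _) _; rewrite leq_add2l); exact: leq_card_setU.
  rewrite leq_add2l; apply: leq_add; first by apply: card_blocked; rewrite // ss.
  rewrite c1 leq_add2l; apply: leq_add => //; exact: card_shift.
have h2 := Tdeg h.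
have h3 : (#|[set z | T h z]|%:R <= #|closings|%:R + (#|Q|%:R + (#|Nh|%:R + (#|Nl|%:R + 1))) :> R)%R.
  by rewrite -[1%R]/(1%:R)%R -!natrD ler_nat.
have arith (a b q x y N : R) : (4^-1 * N <= a -> a <= b + (q + (x + (y + 1))) -> q <= eps * N -> x <= eps * N ->
   y <= eps * N -> 1 <= eps * N -> eps * N <= 64^-1 * N -> 0 <= N -> 8^-1 * N <= b)%R by lra.
have e64 : (eps * n%:R <= 64^-1 * n%:R)%R.
  by rewrite ler_wpM2r //; move: eps_theta theta1; lra.
exact: arith h2 h3 hQ hat lat epsn e64 _.
Qed.

End Step.

(** The ends x and y may both be atypical. A rotation moves the last vertex to the front and brings
    in a new last one, so two rotations replace both ends by typical vertices and a third one can
    close the cycle. The constant is the product of theta/2, theta/2 and 1/8. *)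
Lemma extremal_switchable : switchable E1 ET F ((theta / 2) ^+ 2 / 8) eps.
Proof.
move=> s x y Q sH hx hy xyF FQ Qs hQ.
have us := hamset_uniq sH.
have s0 : 0 < size s by rewrite size_tuple; exact: leq_trans n3.
have sT : path_edges s \subset ET :|: F.
  move: sH; rewrite inE => /and3P[_ _]; apply: subset_trans.
  by rewrite (cycle_edgesE x) // subsetUr.
have hy' : last x s = y by rewrite -hy; case: (tval s) s0.
have txy : T x y.
  rewrite -tmpl_edgesE; move: sH; rewrite inE => /and3P[_ _ sub].
  have : [set x; y] \in cycle_edges s by rewrite (cycle_edgesE x) // hx hy' setUC setU11.
  by move/(subsetP sub); rewrite inE (negPf xyF) orbF.
have rs : rewired E1 Q s s by rewrite /rewired us Qs subsetUl.
apply: Or33.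
have th0 : (0 <= theta / 2 * n%:R)%R.
  by rewrite mulr_ge0 // divr_ge0 //; move: eps0 eps_theta; lra.
have thle : (theta / 2 * n%:R <= (theta - 2 * eps) * n%:R)%R.
  by rewrite ler_wpM2r //; move: eps0 eps_theta; lra.
have E : ((theta / 2) ^+ 2 / 8 * n%:R ^+ 3 = (theta / 2 * n%:R) * (theta / 2 * n%:R) * (8^-1 * n%:R))%R.
  by move: theta (n%:R : R)%R => t N; field.
rewrite E.
pose A := cuts Q s x.
pose B (i : 'I_n) := cuts Q (trotate i s) y.
pose C (i j : 'I_n) := closings Q (trotate j (trotate i s)) (nth x s i.-1) (nth y (trotate i s) j.-1).
have hA i : i \in A -> [/\ rewired E1 Q s (trotate i s), head y (trotate i s) = y, last y (trotate i s) = nth x s i.-1,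
      T y (nth x s i.-1) & nth x s i.-1 \notin atypical].
  move=> iA; have [r1 e1 e2 t1 n1] := cuts_rewired FQ sT rs hx hy' txy iA.
  have z : 0 < size (rotate i s) by rewrite size_rotate.
  split=> //=; first by rewrite -e1; case: (rotate i s) z.
  by rewrite -e2; case: (rotate i s) z.
have hB i j : i \in A -> j \in B i ->
   let h := nth x s i.-1 in let l := nth y (trotate i s) j.-1 in
   [/\ rewired E1 Q s (trotate j (trotate i s)), head h (trotate j (trotate i s)) = h,
     last h (trotate j (trotate i s)) = l, T h l & l \notin atypical].
  move=> iA jB h l; have [r1 e1 e2 t1 n1] := hA i iA.
  have [r2 f1 f2 t2 n2] := cuts_rewired FQ sT r1 e1 e2 t1 jB.
  have z : 0 < size (rotate j (trotate i s)) by rewrite size_rotate size_tuple; exact: leq_trans n3.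
  split=> //=; first by rewrite -[RHS]f1; case: (rotate j _) z.
  by rewrite -[RHS]f2; case: (rotate j _) z.
apply: (card_triples_ge (A := A) (B := B) (C := C)) => //.
- by rewrite mulr_ge0 // invr_ge0.
- exact: le_trans thle (card_cuts hQ rs hx).
- by move=> i iA; have [r1 e1 _ _ _] := hA i iA; exact: le_trans thle (card_cuts hQ r1 e1).
- move=> i j iA jB; have [_ _ _ _ n1] := hA i iA; have [r2 f1 f2 t2 n2] := hB i j iA jB.
  exact: (card_closings FQ sT hQ r2 t2 n1 n2).
move=> i j k iA jB kC; have [r2 f1 f2 t2 n2] := hB i j iA jB.
rewrite in_set /=.
have [i0 j0 k0] : [/\ 0 < i, 0 < j & 0 < k].
  by split; [move: iA|move: jB|move: kC]; rewrite inE => /and4P[].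
rewrite i0 j0 k0 /=; exact: (closings_rewirings r2 f1 f2 kC).
Qed.

End Extremal.

Local Open Scope ring_scope.

(** * Structure of extremal graphs *)

Lemma extremal_split_arith (R : realFieldType) (mu rho eta N s t i j e na1 : R) :
  0 < mu -> mu <= 600^-1 -> rho = mu / 4 -> eta = rho ^+ 2 / 3 -> 0 < N -> 0 <= i -> 0 <= j -> 0 <= na1 ->
  i + j = s -> (1 / 2 - eta) * N <= s -> (1 / 2 - eta) * N <= t -> t <= N ->
  e <= eta * N ^+ 2 -> na1 <= 2 * eta * N ^+ 2 ->
  i * j <= e + na1 -> s * N <= 2 * (e + s * (N - t)) ->
  [/\ 0 <= eta, eta <= mu / 600, t <= (1 / 2 + 3 * eta) * N & i <= rho * N \/ j <= rho * N].
Proof.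
move=> mu0 mu1 Er Ee N0 i0 j0 na0 hij hs ht tN he h1 hij2 hsN.
have r0 : 0 < rho by rewrite Er divr_gt0.
have eta0 : 0 <= eta by rewrite Ee divr_ge0 // exprn_ge0 // ltW.
have etamu : eta <= mu / 600.
  rewrite Ee Er; have : mu ^+ 2 <= mu * 600^-1 by rewrite expr2 ler_wpM2l // ltW.
  have -> : (mu / 4) ^+ 2 / 3 = mu ^+ 2 / 48 by field.
  lra.
have s3 : N <= 3 * s by nra.
split=> //.
  rewrite leNgt; apply/negP => h.
  have k1 : 3 * s * (eta * N) < s * (t - N / 2).
    have sp : 0 < s by lra.
    have -> : 3 * s * (eta * N) = s * (3 * eta * N) by ring.
    rewrite ltr_pM2l //; lra.
  have k2 : N * (eta * N) <= 3 * s * (eta * N) by rewrite ler_wpM2r // mulr_ge0 // ltW.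
  have k3 : N * (eta * N) = eta * N ^+ 2 by ring.
  have k4 : s * (t - N / 2) = s * t - s * N / 2 by ring.
  have k5 : s * (N - t) = s * N - s * t by ring.
  lra.
have [hi|hi] := lerP i (rho * N); first by left.
right; rewrite leNgt; apply/negP => hj.
have rN : 0 <= rho * N by rewrite mulr_ge0 // ltW.
have k1 : (rho * N) * (rho * N) < i * j by apply: ltr_pM.
have k2 : (rho * N) * (rho * N) = 3 * eta * N ^+ 2 by rewrite Ee; field.
lra.
Qed.

Lemma extremal_differ_arith (R : realFieldType) (mu rho eta N s t i j na1 na d : R) :
  0 < mu -> mu <= 600^-1 -> rho = mu / 4 -> 0 <= eta -> eta <= mu / 600 -> 0 < N ->
  0 <= s -> s <= N -> i + j = s -> (1 / 2 - eta) * N <= s -> t <= (1 / 2 + 3 * eta) * N ->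
  j <= rho * N -> i <= t -> na1 <= 2 * eta * N ^+ 2 -> na <= na1 + s * (t - i) -> d <= 2 * na ->
  [/\ d <= mu * N ^+ 2, (1 / 2 - mu) * N <= s & s <= (1 / 2 + mu) * N].
Proof.
move=> mu0 mu1 Er eta0 etamu N0 s0 sN hij hs ht hj it h1 h2 hd.
have eN : eta * N <= mu / 600 * N by rewrite ler_pM2r.
have mN : 0 < mu * N by rewrite mulr_gt0.
rewrite Er in hj.
have k1 : s * (t - i) <= N * ((4 * (mu / 600) + mu / 4) * N).
  apply: ler_pM => //; lra.
have k2 : N * ((4 * (mu / 600) + mu / 4) * N) = (4 * (mu / 600) + mu / 4) * N ^+ 2 by ring.
have k3 : eta * N ^+ 2 <= mu / 600 * N ^+ 2 by rewrite ler_pM2r // exprn_gt0.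
have k4 : 0 < mu * N ^+ 2 by rewrite mulr_gt0 // exprn_gt0.
split; lra.
Qed.

Lemma extremal_same_arith (R : realFieldType) (mu rho eta N s t i j na1 na2 a b d : R) :
  0 < mu -> mu <= 600^-1 -> rho = mu / 4 -> 0 <= eta -> eta <= mu / 600 -> 0 < N ->
  0 <= s -> s <= N -> 0 <= i -> i + j = s -> (1 / 2 - eta) * N <= s -> (1 / 2 - eta) * N <= t ->
  i <= rho * N -> 0 <= N - s - t + i -> na1 <= 2 * eta * N ^+ 2 -> na2 <= 2 * eta * N ^+ 2 ->
  a <= na1 + s * i -> b <= na2 + (N - s - t + i) * (N - s) -> d <= a + b ->
  [/\ d <= mu * N ^+ 2, (1 / 2 - mu) * N <= s & s <= (1 / 2 + mu) * N].
Proof.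
move=> mu0 mu1 Er eta0 etamu N0 s0 sN i0 hij hs ht hi st h1 h2 ha hb hd.
have eN : eta * N <= mu / 600 * N by rewrite ler_pM2r.
have mN : 0 < mu * N by rewrite mulr_gt0.
rewrite Er in hi.
have k1 : s * i <= N * (mu / 4 * N) by apply: ler_pM.
have k1' : (N - s - t + i) * (N - s) <= (2 * (mu / 600) + mu / 4) * N * N.
  by apply: ler_pM => //; lra.
have k2 : N * (mu / 4 * N) = mu / 4 * N ^+ 2 by ring.
have k2' : (2 * (mu / 600) + mu / 4) * N * N = (2 * (mu / 600) + mu / 4) * N ^+ 2 by ring.
have k3 : eta * N ^+ 2 <= mu / 600 * N ^+ 2 by rewrite ler_pM2r // exprn_gt0.
have k4 : 0 < mu * N ^+ 2 by rewrite mulr_gt0 // exprn_gt0.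
split; lra.
Qed.

Lemma setU_arith (R : realFieldType) (N s t i u w : R) :
  u + i = s + t -> u + w = N -> w = N - s - t + i.
Proof. by lra. Qed.

Local Close Scope ring_scope.

Section Structure.
Variables (R : realFieldType) (V : finType) (g : rel V).
Local Notation n := #|V|.
Hypotheses (gsym : symmetric g) (gdeg : forall x, n <= 2 * #|[set y | g x y]|).
Implicit Types S T : {set V}.

Definition adjPairs S T := [set st : V * V | [&& st.1 \in S, st.2 \in T & g st.1 st.2]].
Definition nonadjPairs S T := [set st : V * V | [&& st.1 \in S, st.2 \in T & ~~ g st.1 st.2]].

Lemma card_adjPairsC S T : #|adjPairs S T| = #|adjPairs T S|.
Proof.
have h A B : #|adjPairs A B| <= #|adjPairs B A|.
  apply: (card_le_in (f := fun st => (st.2, st.1))).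
    by move=> [a b] [a' b'] _ _ [-> ->].
  by move=> [a b]; rewrite !inE /= => /and3P[-> ->]; rewrite gsym.
by apply/eqP; rewrite eqn_leq !h.
Qed.

Lemma card_adj_nonadj S T : #|adjPairs S T| + #|nonadjPairs S T| = #|S| * #|T|.
Proof.
rewrite -cardsX -[RHS](cardsID [set st : V * V | g st.1 st.2]); congr (_ + _);
  by apply: eq_card => st; rewrite !inE andbA // andbC.
Qed.

Lemma card_adj_rect S T S' T' : S \subset S' -> T \subset T' -> #|adjPairs S T| <= #|adjPairs S' T'|.
Proof.
move=> /subsetP sS /subsetP sT; apply: subset_leq_card; apply/subsetP => [[a b]].
by rewrite !inE /= => /and3P[/sS -> /sT -> ->].
Qed.

Lemma card_nonadj_rect S T S' T' : S \subset S' -> T \subset T' ->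
  #|nonadjPairs S T| <= #|nonadjPairs S' T'|.
Proof.
move=> /subsetP sS /subsetP sT; apply: subset_leq_card; apply/subsetP => [[a b]].
by rewrite !inE /= => /and3P[/sS -> /sT -> ->].
Qed.

Lemma card_nonadjUr S T T' : #|nonadjPairs S (T :|: T')| <= #|nonadjPairs S T| + #|S| * #|T'|.
Proof.
rewrite -cardsX; apply: leq_trans (leq_card_setU _ _); apply: subset_leq_card.
apply/subsetP => [[a b]]; rewrite !inE /= => /and3P[-> /orP[->|->] ->] //.
by rewrite !orbT.
Qed.

Lemma card_nonadjUl S S' T : #|nonadjPairs (S :|: S') T| <= #|nonadjPairs S T| + #|S'| * #|T|.
Proof.
rewrite -cardsX; apply: leq_trans (leq_card_setU _ _); apply: subset_leq_card.
apply/subsetP => [[a b]]; rewrite !inE /= => /and3P[/orP[->|->] -> ->] //.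
by rewrite !orbT.
Qed.

Lemma adj_setC S T : #|S| * n <= 2 * (#|adjPairs S T| + #|adjPairs S (~: T)|).
Proof.
have -> : #|adjPairs S T| + #|adjPairs S (~: T)| = \sum_(s in S) #|[set y | g s y]|.
  rewrite /adjPairs (card_rel (fun s t => [&& s \in S, t \in T & g s t])).
  rewrite (card_rel (fun s t => [&& s \in S, t \in ~: T & g s t])) -big_split /=.
  rewrite [RHS]big_mkcond; apply: eq_bigr => s _; case: ifP => sS; last first.
    by rewrite !eq_card0 // => t; rewrite !inE.
  rewrite -[RHS](cardsID T [set y | g s y]); congr (_ + _);
    by apply: eq_card => y; rewrite !inE //= andbC.
rewrite big_distrr /= -sum_nat_const; apply: leq_sum => s _; exact: gdeg.
Qed.

(** A vertex has degree at least n/2 and [~: T] has little more than n/2 elements, so a set with few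
    edges to [T] must be joined to almost all of [~: T]. *)
Lemma sparse_setC S T (eta : R) :
  ((1 / 2 - eta) * n%:R <= #|T|%:R)%R -> (#|adjPairs S T|%:R <= eta * n%:R ^+ 2)%R -> (0 <= eta)%R ->
  (#|nonadjPairs S (~: T)|%:R <= 2 * eta * n%:R ^+ 2)%R.
Proof.
move=> hT hST eta0.
have h1 := adj_setC S T; have h2 := card_adj_nonadj S (~: T); have h3 := cardsC T.
have hS : #|S| <= n by apply: max_card.
move: h1 h2 h3 hS hT hST; rewrite -!(@ler_nat R).
move=> h1 /(congr1 (fun k => k%:R : R)%R) h2 /(congr1 (fun k => k%:R : R)%R) h3.
move: h1 h2 h3; rewrite !natrM !natrD.
move: (#|S|%:R)%R (#|T|%:R)%R (#|~: T|%:R)%R (n%:R)%R (#|adjPairs S T|%:R)%R (#|adjPairs S (~: T)|%:R)%R (#|nonadjPairs S (~: T)|%:R)%R (ler0n R #|S|).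
move=> s t c N e1 e2 e3 s0 h1 h2 h3 hs ht he.
have h4 : (s * c <= s * (N / 2 + eta * N))%R by rewrite ler_wpM2l //; lra.
have h5 : (eta * (s * N) <= eta * N ^+ 2)%R.
  by rewrite expr2 ler_wpM2l // ler_wpM2r //; lra.
have E : (s * (N / 2 + eta * N) = s * N / 2 + eta * (s * N))%R by ring.
lra.
Qed.

(** Only missing template edges count; further edges of [g] do no harm, as the cycles will be sought
    inside the template. *)
Definition defects (col : V -> bool) flag :=
  [set xy : V * V | tmpl col flag xy.1 xy.2 && ~~ g xy.1 xy.2].

(** A pair in I x J, with I = S :&: T and J = S :\: T, is either an edge from S to T or a non-edge
    from S to the complement of T, and both are rare. Hence I or J is small. If J is small, S nearly
    equals T and is almost completely joined to its complement: the bipartite template. If I is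
    small, T nearly equals the complement of S, and both sides are nearly complete: two cliques. *)
Lemma extremal_coloring (mu : R) S T : 0 < n -> (0 < mu <= 600^-1)%R ->
  let eta := ((mu / 4) ^+ 2 / 3)%R in
  ((1 / 2 - eta) * n%:R <= #|S|%:R)%R -> ((1 / 2 - eta) * n%:R <= #|T|%:R)%R ->
  (#|adjPairs S T|%:R <= eta * n%:R ^+ 2)%R ->
  exists flag, [/\ (#|defects (mem S) flag|%:R <= mu * n%:R ^+ 2)%R,
     ((1 / 2 - mu) * n%:R <= #|S|%:R)%R & (#|S|%:R <= (1 / 2 + mu) * n%:R)%R].
Proof.
move=> n0 /andP[mu0 mu1] eta hS hT he.
have n0R : (0 < n%:R :> R)%R by rewrite ltr0n.
have e0 : (0 <= eta)%R by rewrite divr_ge0 // exprn_ge0 // divr_ge0 // ltW.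
have na1 := sparse_setC hT he e0.
have he' : (#|adjPairs T S|%:R <= eta * n%:R ^+ 2)%R by rewrite card_adjPairsC.
have na2 := sparse_setC hS he' e0.
pose I := S :&: T; pose J := S :\: T.
have IJ : #|I| + #|J| = #|S| by apply: cardsID.
have IJn : #|I| * #|J| <= #|adjPairs S T| + #|nonadjPairs S (~: T)|.
  rewrite -card_adj_nonadj; apply: leq_add.
    by rewrite card_adjPairsC; apply: card_adj_rect; [apply: subsetDl|apply: subsetIr].
  by apply: card_nonadj_rect; [apply: subsetIl|rewrite /J setDE subsetIr].
have hSn : #|S| * n <= 2 * (#|adjPairs S T| + #|S| * #|~: T|).
  apply: leq_trans (adj_setC S T) _; rewrite leq_mul2l leq_add2l /=.
  by rewrite -card_adj_nonadj leq_addr.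
have toR k l : k <= l -> (k%:R <= l%:R :> R)%R by rewrite ler_nat.
have CT : (#|~: T|%:R = n%:R - #|T|%:R :> R)%R by rewrite -(cardsC T) natrD addrC addKr.
have CS : (#|~: S|%:R = n%:R - #|S|%:R :> R)%R by rewrite -(cardsC S) natrD addrC addKr.
have Tn := toR _ _ (max_card (mem T)); have Sn := toR _ _ (max_card (mem S)).
have IJR : (#|I|%:R + #|J|%:R = #|S|%:R :> R)%R by rewrite -natrD IJ.
have := toR _ _ IJn; rewrite natrM natrD => IJnR.
have := toR _ _ hSn; rewrite !natrM natrD natrM CT => hSnR.
have [_ etamu tle hor] := extremal_split_arith mu0 mu1 erefl erefl n0R (ler0n _ _) (ler0n _ _) (ler0n _ _)
  IJR hS hT Tn he na1 IJnR hSnR.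
case: hor => [hi|hj]; last first.
  exists true.
  have dle : #|defects (mem S) true| <= 2 * #|nonadjPairs S (~: S)|.
    rewrite mul2n -addnn.
    apply: (@leq_trans (#|nonadjPairs S (~: S)| + #|[set xy : V * V | (xy.2, xy.1) \in nonadjPairs S (~: S)]|)).
      apply: leq_trans (leq_card_setU _ _); apply: subset_leq_card; apply/subsetP => [[x y]].
      rewrite !inE /= /tmpl /= => /andP[/eqP + ng]; rewrite gsym (gsym y) ng.
      by case: (x \in S); case: (y \in S).
    rewrite leq_add2l; apply: (card_le_in (f := fun xy => (xy.2, xy.1))).
      by move=> [a b] [a' b'] _ _ [-> ->].
    by move=> [a b]; rewrite inE.
  have nale : #|nonadjPairs S (~: S)| <= #|nonadjPairs S (~: T)| + #|S| * #|T :\: S|.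
    apply: leq_trans (card_nonadjUr _ _ _); apply: card_nonadj_rect => //.
    by apply/subsetP => x; rewrite !inE => ->; case: (x \in T).
  have TS : (#|T :\: S|%:R = #|T|%:R - #|I|%:R :> R)%R.
    by rewrite -(cardsID S T) setIC natrD addrC addKr.
  have := toR _ _ nale; rewrite natrD natrM TS => naleR.
  have := toR _ _ dle; rewrite natrM => dleR.
  have IT : (#|I|%:R <= #|T|%:R :> R)%R by rewrite ler_nat subset_leq_card // subsetIr.
  exact: extremal_differ_arith mu0 mu1 erefl e0 etamu n0R (ler0n _ _) Sn IJR hS tle hj IT na1 naleR dleR.
exists false.
have dle : #|defects (mem S) false| <= #|nonadjPairs S S| + #|nonadjPairs (~: S) (~: S)|.
  apply: leq_trans (leq_card_setU _ _); apply: subset_leq_card; apply/subsetP => [[x y]].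
  rewrite !inE /= /tmpl /= => /andP[/eqP + ->].
  by case: (x \in S); case: (y \in S).
have ale : #|nonadjPairs S S| <= #|nonadjPairs S (~: T)| + #|S| * #|I|.
  apply: leq_trans (card_nonadjUr _ _ _); apply: card_nonadj_rect => //.
  by apply/subsetP => x; rewrite !inE => ->; case: (x \in T).
have ble : #|nonadjPairs (~: S) (~: S)| <= #|nonadjPairs T (~: S)| + #|~: (S :|: T)| * #|~: S|.
  apply: leq_trans (card_nonadjUl _ _ _); apply: card_nonadj_rect => //.
  by apply/subsetP => x; rewrite !inE => /negPf ->; case: (x \in T).
have UR : (#|~: (S :|: T)|%:R = n%:R - #|S|%:R - #|T|%:R + #|I|%:R :> R)%R.
  have E1 : (#|S :|: T|%:R + #|I|%:R = #|S|%:R + #|T|%:R :> R)%R by rewrite -!natrD cardsUI.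
  have E2 : (#|S :|: T|%:R + #|~: (S :|: T)|%:R = n%:R :> R)%R by rewrite -natrD cardsC.
  exact: setU_arith E1 E2.
have := toR _ _ ble; rewrite natrD natrM UR CS => bleR.
have := toR _ _ ale; rewrite natrD natrM => aleR.
have := toR _ _ dle; rewrite natrD => dleR.
have U0 : (0 <= n%:R - #|S|%:R - #|T|%:R + #|I|%:R :> R)%R by rewrite -UR.
exact: extremal_same_arith mu0 mu1 erefl e0 etamu n0R (ler0n _ _) Sn (ler0n _ _) IJR hS hT hi U0 na1 na2 aleR bleR dleR.
Qed.

End Structure.

Lemma exists_subset_card (T : finType) (A : {set T}) m : m <= #|A| ->
  exists2 Z : {set T}, Z \subset A & #|Z| = m.
Proof.
move=> hm; exists [set x in take m (enum A)].
  by apply/subsetP => x; rewrite inE => /mem_take; rewrite mem_enum.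
have /card_uniqP h : uniq (take m (enum A)) by rewrite take_uniq // enum_uniq.
rewrite (_ : #|[set x in _]| = #|take m (enum A)|); last by apply: eq_card => x; rewrite inE.
by rewrite h size_takel // -cardE.
Qed.

Lemma odd_gap_le (k : nat) : k - 2 * k./2 <= 1. Proof. by lia. Qed.

Lemma shift_gap (a b z k : nat) : b <= a -> k = a - b -> 2 * z <= k -> b + z <= a - z.
Proof. by lia. Qed.

Lemma shift_gapE (a b z k : nat) : b <= a -> k = a - b -> 2 * z <= k -> a - z - (b + z) = k - 2 * z.
Proof. by lia. Qed.

Local Open Scope ring_scope.

Lemma recolor_arith (R : realFieldType) (mu N f d : R) : 0 <= mu -> mu <= 600^-1 -> 0 <= N ->
  f <= 5 * mu * N -> N <= 4 * (d + f) -> 5^-1 * N <= d.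
Proof.
move=> mu0 mu1 N0 hf hd.
have : mu * N <= 600^-1 * N by rewrite ler_wpM2r.
lra.
Qed.

Lemma recolor_arith2 (R : realFieldType) (mu N f d e : R) : 0 <= mu -> mu <= 600^-1 -> 0 <= N ->
  f <= 5 * mu * N -> N <= 2 * (e + (d + f)) -> 4 * e <= N -> 5^-1 * N <= d.
Proof. by move=> mu0 mu1 N0 hf hd he; apply: recolor_arith hf _ => //; lra. Qed.

Lemma flip_arith (R : realFieldType) (mu N f a : R) : 0 <= mu -> mu <= 600^-1 -> 0 < N ->
  f * (5^-1 * N) <= a -> a <= mu * N ^+ 2 -> f <= 5 * mu * N.
Proof.
move=> mu0 mu1 N0 h1 h2; rewrite -(ler_pM2r N0).
have -> : 5 * mu * N * N = 5 * (mu * N ^+ 2) by ring.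
have E : f * (5^-1 * N) = 5^-1 * (f * N) by ring.
rewrite E in h1; lra.
Qed.

Lemma flip_deg_arith (R : realFieldType) (mu N t d e : R) : 0 <= mu -> mu <= 600^-1 -> 0 <= N ->
  (1 / 2 - mu) * N <= t -> t <= d + e -> 4 * d <= N -> 5^-1 * N <= e.
Proof.
move=> mu0 mu1 N0 h1 h2 h3; have : mu * N <= 600^-1 * N by rewrite ler_wpM2r.
lra.
Qed.

Lemma defect_arith (R : realFieldType) (mu nu N f d0 d1 : R) : 0 <= N ->
  d1 <= d0 + (f * N + N * f) -> f <= mu * N -> d0 <= nu * N ^+ 2 ->
  d1 <= (nu + 2 * mu) * N ^+ 2.
Proof.
move=> N0 h1 h2 h3; have k : N * f <= N * (mu * N) by rewrite ler_wpM2l.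
have E : N * (mu * N) = mu * N ^+ 2 by ring.
rewrite [f * N]mulrC in h1; lra.
Qed.

Lemma weaken_defects (R : realFieldType) (mu N : R) : 0 <= mu * N -> 11 * mu * N <= 23 * mu * N.
Proof. by lra. Qed.

Lemma weaken_deg (R : realFieldType) (N : R) : 0 <= N -> 100^-1 * N <= 5^-1 * N.
Proof. by lra. Qed.

Lemma six_mu (R : realFieldType) (mu : R) : 0 < mu -> mu <= 600^-1 -> 0 <= 6 * mu <= 100^-1.
Proof. by move=> h1 h2; apply/andP; split; lra. Qed.

Local Close Scope ring_scope.

Section Recolor.
Variables (R : realFieldType) (V : finType) (g : rel V).
Local Notation n := #|V|.
Hypotheses (gsym : symmetric g) (gdeg : forall x, n <= 2 * #|[set y | g x y]|).
Implicit Types (col : V -> bool) (flag : bool).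

Definition classT col := [set x | col x].
Definition degT col flag x := #|[set y | tmpl col flag x y && g x y]|.
Definition balanced col (mu : R) :=
  ((1 / 2 - mu) * n%:R <= #|classT col|%:R)%R /\ (#|classT col|%:R <= (1 / 2 + mu) * n%:R)%R.

Let toR k l : k <= l -> (k%:R <= l%:R :> R)%R. Proof. by rewrite ler_nat. Qed.
Let N0 : (0 <= n%:R :> R)%R. Proof. by []. Qed.

Lemma tmpl_deg col flag mu x : balanced col mu ->
  ((1 / 2 - mu) * n%:R <= #|[set y | tmpl col flag x y]|%:R)%R.
Proof.
move=> [h1 h2]; case: (boolP (col x (+) flag)) => hc.
  rewrite (_ : [set y | _] = classT col) //; apply/setP => y; rewrite !inE /tmpl.
  by move: hc; case: (col x); case: (col y); case: flag.
rewrite (_ : [set y | _] = ~: classT col); last first.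
  apply/setP => y; rewrite !inE /tmpl.
  by move: hc; case: (col x); case: (col y); case: flag.
have E : (#|classT col|%:R + #|~: classT col|%:R = n%:R :> R)%R by rewrite -natrD cardsC.
have arith (a b N : R) : (a + b = N -> a <= (1 / 2 + mu) * N -> (1 / 2 - mu) * N <= b)%R by lra.
exact: arith E h2.
Qed.

Lemma card_defects_change col col' flag (Z : {set V}) : (forall x, x \notin Z -> col' x = col x) ->
  #|defects g col' flag| <= #|defects g col flag| + (#|Z| * n + n * #|Z|).
Proof.
move=> hZ; have -> : #|Z| * n = #|setX Z [set: V]| by rewrite cardsX cardsT.
have -> : n * #|Z| = #|setX [set: V] Z| by rewrite cardsX cardsT.
apply: leq_trans (leq_add (leqnn _) (leq_card_setU _ _)).
apply: leq_trans (leq_card_setU _ _); apply: subset_leq_card; apply/subsetP => [[x y]].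
rewrite !inE /= andbT; case: (boolP (x \in Z)) => [_|/hZ E1]; first by rewrite orbT.
case: (boolP (y \in Z)) => [_|/hZ E2]; first by rewrite !orbT.
by rewrite /tmpl E1 E2 => ->.
Qed.

(** Flips the vertices with fewer than n/4 template neighbours. Each of them has at least n/5
    defects, so there are at most 5 mu n, and after the flip its other neighbours, more than n/4,
    agree with the template except at flipped vertices. *)
Lemma recolor col flag mu : 0 < n -> (0 <= mu <= 600^-1)%R -> balanced col mu ->
  (#|defects g col flag|%:R <= mu * n%:R ^+ 2)%R ->
  exists col', [/\ balanced col' (6 * mu), (#|defects g col' flag|%:R <= 11 * mu * n%:R ^+ 2)%R &
    forall x, (5^-1 * n%:R <= (degT col' flag x)%:R :> R)%R].
Proof.
move=> n0 /andP[mu0 mu1] bal hd.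
have n0R : (0 < n%:R :> R)%R by rewrite ltr0n.
pose Fl := [set x | 4 * degT col flag x < n].
pose col' x := if x \in Fl then ~~ col x else col x.
pose nd x := #|[set y | tmpl col flag x y && ~~ g x y]|.
have ndle x : x \in Fl -> (5^-1 * n%:R <= (nd x)%:R :> R)%R.
  rewrite inE => /ltnW /toR; rewrite natrM => h4.
  have hs : #|[set y | tmpl col flag x y]| <= degT col flag x + nd x.
    apply: leq_trans (leq_card_setU _ _); apply: subset_leq_card; apply/subsetP => y.
    by rewrite !inE => ->; case: (g x y).
  have := toR hs; rewrite natrD => hsR.
  exact: flip_deg_arith mu0 mu1 N0 (tmpl_deg flag x bal) hsR h4.
have Flle : (#|Fl|%:R <= 5 * mu * n%:R)%R.
  apply: flip_arith mu0 mu1 n0R _ hd.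
  have -> : #|defects g col flag| = \sum_x nd x.
    by rewrite /defects (card_rel (fun x y => tmpl col flag x y && ~~ g x y)).
  rewrite natr_sum; apply: (@le_trans _ _ (\sum_(x in Fl) 5^-1 * n%:R)%R).
    by rewrite sumr_const -[leRHS]mulr_natl.
  rewrite big_mkcond; apply: ler_sum => x _; case: ifP => // /ndle //.
have hcol x : x \notin Fl -> col' x = col x by rewrite /col' => /negPf ->.
exists col'; split.
- have [h1 h2] := bal.
  have k1 : #|classT col'| <= #|classT col| + #|Fl|.
    apply: leq_trans (leq_card_setU _ _); apply: subset_leq_card; apply/subsetP => x.
    rewrite 2!inE; case: (boolP (x \in Fl)) => [_|/hcol ->]; first by rewrite orbT.
    by rewrite inE => ->.
  have k2 : #|classT col| <= #|classT col'| + #|Fl|.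
    apply: leq_trans (leq_card_setU _ _); apply: subset_leq_card; apply/subsetP => x.
    rewrite 2!inE; case: (boolP (x \in Fl)) => [_|/hcol E]; first by rewrite orbT.
    by rewrite inE E => ->.
  have arith (a a' f N : R) : ((1 / 2 - mu) * N <= a -> a <= (1 / 2 + mu) * N -> a' <= a + f -> a <= a' + f ->
     f <= 5 * mu * N -> (1 / 2 - 6 * mu) * N <= a' /\ a' <= (1 / 2 + 6 * mu) * N)%R by split; lra.
  have := toR k1; have := toR k2; rewrite !natrD => k2R k1R.
  exact: arith h1 h2 k1R k2R Flle.
- have := toR (card_defects_change flag hcol); rewrite !natrD !natrM => h.
  have := defect_arith N0 h Flle hd.
  by have -> : (mu + 2 * (5 * mu) = 11 * mu)%R by ring.
move=> x; case: (boolP (x \in Fl)) => hx; last first.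
  have h : degT col flag x <= degT col' flag x + #|Fl|.
    apply: leq_trans (leq_card_setU _ _); apply: subset_leq_card; apply/subsetP => y.
    rewrite 2!inE; case: (boolP (y \in Fl)) => [_|/hcol E]; first by rewrite orbT.
    by rewrite inE /tmpl (hcol x hx) E => ->.
  have h' : n <= 4 * (degT col' flag x + #|Fl|).
    by move: hx; rewrite inE -leqNgt => /leq_trans; apply; rewrite leq_mul2l h.
  have := toR h'; rewrite natrM natrD => hR.
  exact: recolor_arith mu0 mu1 N0 Flle hR.
have h : #|[set y | g x y]| <= degT col flag x + (degT col' flag x + #|Fl|).
  apply: leq_trans (leq_add (leqnn _) (leq_card_setU _ _)).
  apply: leq_trans (leq_card_setU _ _); apply: subset_leq_card; apply/subsetP => y.
  rewrite inE => gxy; rewrite 2!in_setU; case: (boolP (y \in Fl)) => [_|/hcol E]; first by rewrite !orbT.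
  rewrite [y \in [set _ | _]]in_set [X in _ || (X || _)]in_set gxy !andbT orbF /tmpl /col' hx.
  move: E; rewrite /col' => ->.
  by case: (col x); case: (col y); case: (flag).
have h2 : n <= 2 * (degT col flag x + (degT col' flag x + #|Fl|)).
  by apply: leq_trans (gdeg x) _; rewrite leq_mul2l h.
have h4 : 4 * degT col flag x <= n by move: hx; rewrite inE => /ltnW.
have := toR h2; have := toR h4; rewrite !natrM !natrD => h4R h2R.
exact: recolor_arith2 mu0 mu1 N0 Flle h2R h4R.
Qed.

Definition degIn col x := #|[set y | col y && g x y]|.

(** Prepares the search for a matching inside the larger class: vertices with more than n/50
    neighbours there are moved to the smaller class until the gap is at most 1 or no such vertex is
    left. A moved vertex keeps at least n/50 - mu n >= n/100 template neighbours. *)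
Lemma rebalance col mu nu : (0 <= mu <= 100^-1)%R -> balanced col mu ->
  #|~: classT col| <= #|classT col| ->
  (#|defects g col true|%:R <= nu * n%:R ^+ 2)%R ->
  (forall x, (5^-1 * n%:R <= (degT col true x)%:R :> R)%R) ->
  exists col', [/\ balanced col' mu, #|~: classT col'| <= #|classT col'|,
    (#|defects g col' true|%:R <= (nu + 2 * mu) * n%:R ^+ 2)%R,
    forall x, (100^-1 * n%:R <= (degT col' true x)%:R :> R)%R &
    #|classT col'| - #|~: classT col'| <= 1 \/
    forall x, col' x -> ((degIn col' x)%:R <= 50^-1 * n%:R :> R)%R].
Proof.
move=> /andP[mu0 mu1] [bal1 bal2] hle hd hdeg.
pose A := classT col; pose k := #|A| - #|~: A|.
pose big := [set x | col x && (50^-1 * n%:R < (degIn col x)%:R :> R)%R].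
(* Each move reduces the gap by two, so half of it is the largest admissible number of moves. *)
have [Z Zbig Zk] := exists_subset_card (geq_minl #|big| k./2).
have ZA : Z \subset A by apply: subset_trans Zbig _; apply/subsetP => x; rewrite !inE => /andP[].
have Z2k : 2 * #|Z| <= k.
  by rewrite Zk; apply: (@leq_trans (2 * k./2)); rewrite ?leq_mul2l ?geq_minr //; lia.
pose col' x := col x && (x \notin Z).
have A'E : classT col' = A :\: Z by apply/setP => x; rewrite !inE andbC.
have cA' : #|classT col'| = #|A| - #|Z| by rewrite A'E cardsD (setIidPr ZA).
have cAC' : #|~: classT col'| = #|~: A| + #|Z|.
  rewrite A'E setDE setCI setCK cardsU (_ : _ :&: _ = set0) ?cards0 ?subn0 //.
  by apply/eqP; rewrite setI_eq0 disjoint_sym disjoints_subset setCK.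
have AAC : (#|A|%:R + #|~: A|%:R = n%:R :> R)%R by rewrite -natrD cardsC.
have Zle : (2 * #|Z|%:R <= #|A|%:R - #|~: A|%:R :> R)%R.
  by have := toR Z2k; rewrite natrM natrB.
have ZleA := toR (subset_leq_card ZA).
have arithZ (a b z N : R) : (a + b = N -> 2 * z <= a - b -> a <= (1 / 2 + mu) * N -> z <= mu * N)%R by lra.
have Zmu := arithZ _ _ _ _ AAC Zle bal2.
have hcol x : x \notin Z -> col' x = col x by rewrite /col' => ->; rewrite andbT.
exists col'; split.
- have E : (#|classT col'|%:R = #|A|%:R - #|Z|%:R :> R)%R by rewrite cA' natrB // subset_leq_card.
  have arith (a b z N : R) : (0 <= z -> 0 <= mu * N -> a + b = N -> 2 * z <= a - b -> a <= (1 / 2 + mu) * N ->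
    (1 / 2 - mu) * N <= a - z /\ a - z <= (1 / 2 + mu) * N)%R by split; lra.
  rewrite /balanced E; apply: arith AAC Zle bal2 => //; exact: mulr_ge0.
- by rewrite cA' cAC'; apply: (@shift_gap _ _ _ k).
- have := toR (card_defects_change true hcol); rewrite !natrD !natrM => h.
  exact: defect_arith N0 h Zmu hd.
- have muN : (mu * n%:R <= 100^-1 * n%:R)%R by rewrite ler_wpM2r.
  move=> x; case: (boolP (x \in Z)) => hx.
    have h : degIn col x <= degT col' true x + #|Z|.
      apply: leq_trans (leq_card_setU _ _); apply: subset_leq_card; apply/subsetP => y.
      rewrite 3!inE => /andP[cy ->]; case: (boolP (y \in Z)) => [_|yZ]; first by rewrite orbT.
      by rewrite /tmpl /col' hx yZ cy andbF.
    have hb : (50^-1 * n%:R < (degIn col x)%:R :> R)%R.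
      by have := subsetP Zbig x hx; rewrite inE => /andP[].
    have := toR h; rewrite natrD => hR.
    have arith (a d z N : R) : (50^-1 * N < a -> a <= d + z -> z <= mu * N -> mu * N <= 100^-1 * N -> 100^-1 * N <= d)%R by lra.
    exact: arith hb hR Zmu muN.
  have h : degT col true x <= degT col' true x + #|Z|.
    apply: leq_trans (leq_card_setU _ _); apply: subset_leq_card; apply/subsetP => y.
    rewrite 3!inE => /andP[t ->]; case: (boolP (y \in Z)) => [_|yZ]; first by rewrite orbT.
    by move: t; rewrite /tmpl (hcol x hx) (hcol y yZ) => ->.
  have := toR h; rewrite natrD => hR.
  have arith (a d z N : R) : (0 <= N -> 5^-1 * N <= a -> a <= d + z -> z <= mu * N -> mu * N <= 100^-1 * N -> 100^-1 * N <= d)%R by lra.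
  exact: arith (hdeg x) hR Zmu muN.
case: (leqP #|big| k./2) => hk; last first.
  left; rewrite cA' cAC' (@shift_gapE _ _ _ k) // Zk (minn_idPr (ltnW hk)).
  exact: odd_gap_le.
right=> x; have EZ : Z = big.
  by apply/eqP; rewrite eqEcard Zbig Zk (minn_idPl hk) leqnn.
rewrite /col' EZ => /andP[cx]; rewrite inE cx /= -leNgt; apply: le_trans.
rewrite ler_nat; apply: subset_leq_card; apply/subsetP => y; rewrite !inE.
by move=> /andP[/andP[-> _] ->].
Qed.

Lemma tmpl_neg col flag : tmpl (fun x => ~~ col x) flag =2 tmpl col flag.
Proof. by move=> x y; rewrite /tmpl; case: (col x); case: (col y); case: flag. Qed.

Lemma extremal_structure (mu : R) (S T : {set V}) : 0 < n -> (0 < mu <= 600^-1)%R ->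
  let eta := ((mu / 4) ^+ 2 / 3)%R in
  ((1 / 2 - eta) * n%:R <= #|S|%:R)%R -> ((1 / 2 - eta) * n%:R <= #|T|%:R)%R ->
  (#|adjPairs g S T|%:R <= eta * n%:R ^+ 2)%R ->
  exists col flag, [/\ balanced col (6 * mu), (#|defects g col flag|%:R <= 23 * mu * n%:R ^+ 2)%R,
    forall x, (100^-1 * n%:R <= (degT col flag x)%:R :> R)%R &
    flag -> #|~: classT col| <= #|classT col| /\
    (#|classT col| - #|~: classT col| <= 1 \/
     forall x, col x -> ((degIn col x)%:R <= 50^-1 * n%:R :> R)%R)].
Proof.
move=> n0 hmu eta hS hT he; have /andP[mu0 mu1] := hmu.
have [flag [hd b1 b2]] := extremal_coloring gsym gdeg n0 hmu hS hT he.
have bal : balanced (mem S) mu by rewrite /balanced (_ : classT _ = S) //; apply/setP => x; rewrite inE.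
have hmu' : (0 <= mu <= 600^-1)%R by rewrite ltW.
have [col [bal1 hd1 hdeg1]] := recolor n0 hmu' bal hd.
have N2 : (0 <= mu * n%:R ^+ 2)%R by rewrite mulr_ge0 ?exprn_ge0 // ltW.
case: flag hd hd1 hdeg1 => hd hd1 hdeg1; last first.
  exists col, false; split=> //.
    exact: le_trans hd1 (weaken_defects N2).
  move=> x; apply: le_trans (hdeg1 x); exact: weaken_deg.
have m6 : (0 <= 6 * mu <= 100^-1)%R by exact: six_mu.
suff [col' [bal' hle' hd' hdeg']] : exists col', [/\ balanced col' (6 * mu), #|~: classT col'| <= #|classT col'|,
   (#|defects g col' true|%:R <= 11 * mu * n%:R ^+ 2)%R &
   forall x, (5^-1 * n%:R <= (degT col' true x)%:R :> R)%R].
  have [col2 [c1 c2 c3 c4 c5]] := rebalance m6 bal' hle' hd' hdeg'.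
  exists col2, true; split=> //.
  by move: c3; have -> : (11 * mu + 2 * (6 * mu) = 23 * mu)%R by ring.
case: (leqP #|~: classT col| #|classT col|) => hle; first by exists col.
exists (fun x => ~~ col x).
have cE : classT (fun x => ~~ col x) = ~: classT col by apply/setP => x; rewrite !inE.
split.
- have E : (#|classT col|%:R + #|~: classT col|%:R = n%:R :> R)%R by rewrite -natrD cardsC.
  case: bal1 => h1 h2; rewrite /balanced cE.
  have arith (a b N m : R) : (a + b = N -> (1 / 2 - m) * N <= a -> a <= (1 / 2 + m) * N ->
     (1 / 2 - m) * N <= b /\ b <= (1 / 2 + m) * N)%R by split; lra.
  exact: arith E h1 h2.
- by rewrite cE setCK ltnW.
- apply: le_trans hd1; rewrite ler_nat; apply: subset_leq_card; apply/subsetP => xy.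
  by rewrite !inE tmpl_neg.
move=> x; apply: le_trans (hdeg1 x) _; rewrite ler_nat; apply: subset_leq_card; apply/subsetP => y.
by rewrite !inE tmpl_neg.
Qed.

End Recolor.

(** * Counting template cycles *)

Lemma leq_expn2r k m e : k <= m -> k ^ e <= m ^ e.
Proof. by case: e => // e; rewrite leq_exp2r. Qed.

Lemma expn_le_fact n a : n <= 4 * a -> n ^ a <= 16 ^ a * a`!.
Proof.
move=> h; case: a h => // a h.
apply: (@leq_trans ((4 * a.+1) ^ a.+1)); first by rewrite leq_exp2r.
by rewrite expnMn (expnMn 4 4) -mulnA leq_mul2l expnn_le_fact orbT.
Qed.

Lemma path_edges_subset (V : finType) (E : {set {set V}}) x p :
  (path_edges (x :: p) \subset E) = path (adjE E) x p.
Proof.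
elim: p x => [|y p IH] x; first by rewrite sub0set.
have -> : path_edges [:: x, y & p] = [set x; y] |: path_edges (y :: p) by [].
by rewrite subUset sub1set IH.
Qed.

Lemma cycle_edges_subset (V : finType) (E : {set {set V}}) s :
  (cycle_edges s \subset E) = cycle (adjE E) s.
Proof.
case: s => [|x s]; first by rewrite sub0set.
by rewrite (cycle_edgesE x) // subUset sub1set path_edges_subset /= rcons_path andbC.
Qed.

Section Counting.
Variable V : finType.
Local Notation n := #|V|.
Implicit Types (x y a b : V) (s p u v : seq V) (E F : {set {set V}}).

Lemma path_edges_catl u v : path_edges u \subset path_edges (u ++ v).
Proof.
case: u => [|x u]; first by rewrite sub0set.
case: v => [|y v]; first by rewrite cats0.
by rewrite (path_edges_cat x) // setUCA subsetUl.
Qed.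

Lemma path_edges_catr u v : path_edges v \subset path_edges (u ++ v).
Proof.
case: v => [|y v]; first by rewrite sub0set.
case: u => [|x u] //.
by rewrite (path_edges_cat x) // setUA subsetUr.
Qed.

Lemma mem_uniq_full s : size s = n -> (forall x, x \in s) -> uniq s.
Proof.
move=> hs hm; apply: (leq_size_uniq (enum_uniq V)); first by move=> x _.
by rewrite hs -cardE.
Qed.

Lemma size_le_hamset E F (X : seq (seq V)) : uniq X ->
  (forall s, s \in X -> [/\ size s = n, uniq s, F \subset cycle_edges s & cycle_edges s \subset E :|: F]) ->
  size X <= #|hamset F E|.
Proof.
move=> uX hX; rewrite cardE -(size_map val).
apply: uniq_leq_size => // s sX; have [hs us Fs sE] := hX s sX.
apply/mapP; exists (tcast hs (in_tuple s)); last by rewrite -[RHS]/(tval _) val_tcast.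
by rewrite mem_enum inE val_tcast us Fs sE.
Qed.

(** The factorial bound gives 4^n; the base 256 is shared by the three templates. *)
Lemma hamset_setT : n ^ n <= 256 ^ n * #|hamset set0 [set: {set V}]|.
Proof.
apply: (@leq_trans (4 ^ n * n`!)); first exact: expnn_le_fact.
apply: leq_mul; first exact: leq_expn2r.
rewrite -(_ : size (permutations (enum V)) = n`!); last first.
  by rewrite size_permutations ?enum_uniq // -cardE.
apply: size_le_hamset; first exact: permutations_uniq.
move=> s; rewrite mem_permutations => hs; split=> //.
- by rewrite (perm_size hs) -cardE.
- by rewrite (perm_uniq hs) enum_uniq.
- exact: sub0set.
- exact: subset_trans (subsetT _) (subsetUl _ _).
Qed.

Lemma path_class (e : rel V) (P : pred V) x p :
  (forall y z, P y -> P z -> e y z) -> all P (x :: p) -> path e x p.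
Proof.
move=> he; elim: p x => // y p IH x /= /and3P[Px Py Pp].
by rewrite he //= IH //= Py.
Qed.

(** The cycles run through one clique from x2 to x1, cross to y1, and run through the other clique
    to y2, which is joined back to x2. The inner vertices A and B can be ordered in |A|! |B|! ways,
    and both sets have at least n/4 elements. *)
Lemma hamset_same (col : V -> bool) x1 x2 y1 y2 : x1 != x2 -> y1 != y2 ->
  col x1 -> col x2 -> ~~ col y1 -> ~~ col y2 ->
  n <= 4 * #|classT col :\ x1 :\ x2| -> n <= 4 * #|~: classT col :\ y1 :\ y2| ->
  n ^ (n - 2) <= 256 ^ n * #|hamset [set [set x1; y1]; [set x2; y2]] (tmpl_edges col false)|.
Proof.
set A := classT col :\ x1 :\ x2; set B := ~: classT col :\ y1 :\ y2.
set F := [set _; _]; set ET := tmpl_edges col false.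
move=> x12 y12 cx1 cx2 cy1 cy2 hA hB.
have hn : #|A| + #|B| + 4 = n.
  have := cardsC (classT col).
  rewrite (cardsD1 x1) (cardsD1 x2 (classT col :\ x1)) (cardsD1 y1 (~: _)) (cardsD1 y2 (~: _ :\ _)).
  by rewrite !inE cx1 cx2 cy1 cy2 (eq_sym x2) x12 (eq_sym y2) y12 /= -/A -/B => <-; lia.
pose f (L M : seq V) := (x2 :: L ++ [:: x1]) ++ (y1 :: M ++ [:: y2]).
pose X := [seq f L M | L <- permutations (enum A), M <- permutations (enum B)].
have sX : size X = #|A|`! * #|B|`!.
  by rewrite size_allpairs !size_permutations ?enum_uniq // -!cardE.
have hX : size X <= #|hamset F ET|.
  apply: size_le_hamset.
    apply: allpairs_uniq; rewrite ?permutations_uniq // => - [L M] [L' M'].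
    move=> /allpairsP [[L1 M1] /= [h1 h2 [-> ->]]] /allpairsP [[L2 M2] /= [h3 h4 [-> ->]]].
    move: h1 h2 h3 h4; rewrite !mem_permutations => /perm_size s1 /perm_size s2 /perm_size s3 /perm_size s4.
    rewrite /f => /eqP; rewrite eqseq_cat /= ?size_cat ?s1 ?s3 // => /andP[].
    rewrite !eqseq_cons !eqxx /= !eqseq_cat ?s1 ?s2 ?s3 ?s4 // => /andP[/eqP -> _] /andP[/eqP -> _] //.
  move=> s /allpairsP [[L M] /= [hL hM ->]].
  rewrite !mem_permutations in hL hM.
  have sz : size (f L M) = n.
    by rewrite /f size_cat /= !size_cat /= (perm_size hL) (perm_size hM) -!cardE -hn; lia.
  have mL z : (z \in L) = (z \in A) by rewrite (perm_mem hL) mem_enum.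
  have mM z : (z \in M) = (z \in B) by rewrite (perm_mem hM) mem_enum.
  split=> //.
  - apply: mem_uniq_full sz _ => z; rewrite /f mem_cat !in_cons !mem_cat !inE mL mM !inE.
    case: (col z) => /=; rewrite ?andbF ?andbT.
      by case: (z == x2); case: (z == x1); rewrite ?orbT.
    by case: (z == y1); case: (z == y2); rewrite ?orbT.
  - have ee : path_edges (f L M) \subset cycle_edges (f L M) by rewrite (cycle_edgesE x1) ?subsetUr // sz -hn addn4.
    apply/subsetP => e; rewrite [in X in X -> _]in_set2 => /orP[] /eqP ->.
      apply: (subsetP ee); rewrite /f (path_edges_cat x1) //.
      by rewrite -[x2 :: _ ++ _]cat_cons last_cat setU11.
    by rewrite (cycle_edgesE x1) ?sz -?hn ?addn4 // /f !last_cat /= !last_cat /= setUC setU11.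
  have cl : cycle_edges (f L M) \subset [set y2; x2] |: path_edges (f L M).
    by rewrite (cycle_edgesE x1) ?sz -?hn ?addn4 // /f !last_cat /= !last_cat.
  apply: subset_trans cl _; rewrite subUset sub1set; apply/andP; split.
    by rewrite !inE [[set y2; x2]]setUC eqxx !orbT.
  have adjT y z : col y = col z -> adjE (ET :|: F) y z.
    by move=> h; rewrite /adjE inE tmpl_edgesE /tmpl h addbb.
  have pA : all col (x2 :: L ++ [:: x1]).
    rewrite /= cx2 all_cat /= cx1 !andbT; apply/allP => z; rewrite mL !inE => /and3P[_ _ //].
  have pB : all (predC col) (y1 :: M ++ [:: y2]).
    rewrite /= cy1 all_cat /= cy2 !andbT; apply/allP => z; rewrite mM !inE => /and3P[_ _ //].
  rewrite /f (path_edges_cat x1) // !subUset sub1set; apply/and3P; split.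
  - by rewrite -[x2 :: _ ++ _]cat_cons last_cat /= !inE eqxx !orbT.
  - rewrite path_edges_subset; apply: path_class pA => y z cy cz; apply: adjT; by rewrite cy cz.
  - rewrite path_edges_subset; apply: path_class pB => y z /negPf cy /negPf cz; apply: adjT; by rewrite cy cz.
apply: (@leq_trans (256 ^ n * (#|A|`! * #|B|`!))); last by rewrite leq_mul2l -sX hX orbT.
have -> : n - 2 = #|A| + #|B| + 2 by rewrite -hn -addnBA.
rewrite !expnD.
have n2 : n ^ 2 <= 16 ^ n.
  by apply: (@leq_trans ((4 ^ n) ^ 2)); [rewrite leq_exp2r // ltnW // ltn_expl|rewrite -expnM mulnC expnM].
have hab : 16 ^ #|A| * 16 ^ #|B| <= 16 ^ n by rewrite -expnD leq_exp2l // -hn leq_addr.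
apply: (@leq_trans ((16 ^ #|A| * #|A|`!) * (16 ^ #|B| * #|B|`!) * 16 ^ n)).
  by apply: leq_mul => //; apply: leq_mul; apply: expn_le_fact.
rewrite mulnACA (_ : 256 ^ n = 16 ^ n * 16 ^ n); last by rewrite -expnMn.
rewrite mulnAC leq_mul2r; apply/orP; right; exact: leq_mul.
Qed.

End Counting.

Section Interleave.
Variable V : finType.
Local Notation n := #|V|.
Implicit Types (x y a b : V) (s u v M : seq V) (L : seq (seq V)) (E F : {set {set V}}) (mt : seq (V * V)).

Definition pair_edges mt : {set {set V}} := [set e in [seq [set p.1; p.2] | p <- mt]].
Definition pair_verts mt := flatten [seq [:: p.1; p.2] | p <- mt].

Lemma pair_edges_cons p mt : pair_edges (p :: mt) = [set p.1; p.2] |: pair_edges mt.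
Proof. by apply/setP => e; rewrite !inE. Qed.

Lemma pair_edges_verts e x mt : e \in pair_edges mt -> x \in e -> x \in pair_verts mt.
Proof.
elim: mt => [|p mt IH]; first by rewrite inE.
rewrite pair_edges_cons in_setU1 /pair_verts /= !in_cons => /orP[/eqP ->|/IH h /h h'].
  by rewrite !inE => /orP[->|->]; rewrite ?orbT.
by rewrite -/(pair_verts mt) h' !orbT.
Qed.

Lemma card_pair_edges mt : uniq (pair_verts mt) -> #|pair_edges mt| = size mt.
Proof.
elim: mt => [|p mt IH]; first by rewrite (_ : pair_edges _ = set0) ?cards0 //; apply/setP => e; rewrite !inE.
rewrite /pair_verts /= => /and3P[np _ us].
rewrite pair_edges_cons cardsU1 IH //; case: (boolP (_ \in _)) => //= h.
have hv := pair_edges_verts h (set21 p.1 p.2).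
by case/negP: np; rewrite in_cons -/(pair_verts mt) hv orbT.
Qed.

(** Blocks from one class separated by single vertices of the other: a matching edge inside the
    larger class is treated as one block, so that the classes become balanced. *)
Fixpoint interleave L M : seq V :=
  match L, M with l :: L', b :: M' => l ++ b :: interleave L' M' | _, _ => [::] end.

Lemma size_interleave L M : size L = size M -> size (interleave L M) = size (flatten L) + size M.
Proof.
elim: L M => [|l L IH] [|b M] //= [h].
by rewrite !size_cat /= IH // !addnS addnA.
Qed.

Lemma mem_interleave L M z : size L = size M -> (z \in interleave L M) = (z \in flatten L) || (z \in M).
Proof.
elim: L M => [|l L IH] [|b M] //= [h].
rewrite !mem_cat !in_cons IH //; by case: (z \in l); case: (z == b); rewrite ?orbT.
Qed.

Lemma block_interleave L M l : size L = size M -> l \in L -> path_edges l \subset path_edges (interleave L M).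
Proof.
elim: L M => [|l' L IH] [|b M] //= [h]; rewrite in_cons => /orP[/eqP ->|hl].
  exact: path_edges_catl.
apply: subset_trans (IH M h hl) _; apply: subset_trans (path_edges_catr _ _).
by rewrite -cat1s; apply: path_edges_catr.
Qed.

Section Coloured.
Variables (P : pred V).

Lemma interleave_inj L M L' M' : size L = size M -> size L' = size M' ->
  all (all P) L -> all (all P) L' -> all (predC P) M -> all (predC P) M' ->
  interleave L M = interleave L' M' -> L = L' /\ M = M'.
Proof.
elim: L M L' M' => [|l L IH] [|b M] [|l' L'] [|b' M'] //=.
- by move=> _ _ _ _ _ _; case: l'.
- by move=> _ _ _ _ _ _; case: l.
move=> [h] [h'] /andP[Pl PL] /andP[Pl' PL'] /andP[Pb PM] /andP[Pb' PM'] E.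
have [El [Eb Er]] : l = l' /\ b = b' /\ interleave L M = interleave L' M'.
  elim: l l' Pl Pl' E => [|a l IHl] [|a' l'] /=.
  - by move=> _ _ [-> ->].
  - by move=> _ /andP[Pa _] [Eb _]; rewrite Eb Pa in Pb.
  - by move=> /andP[Pa _] _ [Ea _]; rewrite -Ea Pa in Pb'.
  by move=> /andP[_ Pl] /andP[_ Pl'] [-> /(IHl l' Pl Pl') [-> ?]].
by have [-> ->] := IH M L' M' h h' PL PL' PM PM' Er; rewrite El Eb.
Qed.

Lemma path_interleave (e : rel V) L M b0 : size L = size M -> ~~ P b0 ->
  all (all P) L -> all (predC P) M -> (forall l, l \in L -> l != [::]) ->
  (forall x l, x :: l \in L -> path e x l) -> (forall x y, P x != P y -> e x y) ->
  path e b0 (interleave L M) /\ ~~ P (last b0 (interleave L M)).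
Proof.
move=> + + + + + + he; elim: L M b0 => [|l L IH] [|b M] b0 //= [h] Pb0 /andP[Pl PL] /andP[Pb PM] hne hp.
have [] := IH M b h Pb PL PM.
- by move=> l' hl'; apply: hne; rewrite in_cons hl' orbT.
- by move=> x l' hl'; apply: hp; rewrite in_cons hl' orbT.
move=> p1 p2; rewrite cat_path last_cat /= p1 p2 andbT.
case: l Pl hne hp => [|a l] /= Pl hne hp; first by have := hne [::]; rewrite mem_head => /(_ isT).
move/andP: Pl => [Pa Pl]; have plast : P (last a l).
  by case/lastP: l Pl {hne hp} => // l z; rewrite all_rcons last_rcons => /andP[].
by rewrite he ?Pa ?(negPf Pb0) // hp ?mem_head // he // plast (negPf Pb).
Qed.

End Coloured.

(** After contracting the matching the larger class has as many blocks as the smaller class has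
    vertices, say m. Any order of the blocks and of the separators gives a cycle, so there are m!^2
    of them, and the required exponent n - #|F| is 2m. *)
Lemma hamset_differ (col : V -> bool) mt : uniq (pair_verts mt) -> all col (pair_verts mt) ->
  0 < #|~: classT col| -> #|~: classT col| + size mt = #|classT col| -> n <= 4 * #|~: classT col| ->
  n ^ (n - #|pair_edges mt|) <= 256 ^ n * #|hamset (pair_edges mt) (tmpl_edges col true)|.
Proof.
set A := classT col; set B := ~: A; set F := pair_edges mt; set ET := tmpl_edges col true.
move=> umt cmt m0 hk hn.
have nAB : #|A| + #|B| = n by apply: cardsC.
rewrite card_pair_edges //; set m := #|B| in m0 hk hn nAB *.
pose A3 := A :\: [set x in pair_verts mt].
have svt : size (pair_verts mt) = 2 * size mt.
  by rewrite /pair_verts; elim: (mt) => // p t IH /=; rewrite IH mulnS.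
have cA3 : #|A3| + 2 * size mt = #|A|.
  rewrite /A3 cardsD (setIidPr _); last by apply/subsetP => x; rewrite !inE => /(allP cmt).
  have -> : #|[set x in pair_verts mt]| = 2 * size mt.
    by rewrite -svt -(card_uniqP umt); apply: eq_card => x; rewrite inE.
  rewrite subnK // -svt -(card_uniqP umt); apply: subset_leq_card; apply/subsetP => x.
  by rewrite !inE => /(allP cmt).
pose blocks := [seq [:: p.1; p.2] | p <- mt] ++ [seq [:: a] | a <- enum A3].
have fl : flatten blocks = pair_verts mt ++ enum A3 by rewrite flatten_cat flatten_seq1.
have sb : size blocks = m by rewrite size_cat !size_map -cardE; lia.
have ub : uniq blocks.
  rewrite cat_uniq; apply/and3P; split.
  - rewrite map_inj_in_uniq; last by move=> [a b] [a' b'] _ _ [-> ->].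
    move: umt; rewrite /pair_verts; elim: (mt) => // p t IH /= /and3P[np _ /IH ->]; rewrite andbT.
    apply/negP => hp; case/negP: np; rewrite in_cons; apply/orP; right; apply/flattenP.
    by exists [:: p.1; p.2]; rewrite ?mem_head //; apply/mapP; exists p.
  - by apply/hasPn => l /mapP [a _ ->]; apply/negP => /mapP [p _].
  - by rewrite map_inj_uniq ?enum_uniq // => a b [].
pose X := [seq interleave L M | L <- permutations blocks, M <- permutations (enum B)].
have allb L : perm_eq L blocks -> all (all col) L.
  move=> hL; rewrite (perm_all _ hL); apply/allP => l hl; apply/allP => z hz.
  have : z \in flatten blocks by apply/flattenP; exists l.
  rewrite fl mem_cat => /orP[/(allP cmt) //|].
  by rewrite mem_enum !inE => /andP[].
have allM M : perm_eq M (enum B) -> all (predC col) M.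
  move=> hM; apply/allP => z; rewrite (perm_mem hM) mem_enum !inE //.
have szM M : perm_eq M (enum B) -> size M = m by move=> hM; rewrite (perm_size hM) -cardE.
have szL L : perm_eq L blocks -> size L = m by move=> hL; rewrite (perm_size hL) sb.
have sX : size X = m`! * m`!.
  by rewrite size_allpairs !size_permutations ?enum_uniq // -cardE sb.
have hX : size X <= #|hamset F ET|.
  apply: size_le_hamset.
    apply: allpairs_uniq; rewrite ?permutations_uniq // => - [L M] [L' M'].
    move=> /allpairsP [[L1 M1] /= [h1 h2 [-> ->]]] /allpairsP [[L2 M2] /= [h3 h4 [-> ->]]].
    move: h1 h2 h3 h4; rewrite !mem_permutations => h1 h2 h3 h4 /= E.
    by have [||-> -> //] := interleave_inj _ _ (allb _ h1) (allb _ h3) (allM _ h2) (allM _ h4) E; rewrite szL // szM.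
  move=> s /allpairsP [[L M] /= [hL hM ->]].
  rewrite !mem_permutations in hL hM.
  have hLM : size L = size M by rewrite szL // szM.
  have sz : size (interleave L M) = n.
    rewrite size_interleave // (perm_size (perm_flatten hL)) fl size_cat svt -cardE szM //.
    by rewrite -nAB -cA3 [2 * _ + _]addnC.
  have [b0 hb0] : exists b0, b0 \in B by apply/card_gt0P.
  have nb0 : ~~ col b0 by move: hb0; rewrite !inE.
  have s0 : 0 < size (interleave L M) by rewrite sz -nAB addn_gt0 m0 orbT.
  have ee : path_edges (interleave L M) \subset cycle_edges (interleave L M) by rewrite (cycle_edgesE b0) ?subsetUr.
  split=> //.
  - apply: mem_uniq_full sz _ => z; rewrite mem_interleave // (perm_mem (perm_flatten hL)) fl mem_cat.
    rewrite (perm_mem hM) !mem_enum !inE.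
    by case: (col z); case: (z \in pair_verts mt).
  - apply/subsetP => e; rewrite [in X in X -> _]inE => /mapP [p hp ->].
    apply: (subsetP ee).
    have hl : [:: p.1; p.2] \in L by rewrite (perm_mem hL) mem_cat; apply/orP; left; apply/mapP; exists p.
    apply: (subsetP (block_interleave hLM hl)); by rewrite /= in_setU1 eqxx.
  have heT x y : col x != col y -> adjE (ET :|: F) x y.
    by rewrite /adjE inE tmpl_edgesE /tmpl => h; apply/orP; left; move: h; case: (col x); case: (col y).
  have [] := @path_interleave col (adjE (ET :|: F)) L M b0 hLM nb0 (allb _ hL) (allM _ hM).
  - move=> l; rewrite (perm_mem hL) mem_cat => /orP[/mapP [p _ ->]|/mapP [a _ ->]] //.
  - move=> x l; rewrite (perm_mem hL) mem_cat => /orP[/mapP [p hp [-> ->]]|/mapP [a _ [_ ->]]] //.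
    rewrite /= andbT /adjE inE; apply/orP; right; rewrite inE; apply/mapP; by exists p.
  - exact: heT.
  move=> hp hlast; rewrite (cycle_edgesE b0) // subUset sub1set; apply/andP; split; last first.
    case E : (interleave L M) hp => [|z w]; first by rewrite sub0set.
    by move=> /= /andP[_]; rewrite path_edges_subset.
  apply: heT; rewrite (negPf hlast).
  have : all (all col) L by apply: allb.
  have : forall l, l \in L -> l != [::].
    move=> l; rewrite (perm_mem hL) mem_cat => /orP[/mapP [p _ ->]|/mapP [a _ ->]] //.
  case: (L) (M) hLM s0 => [|l L'] [|b M'] //= _ _ hne /andP[].
  by case: l hne => [hne|a l _ /= /andP[->]] //; have := hne [::]; rewrite mem_head => /(_ isT).
apply: (@leq_trans (256 ^ n * (m`! * m`!))); last by rewrite leq_mul2l -sX hX orbT.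
have -> : n - size mt = m + m by rewrite -nAB -hk addnAC addnK.
rewrite expnD (_ : 256 ^ n = 16 ^ n * 16 ^ n); last by rewrite -expnMn.
have h16 : 16 ^ m <= 16 ^ n by rewrite leq_exp2l // -nAB leq_addl.
have h1 : n ^ m <= 16 ^ n * m`!.
  by apply: leq_trans (expn_le_fact hn) _; rewrite leq_mul2r h16 orbT.
by rewrite mulnACA; apply: leq_mul.
Qed.

End Interleave.

(** * Correcting edges in a first random exposure *)

Lemma Ebern_union_avoid (R : realFieldType) (X J : finType) (p : R) (B : pred J) (D : J -> {set X})
    (fail : {set X} -> bool) (c d : nat) :
  (0 <= p <= 1)%R -> (forall W, fail W -> exists2 j, B j & W :&: D j == set0) ->
  #|B| <= c -> (forall j, B j -> d <= #|D j|) ->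
  (Ebern p (fun W => (fail W)%:R) <= c%:R * (1 - p) ^+ d)%R.
Proof.
move=> hp hf hc hd; have /andP[p0 p1] := hp.
have q0 : (0 <= 1 - p)%R by rewrite subr_ge0.
have q1 : (1 - p <= 1)%R by rewrite gerBl.
apply: (@le_trans _ _ (Ebern p (fun W => \sum_(j | B j) (W :&: D j == set0)%:R))%R).
  apply: Ebern_le => // W; case: (boolP (fail W)) => [/hf [j Bj /eqP E]|_]; last first.
    by apply: sumr_ge0.
  by rewrite (bigD1 j) //= E eqxx lerDl sumr_ge0.
rewrite Ebern_sum.
apply: (@le_trans _ _ (\sum_(j | B j) (1 - p) ^+ d)%R).
  apply: ler_sum => j Bj; rewrite /Ebern.
  apply: (@le_trans _ _ ((1 - p) ^+ #|D j|)%R); last by apply: ler_wiXn2l => //; apply: hd.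
  rewrite -sum_bmass_avoid [leRHS]big_mkcond; apply: ler_sum => W _.
  by case: (W :&: D j == set0); rewrite ?mulr1 ?mulr0.
by rewrite sumr_const -[leLHS]mulr_natl ler_wpM2r ?exprn_ge0 // ler_nat.
Qed.

(** Such a set is the image of a function on j points, with [None] as padding. *)
Lemma card_small_sets (V : finType) j : #|[pred Z : {set V} | #|Z| <= j]| <= #|V|.+1 ^ j.
Proof.
have -> : #|V|.+1 ^ j = #|{ffun 'I_j -> option V}| by rewrite card_ffun card_option card_ord.
pose F (f : {ffun 'I_j -> option V}) := [set x | Some x \in codom f].
rewrite -cardsT; apply: leq_trans (leq_imset_card F _).
apply: subset_leq_card; apply/subsetP => Z; rewrite inE => hZ; apply/imsetP.
exists [ffun i : 'I_j => nth None [seq Some x | x <- enum Z] i]; rewrite ?inE // /F.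
apply/setP => x; rewrite inE; apply/idP/codomP => [xZ|[i]].
  have hi : index x (enum Z) < j by apply: leq_trans hZ; rewrite cardE index_mem mem_enum.
  exists (Ordinal hi); rewrite ffunE /= (nth_map x) ?nth_index ?mem_enum //.
  by rewrite index_mem mem_enum.
rewrite ffunE; case: (ltnP i (size (enum Z))) => hi.
  by rewrite (nth_map x) // => -[->]; rewrite -mem_enum mem_nth.
by rewrite nth_default // size_map.
Qed.

Lemma matching_arith (R : realFieldType) (N k A Z D op t : R) :
  (0 <= N -> 1 <= k -> k * A <= 2 * op -> op <= 2 * D + 2 * t -> N <= 2 * A -> Z <= 2 * (k - 1) ->
   t <= Z * (50^-1 * N) -> k * N <= 16 * D)%R.
Proof.
move=> N0 k1 h1 h2 h3 h4 h5.
have e1 : (k * N <= 2 * (k * A))%R by have := ler_wpM2l (le_trans ler01 k1) h3; rewrite mulrCA.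
have e2 : (Z * (50^-1 * N) <= 2 * (k - 1) * (50^-1 * N))%R by rewrite ler_wpM2r // mulr_ge0 // invr_ge0.
have e3 : (2 * (k - 1) * (50^-1 * N) = 25^-1 * (k * N) - 25^-1 * N)%R by field.
have e4 : (0 <= k * N)%R by rewrite mulr_ge0 // (le_trans ler01).
lra.
Qed.

Section Matchings.
Variables (R : realFieldType) (V : finType) (EG : {set {set V}}).
Local Notation n := #|V|.
Local Notation g := (adjE EG).
Hypotheses (card2 : forall e, e \in EG -> #|e| = 2) (gdeg : forall x, n <= 2 * #|[set y | g x y]|).
Implicit Types (W : {set {set V}}) (Z : {set V}) (col : V -> bool) (mt : seq (V * V)).

Lemma adjE_irr : irreflexive g.
Proof. by move=> x; apply/negP => /card2; rewrite setUid cards1. Qed.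

Lemma edgeP e : e \in EG -> exists x, exists y, e = [set x; y] /\ x != y.
Proof. by move=> /card2 /eqP /cards2P [x [y [h ->]]]; exists x, y. Qed.

(* A maximal matching of fewer than [k] edges of [W] in the colour class leaves
   no edge of [W] there avoiding its vertex set [Z]. *)
Definition insideAvoid col Z := [set e in EG | (e \subset classT col) && [disjoint e & Z]].

Lemma greedy_matching col W k :
  (exists mt, [/\ size mt = k, uniq (pair_verts mt), all col (pair_verts mt) & pair_edges mt \subset W :&: EG]) \/
  (exists2 Z : {set V}, #|Z| <= 2 * k.-1 & W :&: insideAvoid col Z == set0).
Proof.
suff : forall j, j <= k ->
  (exists mt, [/\ size mt = j, uniq (pair_verts mt), all col (pair_verts mt) & pair_edges mt \subset W :&: EG]) \/
  (exists2 Z : {set V}, #|Z| <= 2 * k.-1 & W :&: insideAvoid col Z == set0) by apply.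
elim=> [|j IH] hj.
  by left; exists [::]; split=> //; apply/subsetP => e; rewrite inE.
have [[mt [smt umt cmt Wmt]]|] := IH (ltnW hj); last by right.
pose Z := [set x in pair_verts mt].
have hZ : #|Z| <= 2 * k.-1.
  have -> : #|Z| = size (pair_verts mt).
    by rewrite -(card_uniqP umt); apply: eq_card => x; rewrite inE.
  have -> : size (pair_verts mt) = 2 * size mt.
    by rewrite /pair_verts; elim: (mt) => // p t IHt /=; rewrite IHt mulnS.
  rewrite smt leq_mul2l /= -ltnS prednK //; exact: leq_ltn_trans hj.
have [h|h] := boolP (W :&: insideAvoid col Z == set0); first by right; exists Z.
left; have /set0Pn [e] := h; rewrite !inE => /and3P[eW eE /andP[ec dis]].
have [x [y [Ee xy]]] := edgeP eE.
have nin z : z \in e -> z \notin pair_verts mt.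
  by move=> ze; have := disjointFr dis ze; rewrite inE => ->.
exists ((x, y) :: mt); split=> /=; first by rewrite smt.
- rewrite /pair_verts /= !in_cons negb_or xy -/(pair_verts mt) umt andbT /=.
  by rewrite !nin // Ee ?set21 ?set22.
- rewrite /pair_verts /= -/(pair_verts mt) cmt andbT.
  have hx := subsetP ec x; have hy := subsetP ec y; rewrite !Ee !inE in hx hy.
  by rewrite hx ?eqxx // hy // eqxx orbT.
by rewrite pair_edges_cons subUset Wmt andbT /= -Ee sub1set inE eW.
Qed.

(** Inner degrees at least k/2 give at least kn/4 ordered adjacent pairs inside the class. Removing
    Z destroys at most 2 |Z| n/50 <= 2kn/25 of them, or none if k = 1, since then Z is empty. More
    than kn/8 ordered pairs, hence kn/16 edges, survive. *)
Lemma card_insideAvoid col k Z : 0 < k -> n <= 2 * #|classT col| ->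
  (forall x, col x -> k <= 2 * degIn g col x) ->
  (k <= 1 \/ forall x, col x -> ((degIn g col x)%:R <= 50^-1 * n%:R :> R)%R) ->
  #|Z| <= 2 * k.-1 -> k * (n %/ 16) <= #|insideAvoid col Z|.
Proof.
move=> k0 hA hdeg hmax hZ; set D := insideAvoid col Z; set A := classT col in hA *.
pose OP := [set xy : V * V | [&& col xy.1, col xy.2 & g xy.1 xy.2]].
pose Z1 := [set xy : V * V | [&& xy.1 \in Z, col xy.1, col xy.2 & g xy.1 xy.2]].
pose Z2 := [set xy : V * V | [&& xy.2 \in Z, col xy.1, col xy.2 & g xy.1 xy.2]].
have cOP : #|OP| = \sum_(x in A) degIn g col x.
  rewrite /OP (card_rel (fun x y => [&& col x, col y & g x y])) [RHS]big_mkcond.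
  apply: eq_bigr => x _; rewrite inE; case: (col x) => //.
  by apply: eq_card0 => y; rewrite !inE.
have cZ1 : #|Z1| = \sum_(x in Z :&: A) degIn g col x.
  rewrite /Z1 (card_rel (fun x y => [&& x \in Z, col x, col y & g x y])) [RHS]big_mkcond.
  apply: eq_bigr => x _; rewrite !inE; case: (x \in Z); case: (col x) => //=;
  by apply: eq_card0 => y; rewrite !inE.
have cZ2 : #|Z2| <= #|Z1|.
  apply: (card_le_in (f := fun xy => (xy.2, xy.1))).
    by move=> [a b] [a' b'] _ _ [-> ->].
  by move=> [a b]; rewrite !inE /= adjEC => /and4P[-> -> -> ->].
have h1 : k * #|A| <= 2 * #|OP|.
  rewrite cOP big_distrr /= mulnC -sum_nat_const; apply: leq_sum => x; rewrite inE; exact: hdeg.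
pose OP' := OP :\: (Z1 :|: Z2).
have h2 : #|OP| <= #|OP'| + 2 * #|Z1|.
  rewrite mul2n -addnn; apply: (@leq_trans (#|OP'| + (#|Z1| + #|Z2|))); last by rewrite leq_add2l leq_add2l.
  apply: leq_trans (leq_add (leqnn _) (leq_card_setU _ _)); apply: leq_trans (leq_card_setU _ _).
  by apply: subset_leq_card; apply/subsetP => xy h; rewrite in_setU in_setD h andbT orNb.
have h3 : #|OP'| <= 2 * #|D|.
  pose inc := [set ea : {set V} * V | (ea.1 \in D) && (ea.2 \in ea.1)].
  have -> : 2 * #|D| = #|inc|.
    rewrite /inc (card_rel (fun e a => (e \in D) && (a \in e))) mulnC -sum_nat_const big_mkcond.
    apply: eq_bigr => e _; case: ifP => eD; last by apply/esym/eq_card0 => a; rewrite !inE.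
    rewrite -(card2 (e := e)); last by move: eD; rewrite inE => /andP[].
    by apply: eq_card => a; rewrite !inE.
  apply: (card_le_in (f := fun xy => ([set xy.1; xy.2], xy.1))).
    move=> [a b] [a' b'] _ _ /= /eqP; rewrite xpair_eqE => /andP[/eqP E /eqP Ea]; subst a'.
    by case: (set2_eq E) => [[_ ->]|[-> ->]].
  move=> [a b] /setDP [hab nZ]; move: hab; rewrite inE /= => /and3P[ca cb gab].
  move: nZ; rewrite !inE /= ca cb gab !andbT negb_or => /andP[na nb].
  rewrite eqxx andbT -[_ \in EG]/(g a b) gab /=; apply/andP; split.
    by apply/subsetP => z; rewrite !inE => /orP[] /eqP ->.
  rewrite disjoints_subset; apply/subsetP => z; rewrite !inE => /orP[] /eqP ->; by [].
have n0 : (0 <= n%:R :> R)%R by [].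
suff h : (k%:R * n%:R <= 16 * #|D|%:R :> R)%R.
  have : k * n <= 16 * #|D| by rewrite -(ler_nat R) !natrM.
  move=> h'; rewrite -(leq_pmul2l (isT : 0 < 16)); apply: leq_trans h'.
  by rewrite mulnCA leq_mul2l mulnC leq_trunc_div orbT.
have k1 : (1 <= k%:R :> R)%R by rewrite ler1n.
have toR a b : a <= b -> (a%:R <= b%:R :> R)%R by rewrite ler_nat.
have := toR _ _ h1; rewrite !natrM => h1R.
have := toR _ _ (leq_trans h2 (leq_add h3 (leqnn _))); rewrite natrD !natrM => h2R.
have := toR _ _ hA; rewrite natrM => hAR.
have : (#|Z|%:R <= 2 * (k%:R - 1) :> R)%R by rewrite -(natrB _ k0) subn1 -natrM ler_nat.
move=> hZR.
have tR : (#|Z1|%:R <= #|Z|%:R * (50^-1 * n%:R) :> R)%R.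
  case: hmax => hmax.
    have Z0 : Z = set0.
      apply/eqP; rewrite -cards_eq0 -leqn0 (leq_trans hZ) //.
      by move: k0 hmax; case: (k) => [|[|]].
    rewrite cZ1 Z0 set0I big_set0 cards0 mul0r; exact: lexx.
  rewrite cZ1 natr_sum; apply: (@le_trans _ _ (\sum_(x in Z :&: A) 50^-1 * n%:R)%R).
    by apply: ler_sum => x; rewrite !inE => /andP[_]; apply: hmax.
  rewrite sumr_const -[leLHS]mulr_natl ler_wpM2r ?mulr_ge0 ?invr_ge0 //.
  by rewrite ler_nat; apply: subset_leq_card; apply: subsetIl.
exact: matching_arith n0 k1 h1R h2R hAR hZR tR.
Qed.

(** Union bound over fewer than (n+1)^(2k) sets Z. Each is missed with probability at most (1-p)^(k
    (n %/ 16)), so every unit of k gains (n+1)^2 (n+1)^-3, and one unit suffices. *)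
Lemma prob_no_matching col k (p : R) : (0 <= p <= 1)%R -> 0 < k -> n <= 2 * #|classT col| ->
  (forall x, col x -> k <= 2 * degIn g col x) ->
  (k <= 1 \/ forall x, col x -> ((degIn g col x)%:R <= 50^-1 * n%:R :> R)%R) ->
  (n.+1%:R ^+ 3 * (1 - p) ^+ (n %/ 16) <= 1)%R ->
  (Ebern p (fun W => [exists Z : {set V}, (#|Z| <= 2 * k.-1)%N && (W :&: insideAvoid col Z == set0)]%:R)
     <= n.+1%:R^-1)%R.
Proof.
move=> hp k0 hA hdeg hmax hsmall.
have q0 : (0 <= 1 - p)%R by have /andP[] := hp; rewrite subr_ge0.
apply: (@le_trans _ _ ((n.+1 ^ (2 * k.-1))%:R * (1 - p) ^+ (k * (n %/ 16)))%R).
  apply: (Ebern_union_avoid hp (B := [pred Z : {set V} | #|Z| <= 2 * k.-1]) (D := insideAvoid col)).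
  - by move=> W /existsP [Z /andP[h1 h2]]; exists Z.
  - exact: card_small_sets.
  - by move=> Z; apply: card_insideAvoid.
set N : R := n.+1%:R%R in hsmall *; set q := ((1 - p) ^+ (n %/ 16))%R in hsmall.
have N1 : (1 <= N)%R by rewrite ler1n.
have N0 : (0 < N)%R by apply: lt_le_trans N1.
have qq0 : (0 <= q)%R by rewrite exprn_ge0.
rewrite natrX -/N (mulnC k) [X in (_ * X)%R]exprM -/q.
have hq : (N ^+ 2 * q <= N^-1)%R.
  by rewrite -[leRHS]mul1r ler_pdivlMr // mulrC mulrA -exprS.
apply: (@le_trans _ _ ((N ^+ 2 * q) ^+ k)%R).
  have -> : ((N ^+ 2 * q) ^+ k = N ^+ (2 * k) * q ^+ k)%R by rewrite [LHS]exprMn -exprM.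
  by rewrite ler_wpM2r ?exprn_ge0 // ler_weXn2l // leq_mul2l leq_pred orbT.
apply: (@le_trans _ _ (N^-1 ^+ k)%R).
  by apply: lerXn2r => //; rewrite nnegrE ?mulr_ge0 ?exprn_ge0 ?invr_ge0 // ltW.
rewrite -[leRHS]expr1; apply: ler_wiXn2l => //; rewrite ?invr_ge0 ?invf_le1 // ltW //.
Qed.

Definition crossAvoid col z := [set e in EG | (e \in tmpl_edges col true) && (z \notin e)].

(** A bipartite graph without two disjoint edges is a star or empty, so some single vertex meets all
    its edges. *)
Lemma two_crossing col W (z0 : V) :
  (exists x1 x2 y1 y2, [/\ x1 != x2, y1 != y2, [&& col x1, col x2, ~~ col y1 & ~~ col y2],
     [set x1; y1] \in W :&: EG & [set x2; y2] \in W :&: EG]) \/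
  (exists2 z, true & W :&: crossAvoid col z == set0).
Proof.
have [/existsP [z h]|/existsPn hno] := boolP [exists z, W :&: crossAvoid col z == set0].
  by right; exists z.
left; have wit z : exists x y, [/\ col x, ~~ col y, [set x; y] \in W :&: EG, x != z & y != z].
  have /set0Pn [e] := hno z; rewrite !inE => /and3P[eW eE /andP[/existsP [x /existsP [y /andP[/eqP Ee t]]] ze]].
  have [xz yz] : x != z /\ y != z.
    by split; apply: contra ze => /eqP <-; rewrite Ee ?set21 ?set22.
  move: t; rewrite /tmpl; case: (boolP (col x)) => cx; case: (boolP (col y)) => cy // _.
    by exists x, y; rewrite inE -Ee eW eE; split.
  by exists y, x; rewrite inE setUC -Ee eW eE; split.
have [x1 [y1 [cx1 cy1 E1 _ _]]] := wit z0.
have [x2 [y2 [cx2 cy2 E2 h2 _]]] := wit x1.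
have [y21|ny] := eqVneq y2 y1; last first.
  by exists x2, x1, y2, y1; split=> //; apply/and4P.
have [x3 [y3 [cx3 cy3 E3 _ h3]]] := wit y1.
have [x31|nx] := eqVneq x3 x1; last first.
  by exists x3, x1, y3, y1; split=> //; apply/and4P.
subst y2 x3; exists x2, x1, y1, y3; split=> //; last by apply/and4P.
by rewrite eq_sym.
Qed.

(** Every [x] in [X] contributes an edge of its own, since [x] is the only vertex of colour [c] in
    that edge. *)
Lemma card_crossAvoid_X col c z (X : {set V}) :
  (forall x, x \in X -> col x = c /\ exists y, [/\ col y != c, g x y, x != z & y != z]) ->
  #|X| <= #|crossAvoid col z|.
Proof.
move=> hX; rewrite -(card_imset (mem X) (@Some_inj _)).
apply: leq_trans (leq_imset_card (fun e : {set V} => [pick x in e | col x == c]) _).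
apply: subset_leq_card; apply/subsetP => _ /imsetP [x xX ->].
have [cx [y [cy gxy xz yz]]] := hX x xX.
apply/imsetP; exists [set x; y].
  rewrite inE -[_ \in EG]/(g x y) gxy tmpl_edgesE /tmpl !inE negb_or ![z == _]eq_sym xz yz !andbT /=.
  by move: cy; rewrite cx; case: (c); case: (col y).
case: pickP => [w /andP[]|/(_ x)]; last by rewrite set21 cx eqxx.
by rewrite !inE => /orP[/eqP -> //|/eqP -> cyc]; rewrite cyc in cy.
Qed.

Lemma cross_nbr col x : col x ->
  n.+2 <= 2 * #|[set y | ~~ col y && g x y]| + 2 * #|classT col|.
Proof.
move=> cx.
have h : #|[set y | g x y]| <= #|[set y | ~~ col y && g x y]| + #|classT col :\ x|.
  apply: leq_trans (leq_card_setU _ _); apply: subset_leq_card; apply/subsetP => y.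
  rewrite !inE => gxy; rewrite gxy andbT; case: (col y) => //=; rewrite andbT.
  by apply/eqP => E; move: gxy; rewrite E adjE_irr.
have := gdeg x; rewrite (cardsD1 x (classT col)) inE cx; lia.
Qed.

(** Every vertex of the smaller class has a neighbour across. This suffices if z lies in the smaller
    class. Otherwise the neighbour must differ from z: if the class has fewer than n/2 vertices
    there are two neighbours to choose from, and if the classes are equal one counts from the class
    of z instead. *)
Lemma card_crossAvoid_half col z m : #|classT col| <= #|~: classT col| -> m < #|classT col| ->
  m <= #|crossAvoid col z|.
Proof.
move=> hAB hm.
have nAB := cardsC (classT col).
have wit x k : col x -> k + 2 * #|classT col| <= n -> k.+2./2 <= #|[set y | ~~ col y && g x y]|.
  by move=> cx hk; have := cross_nbr cx; move: #|[set y | _]| #|classT col| hk => a b hk; lia.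
have [cz|ncz] := boolP (col z).
  apply: (@leq_trans #|classT col :\ z|).
    by move: hm; rewrite (cardsD1 z (classT col)) inE cz add1n ltnS.
  apply: (@card_crossAvoid_X _ true) => x; rewrite !inE => /andP[xz cx]; split=> //.
  have h0 : 0 + 2 * #|classT col| <= n by rewrite add0n -nAB mul2n -addnn leq_add2l.
  have /card_gt0P [y] := wit x 0 cx h0; rewrite inE => /andP[ncy gxy].
  exists y; split=> //; first by case: (col y) ncy.
  by apply: contra ncy => /eqP ->.
have [hlt|hge] := ltnP (2 * #|classT col|) n.
  apply: leq_trans (ltnW hm) _; apply: (@card_crossAvoid_X _ true) => x; rewrite inE => cx; split=> //.
  have : 1 < #|[set y | ~~ col y && g x y]|.
    by have := cross_nbr cx; move: #|[set y | _]| #|classT col| hlt => a b hk; lia.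
  rewrite (cardsD1 z) => h.
  have /card_gt0P [y] : 0 < #|[set y | ~~ col y && g x y] :\ z|.
    by move: h; case: (z \in _); rewrite ?add1n ?add0n ?ltnS // => /ltnW.
  rewrite !inE => /andP[yz /andP[ncy gxy]].
  exists y; split=> //; first by case: (col y) ncy.
  by apply: contra ncz => /eqP <-.
have eAB : #|~: classT col| = #|classT col|.
  by apply/eqP; rewrite eqn_leq hAB andbT; move: hge; rewrite -nAB mul2n -addnn leq_add2l.
apply: (@leq_trans #|(~: classT col) :\ z|).
  by move: hm; rewrite -eAB (cardsD1 z (~: classT col)) !inE ncz add1n ltnS.
apply: (@card_crossAvoid_X _ false) => x; rewrite !inE => /andP[xz ncx]; split.
  by apply/negbTE.
have cC : classT (fun x => ~~ col x) = ~: classT col by apply/setP => w; rewrite !inE.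
have := @cross_nbr (fun x => ~~ col x) x ncx; rewrite cC eAB => h.
have /card_gt0P [y] : 0 < #|[set y | ~~ ~~ col y && g x y]|.
  by move: h; rewrite -nAB eAB; move: #|[set y | _]| #|classT col| => a b; lia.
rewrite inE negbK => /andP[cy gxy]; exists y; split=> //; first by rewrite cy.
by apply: contra ncz => /eqP <-.
Qed.

Lemma card_crossAvoid col z m : m < #|classT col| -> m < #|~: classT col| -> m <= #|crossAvoid col z|.
Proof.
move=> h1 h2; have [h|h] := leqP #|classT col| #|~: classT col|.
  exact: card_crossAvoid_half.
have cC : classT (fun x => ~~ col x) = ~: classT col by apply/setP => w; rewrite !inE.
have -> : crossAvoid col z = crossAvoid (fun x => ~~ col x) z.
  apply/setP => e; rewrite !inE; congr (_ && (_ && _)).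
  apply: eq_existsb => x; apply: eq_existsb => y; by rewrite tmpl_neg.
by apply: card_crossAvoid_half; rewrite cC // setCK ltnW.
Qed.

Lemma prob_no_two_crossing col (p : R) : (0 <= p <= 1)%R ->
  n %/ 16 < #|classT col| -> n %/ 16 < #|~: classT col| ->
  (n.+1%:R ^+ 3 * (1 - p) ^+ (n %/ 16) <= 1)%R ->
  (Ebern p (fun W => [exists z, W :&: crossAvoid col z == set0]%:R) <= n.+1%:R^-1)%R.
Proof.
move=> hp h1 h2 hsmall.
have q0 : (0 <= 1 - p)%R by have /andP[] := hp; rewrite subr_ge0.
apply: (@le_trans _ _ (n.+1%:R * (1 - p) ^+ (n %/ 16))%R).
  apply: (Ebern_union_avoid hp (B := predT) (D := crossAvoid col)).
  - by move=> W /existsP [z h]; exists z.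
  - by rewrite ltnW // ltnS; apply: eq_leq; apply: eq_card.
  - by move=> z _; apply: card_crossAvoid.
set N : R := n.+1%:R%R in hsmall *; set q := ((1 - p) ^+ (n %/ 16))%R in hsmall *.
have N1 : (1 <= N)%R by rewrite ler1n.
have N0 : (0 < N)%R by apply: lt_le_trans N1.
have qq0 : (0 <= q)%R by rewrite exprn_ge0.
rewrite -[leRHS]mul1r ler_pdivlMr //; apply: le_trans hsmall.
rewrite mulrAC ler_wpM2r // -[(N * N)%R]/((N ^+ 2)%R); exact: ler_weXn2l.
Qed.

End Matchings.

(** * Assembly *)

Definition has_ham_cycle (V : finType) (E : {set {set V}}) :=
  [exists s : #|V|.-tuple V, uniq s && (cycle_edges s \subset E)].

Section Constants.
Variable R : realFieldType.
Local Open Scope ring_scope.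

(** The constant of [hamset_spread] for the counting base 256. *)
Definition spread_const (c : R) (r : nat) : R := 6 / c * (8 * 256 * (4 * (1 + 6 / c))) ^+ r.

Lemma spread_const_gt0 c r : 0 < c -> 0 < spread_const c r.
Proof.
move=> c0; have h : 0 < 6 / c by rewrite divr_gt0.
by rewrite /spread_const mulr_gt0 // exprn_gt0 // !mulr_gt0 // addr_gt0.
Qed.

(* [eta_non] is the density threshold of [extremal_structure] at [mu_ext]; below
   it the graph is close to a template, with defects at most [eps_ext ^+ 2 * n ^+ 2]. *)
Definition eps_ext : R := 800^-1.
Definition mu_ext : R := eps_ext ^+ 2 / 32.
Definition eta_non : R := (mu_ext / 4) ^+ 2 / 3.
(** [c_ext] comes from [extremal_switchable] with theta = 1/100, whose condition 8 eps <= theta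
    dictates [eps_ext]; [c_non] and [eps_non] come from [nonextremal_switchable]. *)
Definition c_ext : R := (100^-1 / 2) ^+ 2 / 8.
Definition c_non : R := eta_non ^+ 2 / 800.
Definition eps_non : R := eta_non ^+ 2 / 3200.

Lemma eps_ext_gt0 : 0 < eps_ext. Proof. by rewrite invr_gt0. Qed.
Lemma mu_ext_gt0 : 0 < mu_ext. Proof. by rewrite divr_gt0 // exprn_gt0 // eps_ext_gt0. Qed.
Lemma eta_non_gt0 : 0 < eta_non.
Proof. by rewrite divr_gt0 // exprn_gt0 // divr_gt0 // mu_ext_gt0. Qed.
Lemma c_non_gt0 : 0 < c_non. Proof. by rewrite divr_gt0 // exprn_gt0 // eta_non_gt0. Qed.
Lemma eps_non_gt0 : 0 < eps_non. Proof. by rewrite divr_gt0 // exprn_gt0 // eta_non_gt0. Qed.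
Lemma c_ext_gt0 : 0 < c_ext. Proof. by rewrite divr_gt0 // exprn_gt0 // divr_gt0 // invr_gt0. Qed.

Lemma mu_ext_le : mu_ext <= eps_ext / 32.
Proof.
rewrite ler_pM2r ?invr_gt0 // expr2 -[leRHS]mul1r ler_pM2r ?eps_ext_gt0 //.
by rewrite invf_le1 // ler1n.
Qed.

Lemma mu_ext_le600 : mu_ext <= 600^-1.
Proof. by apply: le_trans mu_ext_le _; rewrite /eps_ext; lra. Qed.

Lemma eta_non_le1 : eta_non <= 1.
Proof.
have h : (mu_ext / 4) ^+ 2 <= 1.
  apply: exprn_ile1; first by rewrite divr_ge0 // ltW // mu_ext_gt0.
  by have := mu_ext_le600; lra.
by rewrite /eta_non; move: h; set x := (_ / 4) ^+ 2; lra.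
Qed.

Lemma c_non_le1 : c_non <= 1.
Proof.
have h : eta_non ^+ 2 <= 1 by apply: exprn_ile1; [rewrite ltW // eta_non_gt0|exact: eta_non_le1].
by rewrite /c_non; move: h; set x := eta_non ^+ 2; lra.
Qed.

Lemma c_ext_le1 : c_ext <= 1.
Proof.
have h : (100^-1 / 2) ^+ 2 <= 1 :> R by apply: exprn_ile1; lra.
by rewrite /c_ext; move: h; set x := (_ / 2) ^+ 2; lra.
Qed.

Lemma gap_arith (N a b k : R) : 0 <= N -> a + b = N -> a <= (1 / 2 + 6 * mu_ext) * N -> k = a - b ->
  k <= eps_ext / 2 * N.
Proof.
move=> N0 h1 h2 ->; have := ler_wpM2r N0 mu_ext_le; have := ltW eps_ext_gt0 => e0.
have := mulr_ge0 e0 N0; rewrite !(mulrDl _ _ N) in h2 *; move: mu_ext eps_ext h2 => mu e; lra.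
Qed.

Lemma side_arith (N a : R) : 0 <= N -> (1 / 2 - 6 * mu_ext) * N <= a -> N <= 3 * a.
Proof.
move=> N0 h; have := ler_wpM2r N0 mu_ext_le600; move: mu_ext h => mu; lra.
Qed.

End Constants.

Lemma div16_lt_third N a : 0 < N -> N <= 3 * a -> N %/ 16 < a.
Proof. by move=> N0 h; rewrite ltn_divLR //; lia. Qed.

Lemma quarter_le N a b : 3200 <= N -> N <= 3 * a -> a <= b + 2 -> N <= 4 * b.
Proof. lia. Qed.

Lemma card_setD2_ge (T : finType) (A : {set T}) x y : #|A| <= #|A :\ x :\ y| + 2.
Proof.
rewrite (cardsD1 x A) (cardsD1 y (A :\ x)) addnA [leqRHS]addnC leq_add2r.
by case: (x \in A); case: (y \in _).
Qed.

Section Assembly.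
Variables (R : realFieldType) (V : finType) (EG : {set {set V}}).
Local Notation n := #|V|.
Local Notation g := (adjE EG).
Hypotheses (card2 : forall e, e \in EG -> #|e| = 2) (gdeg : forall x, n <= 2 * #|[set y | g x y]|).
Variables (p1 p2 K : R) (m : nat).
Hypotheses (hp1 : (0 <= p1 <= 1)%R) (hp2 : (0 <= p2 <= 1)%R) (m2 : 1 < m).
Hypothesis hp2K : ((64 * (trunc_log 2 n).+1%:R + m%:R ^+ 2) * (K / n%:R) <= p2)%R.

Let fail (W : {set {set V}}) : R := (~~ has_ham_cycle (W :&: EG))%:R%R.

Lemma fail_le1 W : (fail W <= 1)%R. Proof. by rewrite /fail; case: (~~ _); rewrite ?lexx. Qed.

Lemma fail_finish (E1 ET F W1 : {set {set V}}) (c eps : R) r : (0 < c <= 1)%R -> (2 <= r%:R * eps)%R ->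
  (spread_const c r <= K)%R -> 2 < n -> E1 \subset ET -> switchable E1 ET F c eps ->
  (#|F|%:R <= eps / 2 * n%:R)%R -> n ^ (n - #|F|) <= 256 ^ n * #|hamset F ET| ->
  E1 \subset EG -> F \subset EG -> F \subset W1 ->
  (Ebern p2 (fun W2 => fail (W1 :|: W2)) <= 3 / m%:R)%R.
Proof.
move=> /andP[c0 c1] hr hK n3 E1T sw hF hT E1G FG FW.
have n0R : (0 < n%:R :> R)%R by rewrite ltr0n; exact: leq_trans n3.
have hF' : (#|F|%:R <= eps * n%:R)%R.
  have F0 : (0 <= #|F|%:R :> R)%R by [].
  by apply: (le_trans hF); move: hF F0; rewrite -mulrA mulrCA mulrC; move: (eps * n%:R)%R => x; lra.
have hT' : (n%:R ^+ (n - #|F|) <= 256 ^+ n * #|hamset F ET|%:R :> R)%R.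
  by rewrite -!natrX -natrM ler_nat.
have C21 : (1 <= 256 :> R)%R by rewrite ler1n.
have [N0 hs] := hamset_spread c0 n3 E1T sw hF' c1 C21 hr hF hT'.
rewrite -/(spread_const c r) in hs.
have q0 : (0 < spread_const c r / n%:R)%R by rewrite divr_gt0 // spread_const_gt0.
have hsz (s : n.-tuple V) : s \in hamset F E1 -> #|cycle_edges s :\: F| <= n.
  move=> _; apply: leq_trans (subset_leq_card (subsetDl _ _)) _.
  by apply: leq_trans (card_cycle_edges _) _; rewrite size_tuple.
have hp : ((64 * (trunc_log 2 n).+1%:R + m%:R ^+ 2) * (spread_const c r / n%:R) <= p2)%R.
  apply: le_trans hp2K; rewrite ler_wpM2l //; last by rewrite ler_wpM2r ?invr_ge0.
  by rewrite addr_ge0 // ?mulr_ge0 // exprn_ge0.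
have [p20 p21] := andP hp2.
apply: le_trans (spread_uncovered q0 N0 m2 hs hsz hp p21).
apply: Ebern_le => // W2; rewrite /fail ler_nat.
case: (boolP (uncovered _ _ _)) => [_|]; first by case: (~~ _).
rewrite negbK => /existsP [s /andP[sH sub]].
rewrite (_ : has_ham_cycle _) //; apply/existsP; exists s.
move: sH; rewrite inE => /and3P[-> Fs sE] /=.
rewrite subsetI; apply/andP; split; last by apply: subset_trans sE _; rewrite subUset E1G.
apply/subsetP => e es; rewrite inE; case: (boolP (e \in F)) => [/(subsetP FW) -> //|eF].
by rewrite (subsetP sub) ?orbT // inE eF.
Qed.

Lemma fail_expect (bad : {set {set V}} -> bool) (b e : R) : (0 <= e)%R ->
  (forall W1, ~~ bad W1 -> (Ebern p2 (fun W2 => fail (W1 :|: W2)) <= e)%R) ->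
  (Ebern p1 (fun W => (bad W)%:R) <= b)%R ->
  (Ebern p1 (fun W1 => Ebern p2 (fun W2 => fail (W1 :|: W2))) <= b + e)%R.
Proof.
move=> e0 h hb; apply: (@le_trans _ _ (Ebern p1 (fun W => (bad W)%:R + e))%R).
  apply: Ebern_le => // W1; case: (boolP (bad W1)) => [_|/h hW]; last by rewrite add0r.
  apply: (@le_trans _ _ 1%R); last by rewrite lerDl.
  rewrite -[leRHS](EbernC {set V} p2); apply: Ebern_le => // W2; exact: fail_le1.
by rewrite EbernD EbernC lerD2r.
Qed.

Variables (r1 r2 : nat).
Hypotheses (hr1 : (2 <= r1%:R * eps_non R)%R) (hr2 : (2 <= r2%:R * eps_ext R)%R).
Hypotheses (K1 : (spread_const (c_non R) r1 <= K)%R) (K2 : (spread_const (c_ext R) r2 <= K)%R).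
Hypotheses (nbig1 : (400 <= eta_non R ^+ 2 * n%:R)%R) (nbig2 : 3200 <= n).
Hypothesis (p1small : (n.+1%:R ^+ 3 * (1 - p1) ^+ (n %/ 16) <= 1)%R).

Let n0 : 0 < n. Proof. exact: leq_trans nbig2. Qed.
Let n3 : 2 < n. Proof. exact: leq_trans nbig2. Qed.
Let n0R : (0 < n%:R :> R)%R. Proof. by rewrite ltr0n. Qed.
Let e30 : (0 <= 3 / m%:R :> R)%R. Proof. by rewrite divr_ge0. Qed.

Lemma fail_nonextremal :
  (forall S T : {set V}, ((1 / 2 - eta_non R) * n%:R <= #|S|%:R)%R -> ((1 / 2 - eta_non R) * n%:R <= #|T|%:R)%R ->
    (eta_non R * n%:R ^+ 2 <= #|adjPairs g S T|%:R)%R) ->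
  (Ebern p1 (fun W1 => Ebern p2 (fun W2 => fail (W1 :|: W2))) <= n.+1%:R^-1 + 3 / m%:R)%R.
Proof.
move=> hno; apply: (@fail_expect pred0) => // [W1 _|]; last first.
  by rewrite (EbernC {set V} p1 0%R) invr_ge0.
have heta : (0 < eta_non R <= 1)%R by rewrite eta_non_gt0 eta_non_le1.
have sw := nonextremal_switchable (adjE_irr card2) gdeg hno heta nbig1 n3.
apply: (@fail_finish EG setT set0 W1 (c_non R) (eps_non R) r1); rewrite ?sub0set ?subsetT //.
- by rewrite c_non_gt0 c_non_le1.
- by rewrite cards0 mulr_ge0 // divr_ge0 // ltW // eps_non_gt0.
- by rewrite cards0 subn0; exact: hamset_setT.
Qed.

Section Coloured.
Variables (col : V -> bool) (flag : bool).
Hypotheses (bal : balanced col (6 * mu_ext R)%R)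
  (hdef : (#|defects g col flag|%:R <= 23 * mu_ext R * n%:R ^+ 2)%R)
  (hdeg : forall x, (100^-1 * n%:R <= (degT g col flag x)%:R :> R)%R).

Definition tmpl_part := EG :&: tmpl_edges col flag.

Lemma tmpl_partE x y : adjE tmpl_part x y = tmpl col flag x y && g x y.
Proof. by rewrite /adjE /tmpl_part inE tmpl_edgesE andbC. Qed.

Lemma class_large : n <= 3 * #|classT col| /\ n <= 3 * #|~: classT col|.
Proof.
have [h1 h2] := bal; have N0 := ltW n0R.
have E : (#|classT col|%:R + #|~: classT col|%:R = n%:R :> R)%R by rewrite -natrD cardsC.
have arith (a b N c : R) : (a + b = N -> a <= (1 / 2 + c) * N -> (1 / 2 - c) * N <= b)%R by lra.
by split; rewrite -(ler_nat R) natrM; apply: side_arith => //; apply: arith E h2.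
Qed.

(** Atypical vertices have more than eps n defects each, and there are at most 23 mu n^2 <= eps^2
    n^2 defects in all, so at most eps n vertices are atypical. *)
Lemma coloured_switchable F : switchable tmpl_part (tmpl_edges col flag) F (c_ext R) (eps_ext R).
Proof.
apply: (@extremal_switchable R V col flag tmpl_part F 100^-1%R (eps_ext R)) => //.
- by move=> x; rewrite tmpl_partE (adjE_irr card2) andbF.
- exact: subsetIr.
- move=> x; apply: le_trans (hdeg x) _; rewrite ler_nat; apply: subset_leq_card.
  by apply/subsetP => y; rewrite !inE tmpl_partE.
- set at_ := atypical _ _ _ _.
  have h : (#|at_|%:R * (eps_ext R * n%:R) <= #|defects g col flag|%:R)%R.
    rewrite /defects (card_rel (fun x y => tmpl col flag x y && ~~ g x y)) natr_sum.
    apply: (@le_trans _ _ (\sum_(x in at_) eps_ext R * n%:R)%R).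
      by rewrite sumr_const -[leRHS]mulr_natl.
    rewrite [leLHS]big_mkcond; apply: ler_sum => x _; case: ifP => // hx.
    move: hx; rewrite inE => /ltW /le_trans; apply; rewrite ler_nat; apply: subset_leq_card.
    by apply/subsetP => y; rewrite !inE tmpl_partE; case: (tmpl col flag x y).
  have en : (0 < eps_ext R * n%:R)%R by rewrite mulr_gt0 // eps_ext_gt0.
  rewrite -(ler_pM2r en); apply: (le_trans h); apply: (le_trans hdef).
  have -> : (eps_ext R * n%:R * (eps_ext R * n%:R) = eps_ext R ^+ 2 * n%:R ^+ 2)%R by rewrite -exprMn expr2.
  rewrite ler_wpM2r ?exprn_ge0 // /mu_ext.
  have : (0 <= eps_ext R ^+ 2)%R by apply: sqr_ge0.
  by move: (eps_ext R ^+ 2)%R => x; lra.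
- move=> x; apply: le_trans (tmpl_deg flag x bal); rewrite ler_wpM2r ?ltW //.
  by have := mu_ext_le600 R; lra.
- exact: eps_ext_gt0.
- by rewrite /eps_ext; lra.
- by lra.
rewrite /eps_ext mulrC ler_pdivlMr // mul1r ler_nat; exact: leq_trans nbig2.
Qed.

End Coloured.

Lemma fail_differ col : balanced col (6 * mu_ext R)%R ->
  (#|defects g col true|%:R <= 23 * mu_ext R * n%:R ^+ 2)%R ->
  (forall x, (100^-1 * n%:R <= (degT g col true x)%:R :> R)%R) ->
  #|~: classT col| <= #|classT col| ->
  (#|classT col| - #|~: classT col| <= 1 \/
     forall x, col x -> ((degIn g col x)%:R <= 50^-1 * n%:R :> R)%R) ->
  (Ebern p1 (fun W1 => Ebern p2 (fun W2 => fail (W1 :|: W2))) <= n.+1%:R^-1 + 3 / m%:R)%R.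
Proof.
move=> bal hdef hdeg hle hmax; set k := _ - _ in hmax.
have [cA cB] := class_large bal.
have nAB := cardsC (classT col).
pose bad W := (0 < k) && [exists Z : {set V}, (#|Z| <= 2 * k.-1) && (W :&: insideAvoid EG col Z == set0)].
apply: (@fail_expect bad) => // [W1 nbad|]; last first.
  case: (posnP k) => [k0|k0].
    rewrite /bad k0 /= (EbernC {set V} p1 0%R); by rewrite invr_ge0.
  rewrite /bad k0 /=; apply: prob_no_matching => //.
  - by rewrite -nAB mul2n -addnn leq_add2l.
  (* The degree is at least n/2, the smaller class takes at most its size, and n equals k plus twice
     that size; so the inner degree is at least k/2. *)
  move=> x cx; have h : #|[set y | g x y]| <= degIn g col x + #|~: classT col|.
    apply: leq_trans (leq_card_setU _ _); apply: subset_leq_card; apply/subsetP => y.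
    by rewrite !inE => ->; case: (col y).
  rewrite /k leq_subLR -(leq_add2r #|~: classT col|) nAB.
  apply: leq_trans (gdeg x) _; apply: (@leq_trans (2 * (degIn g col x + #|~: classT col|))).
    by rewrite leq_mul2l h.
  by rewrite mulnDr (mul2n #|_|) -addnn addnA [_ + 2 * _]addnC.
have [mt [smt umt cmt mtW]] : exists mt, [/\ size mt = k, uniq (pair_verts mt), all col (pair_verts mt) &
    pair_edges mt \subset W1 :&: EG].
  have [//|[Z hZ h]] := greedy_matching card2 col W1 k.
  case: (posnP k) => k0; last first.
    by case/negP: nbad; rewrite /bad k0; apply/existsP; exists Z; rewrite hZ h.
  by exists [::]; rewrite k0; split=> //; apply/subsetP => e; rewrite inE.
have hF : #|pair_edges mt| = k by rewrite card_pair_edges.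
apply: (@fail_finish (tmpl_part col true) (tmpl_edges col true) (pair_edges mt) W1 (c_ext R) (eps_ext R) r2) => //.
- by rewrite c_ext_gt0 c_ext_le1.
- exact: subsetIr.
- exact: coloured_switchable.
- rewrite hF; have [_ h2] := bal; apply: (gap_arith (ltW n0R) _ h2 (b := #|~: classT col|%:R)).
    by rewrite -natrD nAB.
  by rewrite /k natrB.
- apply: hamset_differ => //.
  + by rewrite lt0n; apply/eqP => E; move: cB n0; rewrite E muln0 leqn0 => /eqP ->.
  + by rewrite smt subnKC.
  + by apply: leq_trans cB _; rewrite leq_mul2r orbT.
- exact: subsetIl.
- by apply: subset_trans mtW _; apply: subsetIr.
- by apply: subset_trans mtW _; apply: subsetIl.
Qed.

Lemma fail_same col : balanced col (6 * mu_ext R)%R ->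
  (#|defects g col false|%:R <= 23 * mu_ext R * n%:R ^+ 2)%R ->
  (forall x, (100^-1 * n%:R <= (degT g col false x)%:R :> R)%R) ->
  (Ebern p1 (fun W1 => Ebern p2 (fun W2 => fail (W1 :|: W2))) <= n.+1%:R^-1 + 3 / m%:R)%R.
Proof.
move=> bal hdef hdeg.
have [cA cB] := class_large bal.
apply: (@fail_expect (fun W => [exists z, W :&: crossAvoid EG col z == set0])) => // [W1 nbad|]; last first.
  by apply: prob_no_two_crossing => //; apply: div16_lt_third.
have /card_gt0P [z0 _] := n0.
have [[x1 [x2 [y1 [y2 [x12 y12 /and4P[cx1 cx2 cy1 cy2] e1 e2]]]]]|[z _ h]] := two_crossing EG col W1 z0;
  last by case/negP: nbad; apply/existsP; exists z.
pose F := [set [set x1; y1]; [set x2; y2]].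
have hF : #|F| = 2.
  rewrite cards2; case: eqP => // /set2_eq [[E _]|[E _]]; first by rewrite E eqxx in x12.
  by rewrite E (negPf cy2) in cx1.
have FWG : F \subset W1 :&: EG by apply/subsetP => e; rewrite in_set2 => /orP[] /eqP ->.
apply: (@fail_finish (tmpl_part col false) (tmpl_edges col false) F W1 (c_ext R) (eps_ext R) r2) => //.
- by rewrite c_ext_gt0 c_ext_le1.
- exact: subsetIr.
- exact: coloured_switchable.
- rewrite hF /eps_ext.
  have : (3200 <= n%:R :> R)%R by rewrite ler_nat.
  by move: (n%:R)%R => N; lra.
- rewrite hF; apply: hamset_same => //.
  + apply: (quarter_le nbig2 cA); apply: card_setD2_ge.
  + apply: (quarter_le nbig2 cB); apply: card_setD2_ge.
- exact: subsetIl.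
- by apply: subset_trans FWG _; apply: subsetIr.
- by apply: subset_trans FWG _; apply: subsetIl.
Qed.

Lemma fail_dirac :
  (Ebern p1 (fun W1 => Ebern p2 (fun W2 => fail (W1 :|: W2))) <= n.+1%:R^-1 + 3 / m%:R)%R.
Proof.
have [hex|hno] := boolP [exists S : {set V}, [exists T : {set V},
   [&& ((1 / 2 - eta_non R) * n%:R <= #|S|%:R)%R, ((1 / 2 - eta_non R) * n%:R <= #|T|%:R)%R &
     (#|adjPairs g S T|%:R < eta_non R * n%:R ^+ 2)%R]]]; last first.
  apply: fail_nonextremal => S T hS hT; rewrite leNgt; apply: contra hno => h.
  by apply/existsP; exists S; apply/existsP; exists T; rewrite hS hT h.
case/existsP: hex => S /existsP [T /and3P[hS hT /ltW he]].
have hmu : (0 < mu_ext R <= 600^-1)%R by rewrite mu_ext_gt0 mu_ext_le600.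
have [col [flag [bal hdef hdeg hfl]]] := extremal_structure (@adjEC V EG) gdeg n0 hmu hS hT he.
case: flag hdef hdeg hfl => hdef hdeg hfl; last exact: fail_same bal hdef hdeg.
by have [hle hmax] := hfl isT; apply: fail_differ bal hdef hdeg hle hmax.
Qed.

End Assembly.

Local Open Scope ring_scope.

(** The two exposures together form one random set of density p1 + p2 - p1 p2 <= p, and containing a
    Hamiltonian cycle is a monotone property. *)
Lemma Ebern_has_ham_cycle (R : realFieldType) (V : finType) (EG : {set {set V}}) (p1 p2 p K : R) (m r1 r2 : nat) :
  (forall e, e \in EG -> #|e| = 2%N) -> (forall x, #|V| <= 2 * #|[set y | adjE EG x y]|)%N ->
  0 <= p1 <= 1 -> 0 <= p2 <= 1 -> p1 + p2 - p1 * p2 <= p <= 1 -> (1 < m)%N ->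
  (64 * (trunc_log 2 #|V|).+1%:R + m%:R ^+ 2) * (K / #|V|%:R) <= p2 ->
  #|V|.+1%:R ^+ 3 * (1 - p1) ^+ (#|V| %/ 16) <= 1 ->
  2 <= r1%:R * eps_non R -> 2 <= r2%:R * eps_ext R ->
  spread_const (c_non R) r1 <= K -> spread_const (c_ext R) r2 <= K ->
  400 <= eta_non R ^+ 2 * #|V|%:R -> (3200 <= #|V|)%N ->
  1 - (#|V|.+1%:R^-1 + 3 / m%:R) <= Ebern p (fun W => (has_ham_cycle (W :&: EG))%:R).
Proof.
move=> card2 gdeg hp1 hp2 /andP[hpp p1'] m2 hK hs hr1 hr2 K1 K2 n1 n2.
pose bad (W : {set {set V}}) : R := (~~ has_ham_cycle (W :&: EG))%:R.
have h : Ebern p1 (fun A => Ebern p2 (fun B => bad (A :|: B))) <= #|V|.+1%:R^-1 + 3 / m%:R.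
  by have := fail_dirac card2 gdeg hp1 hp2 m2 hK hr1 hr2 K1 K2 n1 n2 hs.
rewrite (EbernU _ _ bad) in h; set q := p1 + p2 - p1 * p2 in hpp h.
have q0 : 0 <= q.
  have /andP[p10 p11] := hp1; have /andP[p20 p21] := hp2.
  have -> : q = p1 * (1 - p2) + p2 by rewrite /q; ring.
  by rewrite addr_ge0 // mulr_ge0 // subr_ge0.
pose f (W : {set {set V}}) : R := (has_ham_cycle (W :&: EG))%:R.
have fE : Ebern q f = 1 - Ebern q bad.
  rewrite -[X in X - _](EbernC {set V} q) -EbernN -EbernD; apply: eq_bigr => W _; congr (_ * _).
  by rewrite /f /bad; case: has_ham_cycle; rewrite ?subr0 ?subrr.
apply: (@le_trans _ _ (Ebern q f)); first by rewrite fE lerD2l lerN2.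
apply: Ebern_mono => // A B AB; rewrite /f ler_nat.
case: (boolP (has_ham_cycle (A :&: EG))) => // /existsP [s /andP[us sub]].
rewrite (_ : has_ham_cycle _) //; apply/existsP; exists s; rewrite us /=.
by apply: subset_trans sub _; apply: setSI.
Qed.

From mathcomp Require Import all_classical all_reals all_analysis.
Require Import Defs.
Import numFieldNormedType.Exports.

Local Open Scope classical_set_scope.
Local Open Scope ring_scope.

(** * The random subgraph, the choice of densities and the limit *)

Lemma hamiltonianE (V : finType) (H : sgraph V) : (2 < #|V|)%N ->
  hamiltonian H <-> has_ham_cycle (edges H).
Proof.
move=> V3; split=> [[c [_ hc uc cV]]|/existsP [s /andP[us]]].
  have sz : size c == #|V|.
    by rewrite -(card_uniqP uc); apply/eqP/eq_card => x; rewrite cV.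
  by apply/existsP; exists (Tuple sz); rewrite uc cycle_edges_subset.
rewrite cycle_edges_subset => hc; exists s; split=> //; first by rewrite size_tuple.
move=> x; have /subset_cardP : #|s| = #|V| by rewrite (card_uniqP us) size_tuple.
by move=> /(_ (subset_predT _)) ->.
Qed.

(** The random subgraph of G has the edge set W :&: edges G, where W is a random set of arbitrary
    vertex sets. *)
Lemma Gp_prob_Ebern (R : realType) (V : finType) (G : sgraph V) (p : R) (A : sgraph V -> Prop)
    (b : {set {set V}} -> bool) : (forall H, A H <-> b (edges H)) ->
  Gp_prob G p A = Ebern p (fun W => (b (W :&: edges G))%:R).
Proof.
move=> hA; rewrite /Ebern (sum_bmass_inter p (edges G) (fun E => (b E)%:R)) /Gp_prob /Gp_mass.
(* Every subset of [edges G] is the edge set of a graph, so the default value [G] of [insubd] does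
   not occur there. *)
rewrite (reindex_onto (fun H : sgraph V => edges H) (insubd G)) /=; last first.
  move=> E EG; apply: insubdK; apply/forall_inP => e /(fintype.subsetP EG) eG.
  by have /forall_inP := edgesP G; apply.
rewrite big_mkcond [RHS]big_mkcond /=; apply: eq_bigr => H _.
rewrite (valKd G H) eqxx andbT (_ : `[< A H >] = b (edges H)); last by apply/asboolP/idP => /hA.
by case: (b _); case: ifP => //= _; rewrite ?mulr1 ?mulr0.
Qed.

Lemma Gp_prob_le1 (R : realType) (V : finType) (G : sgraph V) (p : R) (A : sgraph V -> Prop) :
  0 <= p <= 1 -> Gp_prob G p A <= 1.
Proof.
move=> hp; pose b (E : {set {set V}}) := `[< A (insubd G E) >].
have hA H : A H <-> b (edges H) by rewrite /b (valKd G H); split => /asboolP.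
rewrite (Gp_prob_Ebern G p hA) -[leRHS](EbernC {set V} p); apply: Ebern_le => // W.
by case: (b _).
Qed.

Lemma min_degree_le (V : finType) (G : sgraph V) x : (min_degree G <= degree G x)%N.
Proof.
rewrite /min_degree; elim: index_enum (mem_index_enum x) => // y r IH.
rewrite in_cons big_cons geq_min => /orP[/eqP -> | /IH ->]; last exact: orbT.
by rewrite leqnn.
Qed.

Section Exposure.
Variable R : realType.
Implicit Types (p K : R) (n m : nat).

Lemma half_le_ln2 : 2^-1 <= ln 2 :> R.
Proof.
have h : ln (1 + - 2^-1) <= - 2^-1 :> R by apply: le_ln1Dx; lra.
move: h; rewrite (_ : 1 + - 2^-1 = 2^-1); last by lra.
by rewrite lnV ?posrE // lerN2.
Qed.

Lemma trunc_log_le_ln n : (0 < n)%N -> (trunc_log 2 n)%:R <= 2 * ln n%:R :> R.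
Proof.
move=> n0; have h : (trunc_log 2 n)%:R * ln 2 <= ln n%:R :> R.
  rewrite mulr_natl -lnXn // ler_ln ?posrE ?exprn_gt0 ?ltr0n //.
  by rewrite -natrX ler_nat trunc_logP.
have := ler_wpM2l (ler0n R (trunc_log 2 n)) half_le_ln2; lra.
Qed.

(* [1 - p <= expR (- p)] and [n <= 32 * (n %/ 16)]. *)
Lemma expr_bern_le n p : (32 <= n)%N -> 192 * ln n%:R / n%:R <= p -> p <= 1 ->
  n.+1%:R ^+ 3 * (1 - p) ^+ (n %/ 16) <= 1.
Proof.
move=> n32 hp p1; have n0 : (0 < n)%N by exact: leq_trans n32.
have N0 : 0 < n%:R :> R by rewrite ltr0n.
set k := (n %/ 16)%N.
have L0 : 0 <= ln n%:R :> R by rewrite ln_ge0 // ler1n.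
have hk : n%:R <= 32 * k%:R :> R by rewrite -natrM ler_nat /k; lia.
have hpk : 6 * ln n%:R <= p * k%:R.
  have h1 : 192 * ln n%:R <= p * n%:R by rewrite -ler_pdivrMr.
  have p0 : 0 <= p by apply: le_trans hp; rewrite divr_ge0 // mulr_ge0.
  have := ler_wpM2l p0 hk; lra.
have h1 : (1 - p) ^+ k <= (n%:R ^+ 6)^-1.
  apply: (@le_trans _ _ (expR (- p) ^+ k)).
    by apply: lerXn2r; rewrite ?nnegrE ?subr_ge0 ?expR_ge0 // expR_ge1Dx.
  rewrite -expRM_natr -[leRHS]lnK ?posrE ?invr_gt0 ?exprn_gt0 //.
  rewrite ler_expR lnV ?posrE ?exprn_gt0 // lnXn // mulNr lerN2 -[leLHS]mulr_natl.
  exact: hpk.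
have h2 : n.+1%:R ^+ 3 <= n%:R ^+ 6 :> R.
  rewrite (_ : 6 = 2 * 3)%N // exprM; apply: lerXn2r; rewrite ?nnegrE ?exprn_ge0 //.
  by rewrite -natrX ler_nat; nia.
apply: (@le_trans _ _ (n.+1%:R ^+ 3 * (n%:R ^+ 6)^-1)).
  by rewrite ler_wpM2l // exprn_ge0.
by rewrite ler_pdivrMr ?exprn_gt0 // mul1r.
Qed.

(** The share 192 log n/n makes the first exposure strong enough to find F; the remaining 258 K log
    n/n pays for all fragmentation rounds. *)
Lemma split_bern K n m p : 0 <= K -> (1 < m)%N -> (2 ^ (m ^ 2) <= n)%N -> (32 <= n)%N ->
  (192 + 258 * K) * ln n%:R / n%:R <= p <= 1 ->
  exists p1 p2 : R, [/\ 0 <= p1 <= 1, 0 <= p2 <= 1, p1 + p2 - p1 * p2 <= p,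
    (64 * (trunc_log 2 n).+1%:R + m%:R ^+ 2) * (K / n%:R) <= p2 &
    n.+1%:R ^+ 3 * (1 - p1) ^+ (n %/ 16) <= 1].
Proof.
move=> K0 m2 mn n32 /andP[hp p1].
have n0 : (0 < n)%N by exact: leq_trans n32.
have N0 : 0 < n%:R :> R by rewrite ltr0n.
have mt : (m ^ 2 <= trunc_log 2 n)%N by rewrite trunc_log_max.
have t1 : (1 <= trunc_log 2 n)%N by apply: leq_trans mt; rewrite expn_gt0 (ltnW m2).
have tL := trunc_log_le_ln n0.
have L0 : 0 <= ln n%:R :> R by rewrite ln_ge0 // ler1n.
have K'0 : 0 <= K / n%:R by rewrite divr_ge0 // ltW.
(* With t = [trunc_log 2 n], both 1 and m^2 are at most t, so the left side is at most 129 t, and t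
   <= 2 ln n. *)
have hc : 64 * (trunc_log 2 n).+1%:R + m%:R ^+ 2 <= 258 * ln n%:R :> R.
  have h1 : m%:R ^+ 2 <= (trunc_log 2 n)%:R :> R by rewrite -natrX ler_nat.
  have h2 : 1 <= (trunc_log 2 n)%:R :> R by rewrite ler1n.
  rewrite -natr1; lra.
exists (192 * ln n%:R / n%:R), ((64 * (trunc_log 2 n).+1%:R + m%:R ^+ 2) * (K / n%:R)).
set q1 := 192 * _ / _; set q2 := (64 * _ + _) * _.
have q10 : 0 <= q1 by rewrite divr_ge0 ?mulr_ge0 // ltW.
have q20 : 0 <= q2 by rewrite mulr_ge0 // addr_ge0 ?mulr_ge0 ?exprn_ge0.
have q12 : q1 + q2 <= p.
  apply: le_trans hp; have := ler_wpM2r K'0 hc; rewrite -/q2 => h.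
  have -> : (192 + 258 * K) * ln n%:R / n%:R = q1 + 258 * ln n%:R * (K / n%:R).
    by rewrite /q1; ring.
  by rewrite lerD2l.
have q120 := mulr_ge0 q10 q20.
split=> //; try by apply/andP; split; lra.
- by lra.
- by apply: expr_bern_le => //; lra.
Qed.

End Exposure.

Theorem theorem1p1 (R : realType) :
  exists C : R, 0 < C /\
    forall (p : nat -> R) (G : forall n : nat, sgraph 'I_n),
      (\forall n \near \oo,
         C * ln n%:R / n%:R <= p n <= 1 /\
         n%:R / 2 <= (min_degree (G n))%:R :> R) ->
      (fun n : nat => Gp_prob (G n) (p n) (@hamiltonian 'I_n)) @ \oo --> (1 : R).
Proof.
have bound_inv (a e : R) : 0 < e -> 0 <= a -> exists r : nat, a <= r%:R * e.
  move=> e0 a0; exists (Num.bound (a / e)); rewrite -ler_pdivrMr //.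
  by apply/ltW/archi_boundP; rewrite divr_ge0 // ltW.
have [r1 hr1] := bound_inv 2 _ (eps_non_gt0 R) (ler0n _ _).
have [r2 hr2] := bound_inv 2 _ (eps_ext_gt0 R) (ler0n _ _).
have [N1 hN1] := bound_inv 400 _ (exprn_gt0 2 (eta_non_gt0 R)) (ler0n _ _).
have k1 := spread_const_gt0 r1 (c_non_gt0 R); have k2 := spread_const_gt0 r2 (c_ext_gt0 R).
set K := spread_const (c_non R) r1 + spread_const (c_ext R) r2.
have K0 : 0 <= K by rewrite addr_ge0 // ltW.
have C0 : 0 < 192 + 258 * K by rewrite ltr_wpDr ?mulr_ge0 ?ltr0n ?ler0n.
exists (192 + 258 * K); split; first exact: C0.
move=> p G hpG; apply/cvgrPdist_le => e e0.
have [m0 hm0] := bound_inv 6 e e0 (ler0n _ _).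
(* [m] depends on the error e only, so the failure bound 1/(n+1) + 3/m splits into two halves of e
   once n is large; the same constant C serves all m because m^2 <= log_2 n eventually. *)
pose m := maxn 2 m0.
have hm : 3 / m%:R <= e / 2.
  have m0' : 0 < m%:R :> R by rewrite ltr0n leq_max.
  rewrite ler_pdivrMr //.
  have : m0%:R * e <= m%:R * e by rewrite ler_pM2r // ler_nat leq_maxr.
  lra.
have [N2 hN2] := bound_inv 2 e e0 (ler0n _ _).
near=> n.
have [hp hd] : (192 + 258 * K) * ln n%:R / n%:R <= p n <= 1 /\ n%:R / 2 <= (min_degree (G n))%:R :> R by near: n.
have n1 : (3200 <= n)%N by near: n; exact: nbhs_infty_ge.
have n2 : (2 ^ (m ^ 2) <= n)%N by near: n; exact: nbhs_infty_ge.
have n3 : (N1 <= n)%N by near: n; exact: nbhs_infty_ge.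
have n4 : (N2 <= n)%N by near: n; exact: nbhs_infty_ge.
have n32 : (32 <= n)%N by exact: leq_trans n1.
have m2 : (1 < m)%N by rewrite leq_max.
have [p1 [p2 [hp1 hp2 hpp hK hs]]] := split_bern K0 m2 n2 n32 hp.
have /andP[_ pn1] := hp.
have pn0 : 0 <= p n <= 1.
  apply/andP; split=> //; apply: le_trans hpp.
  have /andP[p10 p11] := hp1; have /andP[p20 p21] := hp2.
  have -> : p1 + p2 - p1 * p2 = p1 * (1 - p2) + p2 by ring.
  by rewrite addr_ge0 // mulr_ge0 // subr_ge0.
rewrite ger0_norm; last by rewrite subr_ge0 Gp_prob_le1.
have V3 : (2 < #|'I_n|)%N by rewrite card_ord; exact: leq_trans n32.
rewrite (Gp_prob_Ebern _ _ (fun H => hamiltonianE H V3)).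
have card2 f : f \in edges (G n) -> #|f| = 2%N.
  by move=> fG; apply/eqP; have /forall_inP := edgesP (G n); apply.
have gdeg x : (#|'I_n| <= 2 * degree (G n) x)%N.
  rewrite card_ord -(ler_nat R) natrM mulrC -ler_pdivrMr //; apply: le_trans hd _.
  by rewrite ler_nat; exact: min_degree_le.
have := @Ebern_has_ham_cycle R 'I_n (edges (G n)) p1 p2 (p n) K m r1 r2 card2 gdeg hp1 hp2.
rewrite card_ord hpp pn1 => /(_ isT m2 hK hs hr1 hr2) h.
have {}h : 1 - (n.+1%:R^-1 + 3 / m%:R) <= Ebern (p n) (fun W => (has_ham_cycle (W :&: edges (G n)))%:R).
  apply: h => //.
  - by rewrite lerDl ltW.
  - by rewrite lerDr ltW.
  - by apply: le_trans hN1 _; rewrite mulrC ler_wpM2l ?exprn_ge0 ?(ltW (eta_non_gt0 R)) // ler_nat.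
have hn : n.+1%:R^-1 <= e / 2.
  rewrite invf_ple ?posrE ?divr_gt0 ?ltr0n // invf_div.
  rewrite ler_pdivrMr //; apply: le_trans hN2 _; rewrite ler_pM2r // ler_nat.
  exact: leq_trans n4 _.
have arith (a b c d : R) : 1 - (a + b) <= c -> a <= d / 2 -> b <= d / 2 -> 1 - c <= d by lra.
exact: arith h hn hm.
Unshelve. all: by end_near. Qed.
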